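(* There exist planar graphs that do not admit a $3$-page book embedding.
   Context: Let $G=(V,E)$ be a finite simple undirected graph. A vertex ordering $\prec$ of $G$ is a total order of $V$. Two edges $(x,y)$ and $(u,v)$ with no common endpoint, $x\prec y$, $u\prec v$, cross with respect to $\prec$ if $x\prec u\prec y\prec v$ or $u\prec x\prec v\prec y$. A $k$-page book embedding of $G$ is a pair $(\prec,\{E_1,\dots,E_k\})$ where $\prec$ is a vertex ordering of $G$ and $\{E_1,\dots,E_k\}$ is a partition of $E$ into $k$ sets (pages) such that no two edges in the same set cross with respect to $\prec$. *)

(* Defs.v *)
From HB Require Import structures.
From mathcomp Require Import all_boot all_order all_algebra.
From mathcomp Require Import all_classical all_reals all_analysis.

Set Implicit Arguments.
Unset Strict Implicit.
Unset Printing Implicit Defensive.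

Import Order.TTheory GRing.Theory Num.Theory.
Import numFieldNormedType.Exports.

Local Open Scope ring_scope.

Record sgraph := SGraph {
  vertex :> finType;
  adj : rel vertex;
  adj_sym : symmetric adj;
  adj_irrefl : irreflexive adj }.

(* An edge is the two-element set of its endpoints. *)
Definition edges (G : sgraph) : {set {set G}} :=
  [set e | [exists x, exists y, adj x y && (e == [set x; y]%SET)]]%SET.

Definition vertex_ordering (G : sgraph) (lt : rel G) : Prop :=
  [/\ irreflexive lt, transitive lt
    & forall x y : G, x != y -> lt x y || lt y x].

Definition cross (G : sgraph) (lt : rel G) (e f : {set G}) : Prop :=
  exists x y u v : G,
    [/\ e = [set x; y]%SET /\ f = [set u; v]%SET,
        [disjoint e & f],
        lt x y, lt u v
      & [&& lt x u, lt u y & lt y v] || [&& lt u x, lt x v & lt v y]].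

(* Pages may be empty, so that a graph with fewer than k edges, or one that
   can do with fewer than k pages, still has a k-page book embedding. *)
Definition book_embedding (G : sgraph) (k : nat)
    (lt : rel G) (page : 'I_k -> {set {set G}}) : Prop :=
  [/\ vertex_ordering lt,
      (\bigcup_(i < k) page i)%SET = edges G,
      forall i j : 'I_k, i != j -> [disjoint page i & page j]
    & forall (i : 'I_k) (e f : {set G}),
        e \in page i -> f \in page i -> ~ cross lt e f].

Definition admits_book_embedding (G : sgraph) (k : nat) : Prop :=
  exists (lt : rel G) (page : 'I_k -> {set {set G}}), book_embedding lt page.

(* [c] restricted to [0, 1] parametrizes a simple arc (continuous and injective
   on a compact interval, hence a homeomorphism onto its image) from p to q. *)
Definition simple_arc (R : realType) (c : R -> R * R) (p q : R * R) : Prop :=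
  [/\ {within `[0, 1], continuous c}%classic,
      {in `[0, 1] &, injective c},
      c 0 = p & c 1 = q].

(* A drawing in the plane: vertices are distinct points, edges are simple arcs
   joining their endpoints, and the interior of an arc contains no vertex and
   no interior point of another arc.  The values of [arc] outside [edges G]
   are irrelevant. *)
Definition plane_drawing (R : realType) (G : sgraph)
    (pos : G -> R * R) (arc : {set G} -> R -> R * R) : Prop :=
  [/\ injective pos,
      forall e : {set G}, e \in edges G ->
        exists x y : G, e = [set x; y]%SET
          /\ simple_arc (arc e) (pos x) (pos y),
      forall (e : {set G}) (v : G) (t : R),
        e \in edges G -> t \in `]0, 1[ -> arc e t <> pos v
    & forall (e f : {set G}) (s t : R),
        e \in edges G -> f \in edges G -> e != f ->
        s \in `]0, 1[ -> t \in `]0, 1[ -> arc e s <> arc f t].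

Definition planar (R : realType) (G : sgraph) : Prop :=
  exists (pos : G -> R * R) (arc : {set G} -> R -> R * R),
    plane_drawing pos arc.

(* Main.v *)
(* Take many copies of a planar graph P that share two vertices, the poles A and
   B. In a 3-page book embedding two of the copies have the same type: their
   vertices come in the same order on the spine, and corresponding edges have
   the same page. Let t and u be the two vertices 3 and 4 of P, adjacent to both
   poles. Rotating the spine puts A first; reflecting it, exchanging the copies
   and applying the automorphism of P that exchanges t and u leave five orders
   for A, B and the two copies of t and u. The edges tA and tB have distinct
   pages, since otherwise copy 1 of tA crosses copy 0 of tB. Each order is
   refuted by a finite tree of cases, which inserts more and more vertices of P
   and branches over their positions and over the pages of the edges.

   P consists of three octahedra through both poles, consecutive ones sharing a
   further vertex, with vertices stacked repeatedly into the triangular faces.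
   It is drawn with straight edges: the octahedra on a grid, every stacked vertex
   at the barycentre of its face. Copy j is flattened towards the line AB by a
   factor s ^ j, so that it lies inside the lowest triangle of each copy before
   it. *)
From Stdlib Require Import ZArith.
From Stdlib Require List Ascii String.
Require Import Defs.
From mathcomp Require Import all_boot all_order all_algebra.
From mathcomp Require Import all_classical all_reals all_analysis.
From mathcomp Require Import ssrZ zify ring lra.

Set Implicit Arguments. Unset Strict Implicit. Unset Printing Implicit Defensive.
Import Order.TTheory GRing.Theory Num.Theory.
Import numFieldNormedType.Exports.
Import String.StringSyntax.

(** Two copies of the same type say more than one. An edge has a single page for all its copies, so
    a crossing of any copy of one edge with any copy of another already forces different pages, and
    the order of copy 1 repeats that of copy 0. The other copies serve only the pigeonhole
    principle, which takes one copy more than there are types. That number is far too large for a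
    computation on the whole graph, and this shapes both halves of the proof. For the impossibility,
    only two copies are examined; the checker need only be sound: it keeps true partial information
    on an embedding, and a case tree in which no branch survives is a contradiction. For planarity,
    disjointness is expressed by separating lines. This form passes from a face to the pieces of its
    barycentric subdivision and, by rescaling one coordinate, from one copy to all of them, so that
    only the grid drawing of the octahedra has to be checked for separation by computation. *)

Local Notation In := List.In.

(** * The checker: partial configurations of two copies on the spine, refuted by case trees *)

Module Checker.
Local Open Scope nat_scope.

Inductive page := P1 | P2 | P3.
(** A set of pages, with one flag for each. *)
Inductive mask := Mask of bool & bool & bool.

(* Labels order the vertices placed on the spine. A label is a path from the root
   of the infinite binary tree, read from the low bit on (xO left, xI right, xH
   stop), and labels are compared in order, so that there is always a label
   between two labels ([lmid]). *)
Fixpoint llt (a b : positive) : bool :=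
  match a, b with
  | xO a', xO b' => llt a' b'
  | xO _, _ => true
  | xH, xI _ => true
  | xI a', xI b' => llt a' b'
  | _, _ => false
  end.
Fixpoint peq (a b : positive) : bool :=
  match a, b with
  | xO a', xO b' => peq a' b'
  | xI a', xI b' => peq a' b'
  | xH, xH => true
  | _, _ => false
  end.
Fixpoint lbefore (s : positive) :=
  match s with xI _ => xH | xH => xO xH | xO s' => xO (lbefore s') end.
Fixpoint lafter (s : positive) :=
  match s with xO _ => xH | xH => xI xH | xI s' => xI (lafter s') end.
Fixpoint lmid (a b : positive) :=
  match a, b with
  | xO a', xO b' => xO (lmid a' b')
  | xI a', xI b' => xI (lmid a' b')
  | xH, xI b' => xI (lbefore b')
  | xO a', xH => xO (lafter a')
  | _, _ => xH
  end.

(* A placed vertex: [key] encodes vertex and copy (see [key0], [key1]), [paired]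
   marks copy 0 of a vertex whose two copies are both placed, and [l1], [r1], ...
   are the labels of its neighbours to the left and right on each page, along
   the edges whose page is known. *)
Record item := Item { lab : positive; key : positive; paired : bool;
  l1 : seq positive; r1 : seq positive; l2 : seq positive; r2 : seq positive;
  l3 : seq positive; r3 : seq positive }.

(* The state of a sweep away from a vertex x on one page. [Blocked] means that an
   arc over x has been met, so that nothing further is visible from x; [Open s]
   that x sees the current slot if and only if s = [::], and otherwise again
   after the far ends s of the arcs now overhead. *)
Inductive open_arcs := Blocked | Open of seq positive.

Fixpoint anylt (x : positive) (s : seq positive) :=
  if s is z :: s' then (if llt z x then true else anylt x s') else false.
Fixpoint anygt (x : positive) (s : seq positive) :=
  if s is z :: s' then (if llt x z then true else anygt x s') else false.
Fixpoint close (y : positive) (s acc : seq positive) :=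
  if s is z :: s' then (if peq y z then close y s' acc else z :: close y s' acc)
  else acc.
(** An arc from [y] back past [x] encloses [x] and blocks all that follows. Any other arc ending at
    [y] is closed, and those starting at [y] are opened. Arcs at [x] itself are never recorded,
    since they share an end with the new edge. *)
Definition rstep x y (ls rs : seq positive) o :=
  if o is Open s then (if anylt x ls then Blocked else Open (close y s rs)) else o.
Definition lstep x y (ls rs : seq positive) o :=
  if o is Open s then (if anygt x rs then Blocked else Open (close y s ls)) else o.
Definition vis o := if o is Open [::] then true else false.

(** The slots are the gaps after each item; there is none in front of the first item, which is pole
    A. On the right of [x], the slot after an item is reached only once that item has been
    passed. *)
Fixpoint rsweep x o1 o2 o3 (its : seq item) : seq mask :=
  if its is Item y _ _ a1 b1 a2 b2 a3 b3 :: its' then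
    let o1 := rstep x y a1 b1 o1 in
    let o2 := rstep x y a2 b2 o2 in
    let o3 := rstep x y a3 b3 o3 in
    Mask (vis o1) (vis o2) (vis o3) :: rsweep x o1 o2 o3 its'
  else [::].
(** On the left, the slot after an item lies between the item and [x], so its mask is emitted before
    the item is passed. *)
Fixpoint lsweep x o1 o2 o3 (its : seq item) acc : seq mask :=
  if its is Item y _ _ a1 b1 a2 b2 a3 b3 :: its' then
    lsweep x (lstep x y a1 b1 o1) (lstep x y a2 b2 o2) (lstep x y a3 b3 o3) its'
      (Mask (vis o1) (vis o2) (vis o3) :: acc)
  else acc.
Fixpoint sweep k (rp its : seq item) : option (positive * seq mask) :=
  if its is it :: its' then
    if peq k (key it) then
      let x := lab it in let o := Open [::] in
      Some (x, lsweep x o o o rp (Mask true true true :: rsweep x o o o its'))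
    else sweep k (it :: rp) its'
  else None.

Definition mcap m m' :=
  let: Mask a b c := m in let: Mask a' b' c' := m' in
  Mask (if a then a' else false) (if b then b' else false) (if c then c' else false).
Definition mnil m := if m is Mask false false false then true else false.

(* [mss] has one list per neighbour of the new vertex, with one mask per slot;
   [None] means that some edge has no page left if the first slot is chosen. *)
Fixpoint heads (ds : seq mask) (mss : seq (seq mask)) : option (seq mask) :=
  match ds, mss with
  | d :: ds', (m :: _) :: mss' =>
      let m' := mcap d m in
      if mnil m' then None else
      if heads ds' mss' is Some r then Some (m' :: r) else None
  | _, _ => Some [::]
  end.
Definition tails (mss : seq (seq mask)) := map behead mss.

Definition inst (a b : positive) := if llt a b then (a, b) else (b, a).
Definition crossi (e f : positive * positive) :=
  let: (a, b) := e in let: (c, d) := f in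
  if llt a c then (if llt c b then llt b d else false)
  else (if llt c a then (if llt a d then llt d b else false) else false).

(* An edge with undetermined page: its ends, the pages still allowed, and its
   instances in the copies that contain it, as pairs of increasing labels. *)
Record uedge := Uedge { uv : positive; uy : positive; um : mask;
                        ui : seq (positive * positive) }.

(* New label, reversed items before it, items after it, masks of the new edges. *)
Definition cand := (positive * (seq item * seq item) * seq mask)%type.
(** [ok] says which slots to try and [ds] which pages the new edges may have from the start; a slot
    that leaves some edge without a page yields no candidate. *)
Fixpoint cands (ok : seq bool) ds mss (rp its : seq item) : seq cand :=
  match its, ok with
  | it :: its', b :: ok' =>
      let rest := cands ok' ds (tails mss) (it :: rp) its' in
      if b then
        if heads ds mss is Some ms then
          let n := if its' is it' :: _ then lmid (lab it) (lab it') else lafter (lab it) in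
          (n, (it :: rp, its'), ms) :: rest
        else rest
      else rest
  | _, _ => [::]
  end.
Fixpoint sweeps (its : seq item) (ks : seq positive) : option (seq positive * seq (seq mask)) :=
  if ks is k :: ks' then
    if sweep k [::] its is Some (x, ms) then
      if sweeps its ks' is Some (xs, mss) then Some (x :: xs, ms :: mss) else None
    else None
  else Some ([::], [::]).
Fixpoint absent k (its : seq item) :=
  if its is it :: its' then (if peq k (key it) then false else absent k its') else true.

Definition pole (v : positive) := match v with xH | xO xH => true | _ => false end.
(* Key xO v is vertex v of copy 0 and xI v that of copy 1; the poles are common. *)
Definition key0 (v : positive) := xO v.
Definition key1 (v : positive) := if pole v then xO v else xI v.
Fixpoint firstpaired (its : seq item) : option positive :=
  if its is it :: its' then
    if paired it then (if key it is xO w then Some (key1 w) else firstpaired its')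
    else firstpaired its'
  else None.
Definition isk (o : option positive) k := if o is Some k' then peq k' k else false.
(* The slots after each item that lie between [pr] and [su]: as copies have the
   same type, copy 1 of a vertex lies between copies 1 of the nearest paired
   vertices on either side of its copy 0. The second component tells whether [pr] is still to come. *)
Fixpoint flags (pr su : option positive) (seen : bool) (its : seq item) : seq bool * bool :=
  if its is it :: its' then
    let seen := if seen then true else isk su (key it) in
    let: (fl, later) := flags pr su seen its' in
    ((if seen then false else ~~ later) :: fl, if later then true else isk pr (key it))
  else ([::], false).
Definition newitem n k b := Item n k b [::] [::] [::] [::] [::] [::].

Definition pok p m := let: Mask a b c := m in
  match p with P1 => a | P2 => b | P3 => c end.
Definition prem p m := let: Mask a b c := m in
  match p with P1 => Mask false b c | P2 => Mask a false c | P3 => Mask a b false end.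
Definition pone p := match p with P1 => Mask true false false
  | P2 => Mask false true false | P3 => Mask false false true end.
Definition psingle m := match m with
  | Mask true false false => Some P1 | Mask false true false => Some P2
  | Mask false false true => Some P3 | _ => None end.
Fixpoint pick1 (us acc : seq uedge) : option (page * uedge * seq uedge) :=
  if us is u :: us' then
    if psingle (um u) is Some p then Some (p, u, catrev acc us')
    else pick1 us' (u :: acc)
  else None.
Fixpoint crossl e (fs : seq (positive * positive)) :=
  if fs is f :: fs' then (if crossi e f then true else crossl e fs') else false.
Fixpoint crossll (es fs : seq (positive * positive)) :=
  if es is e :: es' then (if crossl e fs then true else crossll es' fs) else false.
Fixpoint prune p es (us : seq uedge) : option (seq uedge) :=
  if us is u :: us' then
    if prune p es us' is Some r then
      let: Uedge v y m i := u in
      if pok p m then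
        if crossll es i then
          let m' := prem p m in if mnil m' then None else Some (Uedge v y m' i :: r)
        else Some (u :: r)
      else Some (u :: r)
    else None
  else Some [::].
Definition addr p b (it : item) := let: Item n k t a1 b1 a2 b2 a3 b3 := it in
  match p with P1 => Item n k t a1 (b :: b1) a2 b2 a3 b3
  | P2 => Item n k t a1 b1 a2 (b :: b2) a3 b3
  | P3 => Item n k t a1 b1 a2 b2 a3 (b :: b3) end.
Definition addl p b (it : item) := let: Item n k t a1 b1 a2 b2 a3 b3 := it in
  match p with P1 => Item n k t (b :: a1) b1 a2 b2 a3 b3
  | P2 => Item n k t a1 b1 (b :: a2) b2 a3 b3
  | P3 => Item n k t a1 b1 a2 b2 (b :: a3) b3 end.
Fixpoint addarcr p a b (its : seq item) :=
  if its is it :: its' then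
    if peq b (lab it) then addl p a it :: its' else it :: addarcr p a b its'
  else its.
Fixpoint addarc p a b (its : seq item) :=
  if its is it :: its' then
    if peq a (lab it) then addr p b it :: addarcr p a b its' else it :: addarc p a b its'
  else its.
Fixpoint addarcs p es its :=
  if es is (a, b) :: es' then addarcs p es' (addarc p a b its) else its.
(* Unit propagation; [fuel] bounds the number of undetermined edges. *)
Fixpoint settle (fuel : seq uedge) its us : option (seq item * seq uedge) :=
  if pick1 us [::] is Some (p, u, us') then
    if fuel is _ :: fuel' then
      if prune p (ui u) us' is Some us'' then settle fuel' (addarcs p (ui u) its) us''
      else None
    else Some (its, us)
  else Some (its, us).

Definition state := (seq item * seq uedge)%type.
Definition full := Mask true true true.
Fixpoint mkues1 v n ys xs ms : seq uedge :=
  match ys, xs, ms with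
  | y :: ys', x :: xs', m :: ms' => Uedge v y m [:: inst n x] :: mkues1 v n ys' xs' ms'
  | _, _, _ => [::]
  end.
Fixpoint mkues2 v n0 n1 ys xs0 xs1 ms : seq uedge :=
  match ys, xs0, xs1, ms with
  | y :: ys', x :: xs', z :: zs', m :: ms' =>
      Uedge v y m [:: inst n0 x; inst n1 z] :: mkues2 v n0 n1 ys' xs' zs' ms'
  | _, _, _, _ => [::]
  end.
(** The two copies of an edge share a page, so they must not cross each other. [prune] cannot detect
    this, as it compares different edges only. *)
Definition selfok (u : uedge) := if ui u is [:: e; f] then ~~ crossi e f else true.
Definition trues (its : seq item) := map (fun _ => true) its.

Section WithGraph.
Variable nb : positive -> seq positive.

(** The result [[:: st]] answers a request that makes no sense, as when [v] is already placed or one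
    of its neighbours is not: the state is kept, which is harmless for soundness. *)
Definition insert1 v (st : state) : seq state :=
  let: (its, us) := st in
  let ys := nb v in
  if ys is [::] then [:: st] else
  if absent (key0 v) its then
    if sweeps its (map key0 ys) is Some (xs, mss) then
      pmap (fun c : cand =>
        let: (n, (rp, tl), ms) := c in
        let us' := mkues1 v n ys xs ms ++ us in
        settle us' (catrev rp (newitem n (key0 v) false :: tl)) us')
        (cands (trues its) (map (fun _ => full) ys) mss [::] its)
    else [:: st]
  else [:: st].

(** The masks [ms] that copy 0 leaves on the edges of [v] are the initial masks for copy 1, because
    an edge has one page in both copies. *)
Definition insert2 v (st : state) : seq state :=
  let: (its, us) := st in
  let ys := nb v in
  if ys is [::] then [:: st] else if pole v then [:: st] else
  if absent (key0 v) its then if absent (key1 v) its then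
    if sweeps its (map key0 ys) is Some (xs, mss) then
      flatten (map (fun c : cand =>
        let: (n, (rp, tl), ms) := c in
        let its0 := catrev rp (newitem n (key0 v) true :: tl) in
        if sweeps its0 (map key1 ys) is Some (xs1, mss1) then
          pmap (fun c : cand =>
            let: (n1, (rp1, tl1), ms1) := c in
            let es := mkues2 v n n1 ys xs xs1 ms1 in
            if all selfok es then
              let us' := es ++ us in
              settle us' (catrev rp1 (newitem n1 (key1 v) false :: tl1)) us'
            else None)
            (cands (flags (firstpaired rp) (firstpaired tl) false its0).1 ms mss1 [::] its0)
        else [:: st])
        (cands (trues its) (map (fun _ => full) ys) mss [::] its))
    else [:: st]
  else [:: st] else [:: st].

(* Insert v in copy 0, insert v in both copies, split on the page of the i-th
   undetermined edge. The subtrees follow the surviving cases. *)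
Inductive tree := I1 of positive & seq tree | I2 of positive & seq tree
  | Sp of nat & seq tree.

Fixpoint setm (i : nat) m (us : seq uedge) : seq uedge :=
  match us, i with
  | Uedge v y _ e :: us', 0 => Uedge v y m e :: us'
  | u :: us', i'.+1 => u :: setm i' m us'
  | [::], _ => [::]
  end.
Definition split i (st : state) : seq state :=
  let: (its, us) := st in
  if nth None (map Some us) i is Some u then
    pmap (fun p => if pok p (um u) then
       let us' := setm i (pone p) us in settle us' its us' else None)
       [:: P1; P2; P3]
  else [:: st].

(** A leaf of the case tree is a node without subtrees, accepted only if no successor survives. *)
Fixpoint check (t : tree) (st : state) : bool :=
  let fix all2 ts ss := match ts, ss with
    | [::], [::] => true
    | t :: ts', s :: ss' => if check t s then all2 ts' ss' else false
    | _, _ => false end in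
  match t with
  | I1 v ts => all2 ts (insert1 v st)
  | I2 v ts => all2 ts (insert2 v st)
  | Sp i ts => all2 ts (split i st)
  end.

(* Six labels in increasing order, for the poles and the copies of 3 and 4. *)
Definition labels : seq positive := [:: xO (xO xH); xO xH; xO (xI xH); xH; xI xH; xI (xI xH)].
Fixpoint labelof (k : positive) (s : seq (positive * positive)) : positive :=
  if s is (l, k') :: s' then (if peq k k' then l else labelof k s') else xH.
Definition start_items (ks : seq positive) :=
  [seq newitem p.1 p.2 (if p.2 is xO _ then true else false) | p <- zip labels ks].
Definition start_edge (ks : seq positive) v y m :=
  let l k := labelof k (zip labels ks) in
  Uedge v y m [:: inst (l (key0 v)) (l (key0 y)); inst (l (key1 v)) (l (key1 y))].
(** The distinct pages of tA and tB are called [P1] and [P2]; those of uA and uB stay open. *)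
Definition start_edges ks :=
  [:: start_edge ks 4%positive 1%positive full; start_edge ks 4%positive 2%positive full;
      start_edge ks 3%positive 1%positive (pone P1); start_edge ks 3%positive 2%positive (pone P2)].
Definition refutes (t : tree) ks : bool :=
  if settle (start_edges ks) (start_items ks) (start_edges ks) is Some st then check t st
  else true.
End WithGraph.

Inductive trie := Leaf | Node of trie & seq positive & trie.
Fixpoint look (t : trie) (p : positive) : seq positive :=
  match t, p with
  | Leaf, _ => [::]
  | Node _ x _, xH => x
  | Node a _ _, xO q => look a q
  | Node _ _ b, xI q => look b q
  end.
Fixpoint put (t : trie) (p : positive) (v : seq positive) : trie :=
  match t, p with
  | Leaf, xH => Node Leaf v Leaf
  | Leaf, xO q => Node (put Leaf q v) [::] Leaf
  | Leaf, xI q => Node Leaf [::] (put Leaf q v)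
  | Node a _ b, xH => Node a v b
  | Node a x b, xO q => Node (put a q v) x b
  | Node a x b, xI q => Node a x (put b q v)
  end.

End Checker.
Import Checker.

(** * Soundness: a true configuration always survives in some branch *)

Module Soundness.
Local Open Scope nat_scope.

Lemma lltxx a : llt a a = false. Proof. by elim: a. Qed.
Lemma llt_trans : transitive llt.
Proof.
move=> b a c; elim: b a c => [b IH|b IH|] [a|a|] [c|c|] //=; exact: IH.
Qed.
Lemma llt_asym a b : llt a b -> llt b a = false.
Proof. by move=> ab; apply/negP => /(llt_trans ab); rewrite lltxx. Qed.
Lemma peqP a b : reflect (a = b) (peq a b).
Proof.
apply: (iffP idP) => [|<-]; last by elim: a.
by elim: a b => [a IH|a IH|] [b|b|] //= /IH ->.
Qed.
Definition memp (x : positive) (s : seq positive) := has (peq x) s.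
Lemma mempP x s : reflect (In x s) (memp x s).
Proof.
apply: (iffP idP); elim: s => //= y s IH; first by case: peqP => [->|_ /= /IH]; [left|right].
by case=> [->|/IH ->]; [case: peqP|rewrite orbT].
Qed.
Lemma llt_lbefore s : llt (lbefore s) s. Proof. by elim: s. Qed.
Lemma llt_lafter s : llt s (lafter s). Proof. by elim: s. Qed.
Lemma llt_lmid a b : llt a b -> llt a (lmid a b) && llt (lmid a b) b.
Proof.
elim: a b => [a IH|a IH|] [b|b|] //=; try exact: IH.
- by rewrite llt_lafter.
- by rewrite llt_lbefore.
Qed.

Lemma In_cat T (x : T) s1 s2 : In x (s1 ++ s2) <-> In x s1 \/ In x s2.
Proof. exact: List.in_app_iff. Qed.

Section Sound.
Variables (nb : positive -> seq positive).
(* The position of a key on the spine, and the page of an edge in both copies. *)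
Variables (ps : positive -> nat) (pg : positive -> positive -> page).

Definition kc (c : bool) := if c then key1 else key0.
(** Every vertex except the poles is listed with at least one smaller neighbour, so a nonempty list
    identifies it. *)
Definition vertexb v := pole v || (0 < size (nb v)).
Definition validk k := exists2 v, vertexb v & exists c, k = kc c v.
(** The edges of page [p] in both copies and in either direction. That [pg] ignores the copy
    expresses equality of types. *)
Definition arc p k1 k2 := exists v y c, [/\ In y (nb v), pg v y = p
  & (k1, k2) = (kc c v, kc c y) \/ (k1, k2) = (kc c y, kc c v)].

Hypothesis nb_vertex : forall v y, In y (nb v) -> vertexb y.
Hypothesis ps_inj : forall k k', validk k -> validk k' -> ps k = ps k' -> k = k'.
Hypothesis ps_min : forall k, validk k -> k <> key0 xH -> ps (key0 xH) < ps k.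
Hypothesis ps_same : forall v w, vertexb v -> vertexb w ->
  ps (key0 v) < ps (key0 w) -> ps (key1 v) < ps (key1 w).
Hypothesis ps_cross : forall p a b c d, arc p a b -> arc p c d ->
  ps a < ps c -> ps c < ps b -> ps b < ps d -> False.

Lemma arc_sym p a b : arc p a b -> arc p b a.
Proof.
by move=> [v [y [c [? ? [[-> ->]|[-> ->]]]]]]; exists v, y, c; split => //; [right|left].
Qed.

Definition frame (its : seq item) := map (fun it => (lab it, key it)) its.
Definition ordp (a b : positive * positive) := llt a.1 b.1 && (ps a.2 < ps b.2).
Lemma ordp_trans : transitive ordp.
Proof.
move=> b a c /andP[h1 h2] /andP[h3 h4].
by rewrite /ordp (llt_trans h1 h3) (ltn_trans h2 h4).
Qed.

(** Recorded arcs must be real, but real arcs may be missing: edges of undetermined page are not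
    recorded. Missing arcs only make more slots visible. *)
Definition arcs_ok p (F : seq (positive * positive)) k rs ls :=
  (forall b, In b rs -> exists2 k', In (b, k') F & ps k < ps k' /\ arc p k k') /\
  (forall b, In b ls -> exists2 k', In (b, k') F & ps k' < ps k /\ arc p k' k).
Definition pick T p (a b c : T) := match p with P1 => a | P2 => b | P3 => c end.
Definition rights p it := pick p (r1 it) (r2 it) (r3 it).
Definition lefts p it := pick p (l1 it) (l2 it) (l3 it).
Definition item_ok F it :=
  validk (key it) /\ forall p, arcs_ok p F (key it) (rights p it) (lefts p it).
Definition inst_ok p F (e : positive * positive) :=
  exists ka kb, [/\ In (e.1, ka) F, In (e.2, kb) F, llt e.1 e.2 & arc p ka kb].
Definition ue_ok F u := [/\ In (uy u) (nb (uv u)), pok (pg (uv u) (uy u)) (um u)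
  & forall e, In e (ui u) -> inst_ok (pg (uv u) (uy u)) F e].
Definition its_ok its := [/\ pairwise ordp (frame its),
  (if its is it :: _ then key it = key0 xH else False)
  & forall it, In it its -> item_ok (frame its) it].
(** The state is true of the embedding given by [ps] and [pg]: labels in spine order, recorded arcs
    real, and the actual page of each undetermined edge still allowed. *)
Definition Inv (st : state) :=
  its_ok st.1 /\ forall u, In u st.2 -> ue_ok (frame st.1) u.

Lemma allIn T (a : pred T) s : all a s <-> (forall x, In x s -> a x).
Proof.
elim: s => [|y s [IH1 IH2]] /=; first by split.
split=> [/andP[ay /IH1 H] x [<-|/H]//|H].
by apply/andP; split; [apply: H; left|apply: IH2 => x xs; apply: H; right].
Qed.

Lemma pw_In F a b : pairwise ordp F -> In a F -> In b F ->
  [\/ a = b, ordp a b | ordp b a].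
Proof.
elim: F => //= c F IH /andP[/allIn H pw] [<-|ha] [<-|hb].
- exact: Or31.
- exact/Or32/H.
- exact/Or33/H.
- exact: IH.
Qed.

Lemma pw_fun F l k k' : pairwise ordp F -> In (l, k) F -> In (l, k') F -> k = k'.
Proof.
move=> pw h h'; case: (pw_In pw h h') => [[]//||] /andP[] /=; by rewrite lltxx.
Qed.

Lemma pw_lt F l k l' k' : pairwise ordp F -> In (l, k) F -> In (l', k') F ->
  llt l l' -> ps k < ps k'.
Proof.
move=> pw h h' ll'; case: (pw_In pw h h') => [[e _]|/andP[]//|/andP[]/=].
  by rewrite e lltxx in ll'.
by rewrite (llt_asym ll').
Qed.

(** A real arc of page [p] crosses the chord from [kx] to a new vertex at position [P]. In the first
    two cases [P] is on the right of [kx], in the last two on the left. *)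
Definition conf p kx P := exists k1 k2, arc p k1 k2 /\
  [\/ [/\ ps k1 < ps kx, ps kx < ps k2 & ps k2 < P],
      [/\ ps kx < ps k1, ps k1 < P & P < ps k2],
      [/\ P < ps k1, ps k1 < ps kx & ps kx < ps k2]
    | [/\ ps k1 < P, P < ps k2 & ps k2 < ps kx]].

Lemma confN p kx kv : arc p kv kx -> conf p kx (ps kv) -> False.
Proof.
move=> h [k1 [k2 [h' [] [h1 h2 h3]]]].
- exact: (ps_cross h' (arc_sym h) h1 h2 h3).
- exact: (ps_cross (arc_sym h) h' h1 h2 h3).
- exact: (ps_cross h h' h1 h2 h3).
- exact: (ps_cross h' h h1 h2 h3).
Qed.

(** The slot of a new vertex at position [P] has number [(below P its).-1], as each slot is numbered
    by the item that it follows. *)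
Definition below P (its : seq item) := count (fun it => ps (key it) < P) its.

(** Invariant of the sweep to the right once everything up to [P0] has been passed. Far ends must
    lie among the items [F] not yet swept, so that the arc is really overhead at the current
    slot. *)
Definition oR p kx (F : seq (positive * positive)) P0 o := match o with
  | Blocked => exists k1 k2, [/\ arc p k1 k2, ps k1 < ps kx, ps kx < ps k2 & ps k2 <= P0]
  | Open s => forall b, In b s -> exists k' k1,
     [/\ In (b, k') F, arc p k1 k', ps kx < ps k1 & ps k1 <= P0] end.

Lemma closeP y s acc b : In b (close y s acc) -> In b acc \/ (In b s /\ b <> y).
Proof.
elim: s => [|z s IH] /=; first by left.
case: peqP => [e|ne].
  move/IH => [|[h h']]; [by left|right; split=> //; by right].
move=> /= [<-|/IH[|[h h']]]; [by right; split; [left|exact/nesym]|by left|].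
by right; split=> //; right.
Qed.

Lemma anyltP x s : anylt x s -> exists2 z, In z s & llt z x.
Proof.
elim: s => //= z s IH; case E: (llt z x) => h; first by exists z => //; left.
by have [w ws wx] := IH h; exists w => //; right.
Qed.
Lemma anygtP x s : anygt x s -> exists2 z, In z s & llt x z.
Proof.
elim: s => //= z s IH; case E: (llt x z) => h; first by exists z => //; left.
by have [w ws wx] := IH h; exists w => //; right.
Qed.

Lemma In_frame it its : In it its -> In (lab it, key it) (frame its).
Proof. by move=> h; apply: (List.in_map (fun it => (lab it, key it)) _ _ h). Qed.

Lemma In_frameP a its : In a (frame its) -> exists2 it, In it its & a = (lab it, key it).
Proof. by case/List.in_map_iff => it [<- h]; exists it. Qed.
Lemma below0P P a its : In a (frame its) -> ps a.2 < P -> 0 < below P its.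
Proof.
move=> /In_frameP[it h ->] /= lt; rewrite -has_count.
by elim: its h => //= j its IH [->|/IH ->]; rewrite ?lt ?orbT.
Qed.

(* [F0] is the frame of all items, [F] that of the items still to be swept. *)
Lemma rstep_ok p F0 F x kx y ky P0 ls rs o :
  pairwise ordp F0 -> In (x, kx) F0 -> In (y, ky) F0 ->
  (forall a, In a F0 -> ps ky < ps a.2 -> In a F) ->
  ps kx < ps ky -> P0 <= ps ky ->
  arcs_ok p F0 ky rs ls ->
  oR p kx ((y, ky) :: F) P0 o -> oR p kx F (ps ky) (rstep x y ls rs o).
Proof.
move=> pw hx hy hF xy P0y [okr okl]; case: o => [|s] /=.
  by move=> [k1 [k2 [? ? ? h]]]; exists k1, k2; split=> //; apply: leq_trans h _.
move=> hs; case E: (anylt x ls) => /=.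
  have [z zl zx] := anyltP E; have [k' hk [h1 h2]] := okl _ zl.
  by exists k', ky; split=> //; apply: (pw_lt pw hk hx).
move=> b /closeP[br|[bs by_]].
  have [k' hk [h1 h2]] := okr _ br; exists k', ky; split=> //.
  exact: hF hk h1.
have [k' [k1 [[[e _]|h1] h2 h3 h4]]] := hs _ bs; first by case: by_.
by exists k', k1; split=> //; apply: leq_trans h4 _.
Qed.

Lemma oR_conf p kx F P0 P o : oR p kx F P0 o -> P0 < P ->
  (forall a, In a F -> P < ps a.2) -> ~~ vis o -> conf p kx P.
Proof.
case: o => [|[|b s]] //= h P0P hF _.
  have [k1 [k2 [? ? ? h4]]] := h; exists k1, k2; split=> //; apply: Or41; split=> //.
  exact: leq_ltn_trans h4 _.
have [|k' [k1 [h1 h2 h3 h4]]] := h b; first by left.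
exists k1, k'; split=> //; apply: Or42; split=> //; first exact: leq_ltn_trans h4 _.
exact: (hF (b, k')).
Qed.

Definition nthm (ms : seq mask) i := nth full ms i.

Lemma below0 P its : (forall a, In a (frame its) -> P <= ps a.2) -> below P its = 0.
Proof.
move=> h; apply/eqP; rewrite -leqn0 leqNgt -has_count; apply/negP.
elim: its h => //= it its IH h /orP[hl|]; last by apply: IH => a ha; apply: h; right.
by have /= := h _ (or_introl erefl); rewrite leqNgt hl.
Qed.

Lemma pick_rstep p x y o1 o2 o3 it :
  pick p (rstep x y (l1 it) (r1 it) o1) (rstep x y (l2 it) (r2 it) o2)
         (rstep x y (l3 it) (r3 it) o3)
  = rstep x y (lefts p it) (rights p it) (pick p o1 o2 o3).
Proof. by case: p. Qed.
Lemma pick_lstep p x y o1 o2 o3 it :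
  pick p (lstep x y (l1 it) (r1 it) o1) (lstep x y (l2 it) (r2 it) o2)
         (lstep x y (l3 it) (r3 it) o3)
  = lstep x y (lefts p it) (rights p it) (pick p o1 o2 o3).
Proof. by case: p. Qed.

Lemma rsweep_ok F0 pre its x kx P0 P o1 o2 o3 p :
  pre ++ frame its = F0 -> pairwise ordp F0 -> In (x, kx) F0 ->
  (forall a, In a (frame its) -> P0 < ps a.2) -> ps kx <= P0 ->
  (forall it, In it its -> item_ok F0 it) ->
  (forall it, In it its -> ps (key it) != P) ->
  oR p kx (frame its) P0 (pick p o1 o2 o3) ->
  0 < below P its ->
  ~~ pok p (nthm (rsweep x o1 o2 o3 its) (below P its).-1) -> conf p kx P.
Proof.
elim: its pre P0 o1 o2 o3 => [//|it its IH] pre P0 o1 o2 o3 eF pw hx0 hP0 xP0 ok neP ho hb.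
have hit : In (lab it, key it) F0 by rewrite -eF; apply/In_cat; right; left.
have pw' := pw; rewrite -eF pairwise_cat /= in pw'.
case/and3P: pw' => /allIn ar _ /andP[/allIn hi pwi].
have Pit := hP0 _ (or_introl erefl); rewrite /= in Pit.
have ltP : ps (key it) < P.
  case: (ltnP (ps (key it)) P) => // le.
  rewrite below0 // in hb; move=> a [<-//|ha].
  by apply: leq_trans le _; apply: ltnW; case/andP: (hi _ ha).
have xit : ps kx < ps (key it) by apply: leq_ltn_trans xP0 Pit.
have hF a : In a F0 -> ps (key it) < ps a.2 -> In a (frame its).
  rewrite -eF => /In_cat[/ar/allIn h|[<-|//]] /=; last by rewrite ltnn.
  have /andP[_ /= h'] := h (lab it, key it) (or_introl erefl).
  by move/(ltn_trans h'); rewrite ltnn.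
have [_ aok] := ok it (or_introl erefl).
have := rstep_ok pw hx0 hit hF xit (ltnW Pit) (aok p) ho.
rewrite -pick_rstep.
have -> : rsweep x o1 o2 o3 (it :: its) =
  let o1' := rstep x (lab it) (l1 it) (r1 it) o1 in
  let o2' := rstep x (lab it) (l2 it) (r2 it) o2 in
  let o3' := rstep x (lab it) (l3 it) (r3 it) o3 in
  Mask (vis o1') (vis o2') (vis o3') :: rsweep x o1' o2' o3' its by case: (it).
move: (rstep _ _ _ _ o1) (rstep _ _ _ _ o2) (rstep _ _ _ _ o3) => o1' o2' o3' /= ho'.
rewrite /below /= ltP add1n /= -/(below P its).
have hi' a : In a (frame its) -> ps (key it) < ps a.2 by move=> /hi /andP[].
(* If no further item lies before [P], the mask just computed belongs to the slot of [P]; otherwise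
   that slot is found further right, by induction. *)
case E: (below P its) => [|n].
  move=> nv; apply: (oR_conf ho' ltP).
    move=> a ha; case: (ltnP P (ps a.2)) => //; rewrite leq_eqVlt => /orP[/eqP e|lt].
      have [j jits ja] := In_frameP ha; have := neP j (or_intror jits).
      by rewrite -e ja eqxx.
    by have := below0P ha lt; rewrite E.
  by move: nv; case: (p).
rewrite /= => nv.
apply: (IH (pre ++ [:: (lab it, key it)]) (ps (key it)) o1' o2' o3') => //.
- by rewrite -catA.
- exact: ltnW.
- by move=> j hj; apply: ok; right.
- by move=> j hj; apply: neP; right.
- by rewrite E.
- by rewrite E.
Qed.
Definition oL p kx (F : seq (positive * positive)) P0 o := match o with
  | Blocked => exists k1 k2, [/\ arc p k1 k2, ps k1 < ps kx, ps kx < ps k2 & P0 <= ps k1]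
  | Open s => forall b, In b s -> exists k' k1,
     [/\ In (b, k') F, arc p k' k1, ps k1 < ps kx & P0 <= ps k1] end.

Lemma lstep_ok p F0 F x kx y ky P0 ls rs o :
  pairwise ordp F0 -> In (x, kx) F0 -> In (y, ky) F0 ->
  (forall a, In a F0 -> ps a.2 < ps ky -> In a F) ->
  ps ky < ps kx -> ps ky <= P0 ->
  arcs_ok p F0 ky rs ls ->
  oL p kx ((y, ky) :: F) P0 o -> oL p kx F (ps ky) (lstep x y ls rs o).
Proof.
move=> pw hx hy hF xy P0y [okr okl]; case: o => [|s] /=.
  by move=> [k1 [k2 [? ? ? h]]]; exists k1, k2; split=> //; apply: leq_trans P0y h.
move=> hs; case E: (anygt x rs) => /=.
  have [z zl zx] := anygtP E; have [k' hk [h1 h2]] := okr _ zl.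
  by exists ky, k'; split=> //; apply: (pw_lt pw hx hk).
move=> b /closeP[br|[bs by_]].
  have [k' hk [h1 h2]] := okl _ br; exists k', ky; split=> //.
  exact: hF hk h1.
have [k' [k1 [[[e _]|h1] h2 h3 h4]]] := hs _ bs; first by case: by_.
by exists k', k1; split=> //; apply: leq_trans P0y h4.
Qed.

Lemma oL_conf p kx F P0 P o : oL p kx F P0 o -> P < P0 ->
  (forall a, In a F -> ps a.2 < P) -> ~~ vis o -> conf p kx P.
Proof.
case: o => [|[|b s]] //= h P0P hF _.
  have [k1 [k2 [? ? ? h4]]] := h; exists k1, k2; split=> //; apply: Or43; split=> //.
  exact: leq_trans P0P h4.
have [|k' [k1 [h1 h2 h3 h4]]] := h b; first by left.
exists k', k1; split=> //; apply: Or44; split=> //; last exact: leq_trans P0P h4.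
exact: (hF (b, k')).
Qed.

Lemma belowT P its : (forall a, In a (frame its) -> ps a.2 < P) -> below P its = size its.
Proof.
elim: its => //= it its IH h; rewrite /below /= -/(below P its) IH => [|a ha].
  by have /= -> := h _ (or_introl erefl).
by apply: h; right.
Qed.

Lemma nth_lsweep x o1 o2 o3 rp acc j :
  nthm (lsweep x o1 o2 o3 rp acc) (size rp + j) = nthm acc j.
Proof.
elim: rp o1 o2 o3 acc j => [//|[y ? ? a1 b1 a2 b2 a3 b3] rp IH] o1 o2 o3 acc j.
rewrite [size _]/= addSnnS; exact: IH.
Qed.

Lemma In_rev T (a : T) s : In a (rev s) <-> In a s.
Proof.
elim: s => // b s IH; rewrite rev_cons -cats1; have := In_cat a (rev s) [:: b].
by move=> /=; tauto.
Qed.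

Lemma lsweep_ok F0 rp post x kx P0 P o1 o2 o3 acc p :
  catrev (frame rp) post = F0 -> pairwise ordp F0 -> In (x, kx) F0 ->
  (forall a, In a (frame rp) -> ps a.2 < P0) -> P0 <= ps kx ->
  (forall it, In it rp -> item_ok F0 it) ->
  (forall it, In it rp -> ps (key it) != P) ->
  oL p kx (frame rp) P0 (pick p o1 o2 o3) ->
  P < P0 -> 0 < below P rp ->
  ~~ pok p (nthm (lsweep x o1 o2 o3 rp acc) (below P rp).-1) -> conf p kx P.
Proof.
elim: rp post P0 o1 o2 o3 acc
  => [//|it rp IH] post P0 o1 o2 o3 acc eF pw hx0 hP0 xP0 ok neP ho PP0 hb.
have eF' : rev (frame rp) ++ (lab it, key it) :: post = F0 by rewrite -catrevE.
have hit : In (lab it, key it) F0 by rewrite -eF'; apply/In_cat; right; left.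
have pw' := pw; rewrite -eF' pairwise_cat /= in pw'.
case/and3P: pw' => /allIn ar _ /andP[/allIn hi pwi].
have hr a : In a (frame rp) -> ps a.2 < ps (key it).
  by move=> /(In_rev a (frame rp)) /ar /allIn /(_ _ (or_introl erefl)) /andP[].
have -> : lsweep x o1 o2 o3 (it :: rp) acc = lsweep x
  (lstep x (lab it) (l1 it) (r1 it) o1) (lstep x (lab it) (l2 it) (r2 it) o2)
  (lstep x (lab it) (l3 it) (r3 it) o3) rp (Mask (vis o1) (vis o2) (vis o3) :: acc)
  by case: (it).
(* If [it] lies before [P], so do all the items left of it: [P] is in the slot right after [it],
   whose mask stands behind the [size rp] masks of those items. *)
case: (ltnP (ps (key it)) P) => leP.
  rewrite /below /= leP -/(below P rp) (@belowT P rp); last first.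
    by move=> a /hr h; apply: ltn_trans h leP.
  rewrite add1n /= -[size rp]addn0 nth_lsweep => nv.
  apply: (oL_conf ho PP0); last by move: nv; case: (p).
  by move=> a [<-//|/hr h]; apply: ltn_trans h leP.
have ltP : P < ps (key it).
  by move: leP; rewrite leq_eqVlt => /orP[/eqP e|//];
    have := neP it (or_introl erefl); rewrite -e eqxx.
have E : below P (it :: rp) = below P rp by rewrite /below /= ltnNge leP.
have Pit := hP0 _ (or_introl erefl); rewrite /= in Pit.
have xit : ps (key it) < ps kx by apply: leq_trans Pit xP0.
have hF a : In a F0 -> ps a.2 < ps (key it) -> In a (frame rp).
  rewrite -eF' => /In_cat[/In_rev//|[<-|/hi /andP[_ h']]] /=; first by rewrite ltnn.
  by move/(ltn_trans h'); rewrite ltnn.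
have [_ aok] := ok it (or_introl erefl).
have ho' := lstep_ok pw hx0 hit hF xit (ltnW Pit) (aok p) ho.
rewrite -pick_lstep in ho'.
rewrite E; apply: (IH ((lab it, key it) :: post) (ps (key it))) => //.
- exact: ltnW.
- by move=> j hj; apply: ok; right.
- by move=> j hj; apply: neP; right.
- by rewrite -E.
Qed.

Lemma size_rsweep x o1 o2 o3 its : size (rsweep x o1 o2 o3 its) = size its.
Proof. by elim: its o1 o2 o3 => [|[? ? ? ? ? ? ? ? ?] its IH] //= *; rewrite IH. Qed.
Lemma size_lsweep x o1 o2 o3 its acc :
  size (lsweep x o1 o2 o3 its acc) = size its + size acc.
Proof.
by elim: its o1 o2 o3 acc => [|[? ? ? ? ? ? ? ? ?] its IH] //= *; rewrite IH /= addnS addSn.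
Qed.

Lemma sweepE k rp its x ms : sweep k rp its = Some (x, ms) ->
  exists pre it post, [/\ its = pre ++ it :: post, key it = k, lab it = x &
   ms = lsweep x (Open [::]) (Open [::]) (Open [::]) (catrev pre rp)
     (full :: rsweep x (Open [::]) (Open [::]) (Open [::]) post)].
Proof.
elim: its rp => //= it its IH rp; case: peqP => [->[<- <-]|_ /IH].
  by exists [::], it, its.
by move=> [pre [j [post [-> e1 e2 e3]]]]; exists (it :: pre), j, post.
Qed.

Lemma frame_cat s1 s2 : frame (s1 ++ s2) = frame s1 ++ frame s2.
Proof. exact: map_cat. Qed.
Lemma below_cat P s1 s2 : below P (s1 ++ s2) = below P s1 + below P s2.
Proof. exact: count_cat. Qed.

(** The item of [k] divides the slots between the two sweeps. The slot right after it carries the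
    mask [full], as nothing separates it from [k]. *)
Lemma sweep_ok its k x ms P : its_ok its -> sweep k [::] its = Some (x, ms) ->
  (forall it, In it its -> ps (key it) != P) -> 0 < below P its ->
  [/\ In (x, k) (frame its), size ms = size its &
   forall p, ~~ pok p (nthm ms (below P its).-1) -> conf p k P].
Proof.
move=> [pw _ ok] /sweepE[pre [it [post [e ek ex ems]]]] neP hb.
have hx : In (x, k) (frame its) by rewrite e frame_cat -ek -ex; apply/In_cat; right; left.
have eF : frame its = frame pre ++ (x, k) :: frame post by rewrite e frame_cat /= ex ek.
have pw' := pw; rewrite eF pairwise_cat /= in pw'.
case/and3P: pw' => /allIn ar _ /andP[/allIn hi pwi].
have hpre a : In a (frame pre) -> ps a.2 < ps k.
  by move=> /ar /allIn /(_ _ (or_introl erefl)) /andP[].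
have hpost a : In a (frame post) -> ps k < ps a.2 by move=> /hi /andP[].
have szr : size (catrev pre [::]) = size pre by exact: size_rev.
split=> // [|p]; first by rewrite ems size_lsweep /= size_rsweep szr e size_cat.
have below_pre : below P its = below P pre + (ps k < P) + below P post.
  by rewrite e below_cat /below /= ek addnA.
case: (ltnP (ps k) P) => kP.
  rewrite below_pre kP (belowT (its := pre)); last by move=> a /hpre h; apply: ltn_trans h kP.
  rewrite addn1 addSn /= -szr ems nth_lsweep.
  case E: (below P post) => [|n] /=; first by case: (p).
  rewrite -[n]/(n.+1.-1) -E;
    apply: (@rsweep_ok (frame its) (frame pre ++ [:: (x, k)]) post x k (ps k)) => //.
  - by rewrite eF -catA.
  - by move=> j hj; apply: ok; rewrite e; apply/In_cat; right; right.
  - by move=> j hj; apply: neP; rewrite e; apply/In_cat; right; right.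
  - by case: (p).
  - by rewrite E.
have kP' : P < ps k.
  move: kP; rewrite leq_eqVlt => /orP[/eqP eP|//].
  have := neP it; rewrite ek -eP eqxx => H; suff: false by []; apply: H.
  by rewrite e; apply/In_cat; right; left.
have b0 : below P post = 0 by apply: below0 => a /hpost h; apply: ltnW; apply: ltn_trans kP' h.
have kPf : (ps k < P) = false by rewrite ltnNge (ltnW kP').
rewrite below_pre b0 kPf !addn0 in hb *.
have bE : below P pre = below P (catrev pre [::])
  by rewrite /below -[catrev _ _]/(rev pre) count_rev.
rewrite bE ems; apply: (@lsweep_ok (frame its) _ ((x,k) :: frame post) x k (ps k)) => //.
- by rewrite eF -[catrev pre _]/(rev pre) {1}/frame map_rev catrevE revK.
- by move=> a; rewrite -[catrev pre _]/(rev pre) /frame map_rev => /In_rev /hpre.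
- by move=> j; rewrite -[catrev pre _]/(rev pre) => /In_rev hj;
  apply: ok; rewrite e; apply/In_cat; left.
- by move=> j; rewrite -[catrev pre _]/(rev pre) => /In_rev hj;
  apply: neP; rewrite e; apply/In_cat; left.
- by case: (p).
- by rewrite -bE.
Qed.
Fixpoint good j (qs : seq page) (ds : seq mask) (mss : seq (seq mask)) : bool :=
  match qs, ds, mss with
  | q :: qs', d :: ds', ms :: mss' =>
    [&& pok q d, pok q (nthm ms j), j < size ms & good j qs' ds' mss']
  | [::], [::], [::] => true
  | _, _, _ => false
  end.
Fixpoint pokl (qs : seq page) (ms : seq mask) : bool :=
  match qs, ms with
  | q :: qs', m :: ms' => pok q m && pokl qs' ms'
  | [::], [::] => true
  | _, _ => false
  end.

Lemma pok_mcap q a b : pok q (mcap a b) = pok q a && pok q b.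
Proof. by case: q a b => [] [[] [] []] [[] [] []]. Qed.
Lemma pok_mnil q m : pok q m -> mnil m = false.
Proof. by case: q m => [] [[] [] []]. Qed.

Lemma heads_good qs ds mss : good 0 qs ds mss ->
  exists2 ms, heads ds mss = Some ms & pokl qs ms.
Proof.
elim: qs ds mss => [|q qs IH] [|d ds] [|[|m ms] mss] //=.
  by exists [::].
  by rewrite !andbF.
move=> /and3P[h1 h2 /IH[r -> hr]].
have h : pok q (mcap d m) by rewrite pok_mcap h1.
by rewrite (pok_mnil h); exists (mcap d m :: r) => //=; rewrite h.
Qed.

Lemma good_tails j qs ds mss : good j.+1 qs ds mss -> good j qs ds (tails mss).
Proof.
elim: qs ds mss => [|q qs IH] [|d ds] [|[|m ms] mss] //=; first by rewrite !andbF.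
by move=> /and4P[-> h2 h3 /IH ->]; rewrite /nthm /= in h2 *; rewrite h2 -ltnS h3.
Qed.

Definition midlab it (tl : seq item) :=
  if tl is it' :: _ then lmid (lab it) (lab it') else lafter (lab it).

(** Whatever becomes of the other slots, the actual slot [j], where the actual pages [qs] survive,
    is among the candidates, with masks that still allow [qs]. *)
Lemma cands_ok j okf qs ds mss rp its :
  j < size its -> j < size okf -> nth true okf j -> good j qs ds mss ->
  exists pre it tl ms, [/\ its = pre ++ it :: tl, size pre = j, pokl qs ms
   & In (midlab it tl, (it :: catrev pre rp, tl), ms) (cands okf ds mss rp its)].
Proof.
elim: its j okf mss rp => [//|it its IH] [|j] [|b okf] //= mss rp lt1 lt2 h.
  move/heads_good => [ms hh hp]; exists [::], it, its, ms; split=> //.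
  by rewrite h hh; left.
move/good_tails => hg.
have [pre [it1 [tl [ms [-> sz hp hin]]]]] := IH j okf (tails mss) (it :: rp) lt1 lt2 h hg.
exists (it :: pre), it1, tl, ms; split=> //=; first by rewrite sz.
by case: b => //; case: heads => // ?; right.
Qed.

Lemma below_split P s1 s2 : pairwise ordp (frame (s1 ++ s2)) ->
  size s1 = below P (s1 ++ s2) ->
  (forall a, In a (frame s1) -> ps a.2 < P) /\ (forall a, In a (frame s2) -> P <= ps a.2).
Proof.
elim: s1 => [|it s1 IH] /= pw sz.
  split=> // a ha; rewrite leqNgt; apply/negP => lt.
  by have := below0P ha lt; rewrite -sz.
case/andP: pw => /allIn hi pw; rewrite /below /= -/(below P (s1 ++ s2)) in sz.
case: (ltnP (ps (key it)) P) => h.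
  rewrite h add1n in sz; case: sz => /(IH pw)[h1 h2]; split=> // a [<-//|]; exact: h1.
have b0 : below P (s1 ++ s2) = 0.
  by apply: below0 => a /hi /andP[_ /= lt]; apply: leq_trans h (ltnW lt).
by rewrite b0 ltnNge h in sz.
Qed.

Lemma arcs_mono p F F' k rs ls : (forall a, In a F -> In a F') ->
  arcs_ok p F k rs ls -> arcs_ok p F' k rs ls.
Proof.
move=> sub [h1 h2]; split=> b hb.
  by have [k' ? ?] := h1 _ hb; exists k' => //; apply: sub.
by have [k' ? ?] := h2 _ hb; exists k' => //; apply: sub.
Qed.

Lemma ue_mono F F' u : (forall a, In a F -> In a F') -> ue_ok F u -> ue_ok F' u.
Proof.
move=> sub [h1 h2 h3]; split=> // e /h3[ka [kb [? ? ? ?]]].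
by exists ka, kb; split=> //; apply: sub.
Qed.

(** The size condition puts the new item into its true slot, so that a label between those of its
    neighbours keeps labels and spine in the same order. *)
Lemma ins_ok pre it tl k b : its_ok (pre ++ it :: tl) -> validk k ->
  size pre = (below (ps k) (pre ++ it :: tl)).-1 -> 0 < below (ps k) (pre ++ it :: tl) ->
  (forall j, In j (pre ++ it :: tl) -> ps (key j) != ps k) ->
  its_ok (pre ++ it :: newitem (midlab it tl) k b :: tl).
Proof.
set P := ps k; move=> [pw hd ok] vk sz b0 neP.
have [h1 h2] : (forall a, In a (frame (rcons pre it)) -> ps a.2 < P) /\
   (forall a, In a (frame tl) -> P <= ps a.2).
  by apply: below_split; rewrite -cats1 -?catA //= size_cat /= sz addn1 prednK.
have h2' a : In a (frame tl) -> P < ps a.2.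
  move=> ha; rewrite ltn_neqAle h2 // andbT; have [j hj ->] := In_frameP ha.
  by rewrite eq_sym; apply: neP; apply/In_cat; right; right.
have hit : ps (key it) < P.
  by apply: (h1 (lab it, key it)); rewrite -cats1 frame_cat; apply/In_cat; right; left.
pose n := midlab it tl.
have pw' := pw; rewrite frame_cat /= pairwise_cat /= in pw'.
case/and4P: pw' => ar ppre /allIn hi ptl.
have itn : ordp (lab it, key it) (n, k).
  rewrite /ordp /= hit andbT /n; case: (tl) hi => [|j tl'] hi /=; first exact: llt_lafter.
  have /andP[/= l _] := hi (lab j, key j) (or_introl erefl).
  by case/andP: (llt_lmid l).
have ntl : all (ordp (n, k)) (frame tl).
  rewrite /n; case: (tl) h2' hi ptl => [//|j tl'] h2' hi /andP[hj _] /=.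
  have /andP[/= l _] := hi (lab j, key j) (or_introl erefl).
  have nj : ordp (lmid (lab it) (lab j), k) (lab j, key j).
    rewrite /ordp /=; case/andP: (llt_lmid l) => _ ->.
    exact: (h2' (lab j, key j) (or_introl erefl)).
  rewrite nj /=; apply/allIn => a ha; apply: ordp_trans nj _.
  by move/allIn: hj; apply.
have pren : all (fun a => ordp a (n, k)) (frame pre).
  apply/allIn => a ha; apply: ordp_trans itn.
  by move/allIn: ar => /(_ _ ha) /= /andP[].
have sub a : In a (frame (pre ++ it :: tl)) ->
    In a (frame (pre ++ it :: newitem n k b :: tl)).
  rewrite !frame_cat => /In_cat h; apply/In_cat; case: h => [|[|]] h; [by left|by right; left|].
  by right; right; right.
split.
- rewrite frame_cat pairwise_cat /= ppre ptl ntl itn !andbT /= (_ : all _ _ = true); last first.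
    by apply/allIn.
  rewrite andbT; apply/allIn => a ha /=; move/allIn: ar => /(_ _ ha) /= /andP[-> ->].
  by move/allIn: pren => /(_ _ ha) ->.
- by case: (pre) hd.
- have nok : item_ok (frame (pre ++ it :: newitem n k b :: tl)) (newitem n k b).
    by split=> // p; split; case: p.
  have ok' j : In j (pre ++ it :: tl) -> item_ok (frame (pre ++ it :: newitem n k b :: tl)) j.
    by move=> /ok[vj hj]; split=> // p; apply: arcs_mono (hj p).
  move=> j /In_cat[hj|[hj|[<-//|hj]]]; apply: ok'; apply/In_cat; [by left|right; by left|].
  by right; right.
Qed.

Lemma prem_ok p q m : pok q m -> p <> q -> pok q (prem p m).
Proof. by case: p q m => [] [] [[] [] []]. Qed.
Lemma psingleP m p q : psingle m = Some p -> pok q m -> q = p.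
Proof. by case: m => [[] [] []] //= [<-]; case: q. Qed.

Lemma pick1_ok us acc p u us' : pick1 us acc = Some (p, u, us') ->
  psingle (um u) = Some p /\
  (forall w, In w (u :: us') <-> In w acc \/ In w us).
Proof.
elim: us acc => //= w us IH acc; case E: psingle => [q|].
  case=> <- <- <-; split=> // z; rewrite catrevE.
  have := In_cat z (rev acc) us; have := In_rev z acc; rewrite /=; tauto.
by move=> /IH[e h]; split=> // z; have := h z => /=; tauto.
Qed.

Lemma cross_ok F p e f : pairwise ordp F -> inst_ok p F e -> inst_ok p F f ->
  crossi e f -> False.
Proof.
case: e f => a b [c d] pw [ka [kb [/= ha hb _ e]]] [kc' [kd [/= hc hd _ f]]] /=.
case E: (llt a c).
  case E1: (llt c b) => // E2.
  exact: (ps_cross e f (pw_lt pw ha hc E) (pw_lt pw hc hb E1) (pw_lt pw hb hd E2)).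
case E1: (llt c a) => //; case E2: (llt a d) => // E3.
exact: (ps_cross f e (pw_lt pw hc ha E1) (pw_lt pw ha hd E2) (pw_lt pw hd hb E3)).
Qed.

Lemma crossll_ok F p es fs : pairwise ordp F ->
  (forall e, In e es -> inst_ok p F e) -> (forall e, In e fs -> inst_ok p F e) ->
  crossll es fs -> False.
Proof.
move=> pw hes hfs; elim: es hes => //= e es IH hes.
case E: (crossl e fs) => hh; last by apply: IH hh => f hf; apply: hes; right.
clear hh IH.
have he := hes e (or_introl erefl).
elim: fs hfs E => //= f fs IHf hfs; case E: (crossi e f) => hh.
  exact: (cross_ok pw he (hfs f (or_introl erefl)) E).
by apply: IHf hh => f' hf'; apply: hfs; right.
Qed.

(** Where an instance of an edge crosses the settled edge, the actual page of the former is not [p],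
    so removing [p] cannot empty its mask. *)
Lemma prune_ok F p es us : pairwise ordp F -> (forall e, In e es -> inst_ok p F e) ->
  (forall u, In u us -> ue_ok F u) ->
  exists2 us', prune p es us = Some us' & forall u, In u us' -> ue_ok F u.
Proof.
move=> pw hes; elim: us => [|u us IH] /= h; first by exists [::].
have [w hw|r -> hr] := IH; first by apply: h; right.
have hu := h u (or_introl erefl).
have hur w : In w (u :: r) -> ue_ok F w by move=> [<-//|/hr].
case: u hu hur {h IH} => v y m i hu hur.
case E: (pok p m); last by exists (Uedge v y m i :: r).
case E2: crossll; last by exists (Uedge v y m i :: r).
case: hu => /= h1 h2 h3.
have ne : p <> pg v y by move=> e; rewrite -e in h3; apply: (crossll_ok pw hes h3 E2).
have h2' := prem_ok h2 ne.
by rewrite (pok_mnil h2'); exists (Uedge v y (prem p m) i :: r) => // w [<-|/hr].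
Qed.

Lemma frame_addl p a it : (lab (addl p a it), key (addl p a it)) = (lab it, key it).
Proof. by case: it p => ? ? ? ? ? ? ? ? ? []. Qed.
Lemma frame_addr p a it : (lab (addr p a it), key (addr p a it)) = (lab it, key it).
Proof. by case: it p => ? ? ? ? ? ? ? ? ? []. Qed.
Lemma frame_addarcr p a b its : frame (addarcr p a b its) = frame its.
Proof.
elim: its => //= it its IH; case: ifP => _; first by rewrite /= frame_addl.
by rewrite /= IH.
Qed.
Lemma frame_addarc p a b its : frame (addarc p a b its) = frame its.
Proof.
elim: its => //= it its IH; case: ifP => _; last by rewrite /= IH.
by rewrite /= frame_addr frame_addarcr.
Qed.

Lemma addl_ok F p a it ka : item_ok F it -> In (a, ka) F -> ps ka < ps (key it) ->
  arc p ka (key it) -> item_ok F (addl p a it).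
Proof.
move=> [vk ok] ha lt e; split; first by case: it p vk {ok lt e} => ? ? ? ? ? ? ? ? ? [].
move=> q; have {ok} := ok q; case: it p q vk lt e => n k t a1 b1 a2 b2 a3 b3 p q vk lt e.
by case: p q e => [] [] e [h1 h2]; split=> //= c; try exact: h1; try exact: h2;
  case=> [<-|]; try exact: h2; exists ka.
Qed.
Lemma addr_ok F p a it ka : item_ok F it -> In (a, ka) F -> ps (key it) < ps ka ->
  arc p (key it) ka -> item_ok F (addr p a it).
Proof.
move=> [vk ok] ha lt e; split; first by case: it p vk {ok lt e} => ? ? ? ? ? ? ? ? ? [].
move=> q; have {ok} := ok q; case: it p q vk lt e => n k t a1 b1 a2 b2 a3 b3 p q vk lt e.
by case: p q e => [] [] e [h1 h2]; split=> //= c; try exact: h1; try exact: h2;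
  case=> [<-|]; try exact: h1; exists ka.
Qed.

Lemma addarcr_ok F p a ka b kb its : pairwise ordp F -> In (a, ka) F -> In (b, kb) F ->
  ps ka < ps kb -> arc p ka kb -> (forall it, In it its -> item_ok F it /\ In (lab it, key it) F) ->
  forall it, In it (addarcr p a b its) -> item_ok F it.
Proof.
move=> pw ha hb lt e; elim: its => //= j its IH h it.
have [h1 h2] := h j (or_introl erefl); case: peqP => [ej|_] /= [<-|hin].
- rewrite -ej in h2; have ek := pw_fun pw hb h2; apply: (addl_ok h1 ha); by rewrite -ek.
- by case: (h it) => //; right.
- by [].
- by apply: IH hin => i hi; apply: h; right.
Qed.
Lemma addarc_ok F p a ka b kb its : pairwise ordp F -> In (a, ka) F -> In (b, kb) F ->
  ps ka < ps kb -> arc p ka kb -> (forall it, In it its -> item_ok F it /\ In (lab it, key it) F) ->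
  forall it, In it (addarc p a b its) -> item_ok F it.
Proof.
move=> pw ha hb lt e; elim: its => //= j its IH h it.
have [h1 h2] := h j (or_introl erefl); case: peqP => [ej|_] /= [<-|hin].
- rewrite -ej in h2; have ek := pw_fun pw ha h2; apply: (addr_ok h1 hb); by rewrite -ek.
- by apply: (addarcr_ok pw ha hb lt e) hin => i hi; apply: h; right.
- by [].
- by apply: IH hin => i hi; apply: h; right.
Qed.

Lemma frame_hd its : (if its is it :: _ then key it = key0 xH else False) <->
  (if frame its is a :: _ then a.2 = key0 xH else False).
Proof. by case: its. Qed.

Lemma addarcs_ok p es its : its_ok its -> (forall e, In e es -> inst_ok p (frame its) e) ->
  its_ok (addarcs p es its) /\ frame (addarcs p es its) = frame its.
Proof.
elim: es its => [|[a b] es IH] its //= ok h.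
have [pw hd hits] := ok.
have [ka [kb [/= ha hb lt e]]] := h (a, b) (or_introl erefl).
have [||ok' e'] := IH (addarc p a b its); rewrite ?frame_addarc //.
- split; rewrite ?frame_addarc //; first by apply/frame_hd; rewrite frame_addarc; apply/frame_hd.
  apply: (addarc_ok pw ha hb (pw_lt pw ha hb lt) e) => it hit; split; first exact: hits.
  exact: In_frame.
- by move=> f hf; apply: h; right.
by split=> //; rewrite e' frame_addarc.
Qed.

(** A mask reduced to one page contains the actual page, so the arcs then recorded are real and
    propagation cannot fail. Any [fuel] will do, since stopping early also leaves a true state. *)
Lemma settle_ok fuel its us : Inv (its, us) ->
  exists2 st, settle fuel its us = Some st & Inv st.
Proof.
elim: fuel its us => [|f fuel IH] its us inv /=.
  by case: pick1 => [[[? ?] ?]|]; exists (its, us).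
case E: pick1 => [[[p u] us']|]; last by exists (its, us).
have [ok hus] := inv; have [e h] := pick1_ok E.
have hu : ue_ok (frame its) u by apply: hus; have := h u => /= [[H _]]; case: H => //; left.
have [hu1 hu2 hu3] := hu; have ep := psingleP e hu2; rewrite ep in hu3.
have [pw _ _] := ok.
have [w hw|us'' -> hus''] := @prune_ok (frame its) p (ui u) us' pw hu3.
  by apply: hus; have := h w => /= [[H _]]; case: H => //; right.
have [ok' ef] := addarcs_ok ok hu3.
by apply: IH; split=> //= w; rewrite ef; exact: hus''.
Qed.

Lemma absentP k its : absent k its -> forall it, In it its -> key it <> k.
Proof.
elim: its => //= j its IH; case: peqP => // ne /IH h it [<-|/h //]; exact/nesym.
Qed.

Fixpoint xok F c (xs ys : seq positive) : Prop := match xs, ys with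
  | x :: xs', y :: ys' => In (x, kc c y) F /\ xok F c xs' ys'
  | [::], [::] => True | _, _ => False end.

Lemma xok_mono F F' c xs ys : (forall a, In a F -> In a F') -> xok F c xs ys -> xok F' c xs ys.
Proof. by move=> sub; elim: xs ys => [|x xs IH] [|y ys] //= [/sub ? /IH]. Qed.

Lemma arc_vy c v y : In y (nb v) -> arc (pg v y) (kc c v) (kc c y).
Proof. by move=> h; exists v, y, c; split=> //; left. Qed.

(** If the sweep excluded the actual page of the edge from [v] to [y], it would exhibit a real arc
    of that page crossing this edge, against [confN]. *)
Lemma sweeps_ok its v c ys xs mss ds : its_ok its ->
  (forall it, In it its -> ps (key it) != ps (kc c v)) ->
  0 < below (ps (kc c v)) its -> (forall y, In y ys -> In y (nb v)) ->
  sweeps its (map (kc c) ys) = Some (xs, mss) -> pokl (map (pg v) ys) ds ->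
  good (below (ps (kc c v)) its).-1 (map (pg v) ys) ds mss /\ xok (frame its) c xs ys.
Proof.
move=> ok neP b0; elim: ys xs mss ds => [|y ys IH] xs mss [|d ds] hy //=.
  by case=> <- <-.
case E: sweep => [[x ms]|] //; case E2: sweeps => [[xs' mss']|] // [<- <-] /andP[hd hds].
have [h1 h2] := IH xs' mss' ds (fun z hz => hy z (or_intror hz)) E2 hds.
have [h3 h4 h5] := sweep_ok ok E neP b0.
split=> //=; rewrite hd h1 h4 !andbT /=; apply/andP; split.
  apply/negPn/negP => /h5 cf; apply: confN cf; apply: arc_vy.
  by apply: hy; left.
by rewrite prednK //; exact: count_size.
Qed.

Lemma validk0 v : vertexb v -> validk (key0 v).
Proof. by exists v => //; exists false. Qed.
Lemma validk1 v : vertexb v -> validk (key1 v).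
Proof. by exists v => //; exists true. Qed.

(** Pole A is the first item and the first vertex on the spine, so at least one item precedes [k],
    and the predecessor in slot numbers never truncates at 0. *)
Lemma placed its k : its_ok its -> validk k -> absent k its ->
  (forall it, In it its -> ps (key it) != ps k) /\ 0 < below (ps k) its.
Proof.
move=> [pw hd ok] vk /absentP ab; split=> [it hit|].
  apply/eqP => /ps_inj e; apply: (ab it hit); apply: e => //; by have [] := ok it hit.
case: its hd ab ok {pw} => // it its e ab ok; rewrite /below /= e ps_min //.
by move=> ek; apply: (ab it (or_introl erefl)); rewrite e ek.
Qed.

Lemma pokl_full ys v : pokl (map (pg v) ys) (map (fun _ => full) ys).
Proof. by elim: ys => //= y ys ->; case: (pg v y). Qed.

Lemma inst_okP p F a b ka kb : pairwise ordp F -> In (a, ka) F -> In (b, kb) F ->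
  ka <> kb -> arc p ka kb -> inst_ok p F (inst a b).
Proof.
move=> pw ha hb ne e; rewrite /inst; case E: (llt a b); first by exists ka, kb.
exists kb, ka; split=> //=; last exact: arc_sym.
by case: (pw_In pw ha hb) => [[_ //]|/andP[]/=|/andP[]//]; rewrite E.
Qed.

Lemma kcI c v w : vertexb v -> vertexb w -> kc c v = kc c w -> v = w.
Proof. by move=> _ _; case: c; rewrite /= /key1 /key0; [case: (pole v); case: (pole w)|]; case. Qed.

Lemma pmap_In T U (f : T -> option U) x y s : In x s -> f x = Some y -> In y (pmap f s).
Proof.
elim: s => //= z s IH [->|/IH h] e; first by rewrite e /=; left.
by have := h e; case: (f z) => //= ? ?; right.
Qed.
Lemma flatten_In T U (f : T -> seq U) x y s : In x s -> In y (f x) -> In y (flatten (map f s)).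
Proof.
elim: s => //= z s IH [->|h] h'; apply/In_cat; [by left|by right; apply: IH].
Qed.

Hypothesis nb_irr : forall v, ~ In v (nb v).

Lemma mkues1_ok F v n ys xs ms : pairwise ordp F -> (forall y, In y ys -> In y (nb v)) ->
  vertexb v -> In (n, key0 v) F -> xok F false xs ys -> pokl (map (pg v) ys) ms ->
  forall u, In u (mkues1 v n ys xs ms) -> ue_ok F u.
Proof.
move=> pw hy vv hn; elim: ys xs ms hy => [|y ys IH] [|x xs] [|m ms] hy //= [hx hxs] /andP[hm hms] u.
have yv := hy y (or_introl erefl).
case=> [<-|]; last by apply: IH => // z hz; apply: hy; right.
split=> //= e [<-|//]; apply: (inst_okP pw hn hx); last exact: (arc_vy false).
by case=> e'; case: (@nb_irr v); rewrite {1}e'.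
Qed.

Lemma mkues2_ok F v n0 n1 ys xs0 xs1 ms : pairwise ordp F ->
  (forall y, In y ys -> In y (nb v)) ->
  vertexb v -> In (n0, key0 v) F -> In (n1, key1 v) F ->
  xok F false xs0 ys -> xok F true xs1 ys -> pokl (map (pg v) ys) ms ->
  all selfok (mkues2 v n0 n1 ys xs0 xs1 ms) /\
  forall u, In u (mkues2 v n0 n1 ys xs0 xs1 ms) -> ue_ok F u.
Proof.
move=> pw hy vv hn0 hn1; elim: ys xs0 xs1 ms hy => [|y ys IH] [|x xs] [|x1 xs1] [|m ms] hy //=.
move=> [hx hxs] [hx1 hxs1] /andP[hm hms].
have yv := hy y (or_introl erefl); have vy := nb_vertex yv.
have ney : v <> y by move=> e'; case: (@nb_irr v); rewrite {1}e'.
have [|h1 h2] := IH xs xs1 ms _ hxs hxs1 hms; first by move=> z hz; apply: hy; right.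
have i0 : inst_ok (pg v y) F (inst n0 x).
  by apply: (inst_okP pw hn0 hx); [case|exact: (arc_vy false)].
have i1 : inst_ok (pg v y) F (inst n1 x1).
  by apply: (inst_okP pw hn1 hx1); [move/(kcI (c := true) vv vy)|exact: (arc_vy true)].
split=> [|u]; first by rewrite h1 andbT; apply/negP; exact: (cross_ok pw i0 i1).
by case=> [<-|/h2 //]; split=> //= e [<-|[<-|//]].
Qed.

Lemma Inv_ins its us pre it tl k b : its = pre ++ it :: tl -> Inv (its, us) ->
  its_ok (pre ++ it :: newitem (midlab it tl) k b :: tl) ->
  (forall a, In a (frame its) -> In a (frame (pre ++ it :: newitem (midlab it tl) k b :: tl)))
  /\ forall u, In u us -> ue_ok (frame (pre ++ it :: newitem (midlab it tl) k b :: tl)) u.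
Proof.
move=> -> [_ hus] ok.
have sub a : In a (frame (pre ++ it :: tl)) ->
    In a (frame (pre ++ it :: newitem (midlab it tl) k b :: tl)).
  rewrite !frame_cat => /In_cat h; apply/In_cat; case: h => [|[|]] h; [by left|by right; left|].
  by right; right; right.
by split=> // u /hus; apply: ue_mono.
Qed.

Lemma In_new pre it n k b tl : In (n, k) (frame (pre ++ it :: newitem n k b :: tl)).
Proof. by rewrite frame_cat; apply/In_cat; right; right; left. Qed.

Lemma catrev_ins T (pre : seq T) it s : catrev (it :: catrev pre [::]) s = pre ++ it :: s.
Proof. by rewrite -[catrev pre _]/(rev pre) /= catrevE revK. Qed.

Lemma nth_trues its j : nth true (trues its) j.
Proof. by rewrite /trues; elim: its j => [|? ? IH] [|j] /=. Qed.

Lemma insert1_ok v st : Inv st -> exists2 st', In st' (insert1 nb v st) & Inv st'.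
Proof.
case: st => its us inv; have [ok hus] := inv; rewrite /insert1.
have dflt : exists2 st', In st' [:: (its, us)] & Inv st' by exists (its, us) => //; left.
case En: (nb v) => [//|y0 ys0]; have vv : vertexb v by rewrite /vertexb En orbT.
rewrite -En; case: ifP => // ab; case Es: sweeps => [[xs mss]|] //.
have vk := validk0 vv; have [neP b0] := placed ok vk ab.
have [hg hx] := sweeps_ok (c := false) ok neP b0 (fun y h => h) Es (pokl_full _ v).
set j := (below _ its).-1 in hg.
have jlt : j < size its by rewrite prednK //; exact: count_size.
have [|pre [it [tl [ms [e sz hp hin]]]]] := cands_ok [::] jlt _ (nth_trues its j) hg.
  by rewrite size_map.
have ok' : its_ok (pre ++ it :: newitem (midlab it tl) (key0 v) false :: tl).
  by apply: ins_ok; rewrite -?e.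
have [sub hus'] := Inv_ins e inv ok'.
have [pw _ _] := ok'.
pose us' := mkues1 v (midlab it tl) (nb v) xs ms ++ us.
have [|st' h1 h2] := @settle_ok us' (pre ++ it :: newitem (midlab it tl) (key0 v) false :: tl) us'.
  split=> // u /In_cat[|/hus' //].
  by apply: mkues1_ok => //; [exact: In_new|exact: xok_mono hx].
by exists st' => //; apply: pmap_In hin _; rewrite catrev_ins.
Qed.

Lemma size_flags pr su b its : size (flags pr su b its).1 = size its.
Proof.
elim: its b => //= it its IH b; move: (IH (if b then true else isk su (key it))).
by case: flags => /= ? ? ->.
Qed.

Lemma flags_later pr su b its : (flags pr su b its).2 -> exists2 x, In x its & isk pr (key x).
Proof.
elim: its b => //= it its IH b.
move: (IH (if b then true else isk su (key it))); case: flags => fl [] /= H h.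
  by have [//|x ? ?] := H _; exists x => //; right.
by exists it => //; left.
Qed.

Lemma flags_ok pr su pre it tl :
  (forall x, In x (pre ++ [:: it]) -> ~~ isk su (key x)) ->
  (forall x, In x tl -> ~~ isk pr (key x)) ->
  nth true (flags pr su false (pre ++ it :: tl)).1 (size pre).
Proof.
elim: pre => [|x pre IH] /= h1 h2.
  have := h1 it (or_introl erefl) => /negbTE ->.
  have := @flags_later pr su false tl; case: flags => fl later /=; case: later => //.
  by case=> // x /h2 /negbTE ->.
have := h1 x (or_introl erefl) => /negbTE ->.
by have := IH (fun z hz => h1 z (or_intror hz)) h2; case: flags.
Qed.

Lemma firstpairedP its k : firstpaired its = Some k ->
  exists2 it, In it its & exists2 w, key it = xO w & k = key1 w.
Proof.
have I it its' : (exists2 it, In it its' & exists2 w, key it = xO w & k = key1 w) ->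
    exists2 it0, In it0 (it :: its') & exists2 w, key it0 = xO w & k = key1 w.
  by move=> [j hj h]; exists j => //; right.
elim: its => //= it its IH; case: (paired it); last by move=> h; apply: I; apply: IH.
case E: (key it) => [w|w|]; try by move=> h; apply: I; apply: IH.
by move=> [<-]; exists it; [left|exists w].
Qed.

Lemma validkO w : validk (xO w) -> vertexb w.
Proof. by move=> [v vv [[]]]; rewrite /= /key1 /key0; try case: pole => //; case=> ->. Qed.

Lemma absentI k its : (forall it, In it its -> key it <> k) -> absent k its.
Proof.
elim: its => //= j its IH h; case: peqP => [e|_]; first by case: (h j (or_introl erefl)).
by apply: IH => it hit; apply: h; right.
Qed.

Lemma iskP o k : isk o k -> o = Some k.
Proof. by case: o => //= k' /peqP ->. Qed.

(** The slot of copy 1 of [v] passes the filter. Otherwise copy 1 of a paired vertex would lie on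
    one side of copy 1 of [v] while its copy 0 lies on the other side of copy 0 of [v], against
    [ps_same]. *)
Lemma flags_new v pre it tl n b :
  let its := pre ++ it :: newitem n (key0 v) b :: tl in
  its_ok its -> vertexb v -> (forall x, In x its -> ps (key x) != ps (key1 v)) ->
  0 < below (ps (key1 v)) its ->
  nth true (flags (firstpaired (it :: catrev pre [::])) (firstpaired tl) false its).1
    (below (ps (key1 v)) its).-1.
Proof.
move=> its ok vv neP b0; set P := ps (key1 v) in neP b0 *; set j := _.-1.
have [pw _ vok] := ok.
have jlt : j < size its by rewrite prednK //; exact: count_size.
have eits : its = take j its ++ nth it its j :: drop j.+1 its.
  by rewrite -drop_nth // cat_take_drop.
have sz : size (take j its) = j by rewrite size_takel // ltnW.
have [h1 h2] : (forall a, In a (frame (rcons (take j its) (nth it its j))) -> ps a.2 < P) /\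
   (forall a, In a (frame (drop j.+1 its)) -> P <= ps a.2).
  apply: below_split; rewrite cat_rcons -eits //.
  by rewrite size_rcons sz prednK.
have pw' := pw; rewrite frame_cat /= pairwise_cat /= in pw'.
case/and4P: pw' => /allIn ar _ /andP[itn _] /andP[/allIn hi _].
have := @flags_ok (firstpaired (it :: catrev pre [::])) (firstpaired tl)
  (take j its) (nth it its j) (drop j.+1 its).
rewrite -eits sz; apply => x hx; apply/negP => /iskP /firstpairedP[z hz [w ez ew]].
- have zt : In z its by apply/In_cat; right; right; right.
  have vw : vertexb w by apply: validkO; rewrite -ez; have [] := vok z zt.
  have /andP[_ /= lt] := hi _ (In_frame hz); rewrite ez in lt.
  have := ps_same vv vw lt; rewrite -ew ltnNge => /negP; apply.
  apply: ltnW; apply: (h1 (lab x, key x)); rewrite -cats1; exact: In_frame.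
- have zt : In z (pre ++ [:: it]).
    have : In z (rev (pre ++ [:: it])) by rewrite rev_cat.
    by move/In_rev.
  have zits : In z its.
    by apply/In_cat; case/In_cat: zt => [|[->|//]]; [left|right; left].
  have vw : vertexb w by apply: validkO; rewrite -ez; have [] := vok z zits.
  have lt : ps (key0 w) < ps (key0 v).
    rewrite -[key0 w]ez; case/In_cat: zt => [hzp|[<-|//]]; last by case/andP: itn.
    by have /allIn /(_ (n, key0 v)) H := ar _ (In_frame hzp);
      have /andP[] := H (or_intror (or_introl erefl)).
  have := ps_same vw vv lt; rewrite -ew ltnNge => /negP; apply.
  exact: (h2 (lab x, key x) (In_frame hx)).
Qed.

Lemma insert2_ok v st : Inv st -> exists2 st', In st' (insert2 nb v st) & Inv st'.
Proof.
case: st => its us inv; have [ok hus] := inv; rewrite /insert2.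
have dflt : exists2 st', In st' [:: (its, us)] & Inv st' by exists (its, us) => //; left.
case En: (nb v) => [//|y0 ys0]; have vv : vertexb v by rewrite /vertexb En orbT.
rewrite -En; case Ep: (pole v) => //; case: ifP => // ab; case: ifP => // ab1.
case Es: sweeps => [[xs mss]|] //.
have vk := validk0 vv; have [neP b0] := placed ok vk ab.
have [hg hx] := sweeps_ok (c := false) ok neP b0 (fun y h => h) Es (pokl_full _ v).
set j := (below _ its).-1 in hg.
have jlt : j < size its by rewrite prednK //; exact: count_size.
have [|pre [it [tl [ms [e sz hp hin]]]]] := cands_ok [::] jlt _ (nth_trues its j) hg.
  by rewrite size_map.
pose its0 := pre ++ it :: newitem (midlab it tl) (key0 v) true :: tl.
have ok' : its_ok its0 by apply: ins_ok; rewrite -?e.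
have [sub hus'] := Inv_ins e inv ok'.
(* Copy 0 is now fixed in its actual slot; what remains is the search over the slots of copy 1. *)
suff [st' h1 h2] : exists2 st', In st'
   ((fun c : cand =>
        let: (n, (rp, tl), ms) := c in
        let its0 := catrev rp (newitem n (key0 v) true :: tl) in
        if sweeps its0 (map key1 (nb v)) is Some (xs1, mss1) then
          pmap (fun c : cand =>
            let: (n1, (rp1, tl1), ms1) := c in
            let es := mkues2 v n n1 (nb v) xs xs1 ms1 in
            if all selfok es then
              let us' := es ++ us in
              settle us' (catrev rp1 (newitem n1 (key1 v) false :: tl1)) us'
            else None)
            (cands (flags (firstpaired rp) (firstpaired tl) false its0).1 ms mss1 [::] its0)
        else [:: (its, us)]) (midlab it tl, (it :: catrev pre [::], tl), ms)) & Inv st'.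
  by exists st' => //; apply: flatten_In hin h1.
rewrite [catrev (it :: _) _]catrev_ins -/its0; cbv zeta.
case Es1: sweeps => [[xs1 mss1]|] //.
have vk1 := validk1 vv.
have [|neP1 b1] := @placed its0 (key1 v) ok' vk1.
  apply: absentI => x /In_cat[hxp|[<-|[<-|hxt]]].
  - by apply: (absentP ab1); rewrite e; apply/In_cat; left.
  - by apply: (absentP ab1); rewrite e; apply/In_cat; right; left.
  - by rewrite /= /key0 /key1 Ep.
  - by apply: (absentP ab1); rewrite e; apply/In_cat; right; right.
have [hg1 hx1] := sweeps_ok (c := true) ok' neP1 b1 (fun y h => h) Es1 hp.
set j1 := (below _ its0).-1 in hg1.
have jlt1 : j1 < size its0 by rewrite prednK //; exact: count_size.
have hfl := flags_new ok' vv neP1 b1.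
have [|pre1 [it1 [tl1 [ms1 [e1 sz1 hp1 hin1]]]]] := cands_ok [::] jlt1 _ hfl hg1.
  by rewrite size_flags.
have ok1 : its_ok (pre1 ++ it1 :: newitem (midlab it1 tl1) (key1 v) false :: tl1).
  by apply: ins_ok; rewrite -?e1.
have [sub1 hus1] := @Inv_ins its0 us pre1 it1 tl1 (key1 v) false e1 (conj ok' hus') ok1.
have [pw1 _ _] := ok1.
have [sok hues] : all selfok (mkues2 v (midlab it tl) (midlab it1 tl1) (nb v) xs xs1 ms1) /\
  forall u, In u (mkues2 v (midlab it tl) (midlab it1 tl1) (nb v) xs xs1 ms1) ->
    ue_ok (frame (pre1 ++ it1 :: newitem (midlab it1 tl1) (key1 v) false :: tl1)) u.
  apply: mkues2_ok => //.
  - by apply: sub1; exact: In_new.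
  - exact: In_new.
  - by apply: xok_mono hx => a /sub /sub1.
  - by apply: xok_mono hx1.
pose us' := mkues2 v (midlab it tl) (midlab it1 tl1) (nb v) xs xs1 ms1 ++ us.
have [|st' h1 h2] := @settle_ok us'
  (pre1 ++ it1 :: newitem (midlab it1 tl1) (key1 v) false :: tl1) us'.
  by split=> // u /In_cat[/hues|/hus1].
by exists st' => //; apply: (pmap_In hin1); rewrite sok catrev_ins.
Qed.

Lemma setm_ok F i m us u : nth None (map Some us) i = Some u ->
  pok (pg (uv u) (uy u)) m -> (forall w, In w us -> ue_ok F w) ->
  forall w, In w (setm i m us) -> ue_ok F w.
Proof.
elim: us i => [|w us IH] [|i] //=.
  move=> [->] {IH} hp h z; case: u hp h => v y m' e hp h [<-|hz]; last by apply: h; right.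
  by have [h1 h2 h3] := h _ (or_introl erefl).
move=> hn hp h z; case: w h => v' y' m' e' h [<-|]; first by apply: h; left.
by apply: (IH i) => // x hx; apply: h; right.
Qed.

Lemma nth_In T (us : seq T) i u : nth None (map Some us) i = Some u -> In u us.
Proof. by elim: us i => [|w us IH] [|i] //=; [case; left|move/IH; right]. Qed.

Lemma split_ok i st : Inv st -> exists2 st', In st' (split i st) & Inv st'.
Proof.
case: st => its us inv; have [ok hus] := inv; rewrite /split.
case E: nth => [u|]; last by exists (its, us) => //; left.
set p := pg (uv u) (uy u).
have hu : ue_ok (frame its) u.
  exact: hus (nth_In E).
have [_ hp _] := hu.
pose us' := setm i (pone p) us.
have [|st' h1 h2] := @settle_ok us' its us'.
  by split=> //; apply: (setm_ok E) => //; rewrite -/p; case: (p).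
exists st' => //; apply: (@pmap_In _ _ _ p); last by rewrite hp.
by case: (p); [left|right; left|right; right; left].
Qed.

(** The subtrees of a node form a list, so induction needs a hypothesis for every member of it,
    which [List.Forall] carries. *)
Definition tree_nest (Q : tree -> Prop)
  (f1 : forall v ts, List.Forall Q ts -> Q (I1 v ts))
  (f2 : forall v ts, List.Forall Q ts -> Q (I2 v ts))
  (f3 : forall i ts, List.Forall Q ts -> Q (Sp i ts)) : forall t, Q t :=
  fix F t := let fix G ts : List.Forall Q ts :=
      if ts is t :: ts' then List.Forall_cons t (F t) (G ts') else List.Forall_nil Q in
    match t with I1 v ts => f1 v ts (G ts) | I2 v ts => f2 v ts (G ts)
    | Sp i ts => f3 i ts (G ts) end.

(** A state with [Inv] has a successor with [Inv], but a checked tree ends every branch in an empty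
    list of successors. *)
Lemma check_sound (t : tree) : forall st, check nb t st -> Inv st -> False.
Proof.
have H ts ss : List.Forall (fun t => forall st, check nb t st -> Inv st -> False) ts ->
    (fix all2 ts ss := match ts, ss with
    | [::], [::] => true
    | t :: ts', s :: ss' => if check nb t s then all2 ts' ss' else false
    | _, _ => false end) ts ss -> forall st, In st ss -> Inv st -> False.
  elim: ts ss => [|t' ts IH] [|s ss] //= /List.Forall_cons_iff[ht hts].
  case E: (check nb t' s) => // h st [<-|hin]; first exact: ht.
  exact: (IH ss).
elim/tree_nest: t => [v ts|v ts|i ts] /H h st /= /h {}h.
- by move=> /(insert1_ok v)[st' h1 h2]; apply: h h1 h2.
- by move=> /(insert2_ok v)[st' h1 h2]; apply: h h1 h2.
- by move=> /(split_ok i)[st' h1 h2]; apply: h h1 h2.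
Qed.

Lemma labelofP k s : (exists l, In (l, k) s) -> In (labelof k s, k) s.
Proof.
elim: s => [[l []]|[l k'] s IH] //= [l' [[_ ->]|h]]; first by case: peqP => // _; left.
by case: peqP => [->|_]; [left|right; apply: IH; exists l'].
Qed.

Lemma zip_In (ls ks : seq positive) k : size ls = size ks -> In k ks ->
  exists l, In (l, k) (zip ls ks).
Proof.
elim: ls ks => [|l ls IH] [|k' ks] //= [e] [->|/(IH _ e)[l' h]]; first by exists l; left.
by exists l'; right.
Qed.

Lemma In_zip (ls ks : seq positive) l k : In (l, k) (zip ls ks) -> In l ls /\ In k ks.
Proof.
by elim: ls ks => [|l' ls IH] [|k' ks] //= [[-> ->]|/IH[h1 h2]]; split; [left|left|right|right].
Qed.

Lemma pairwise_zip (ls ks : seq positive) : pairwise llt ls ->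
  pairwise (fun a b => ps a < ps b) ks -> pairwise ordp (zip ls ks).
Proof.
elim: ls ks => [|l ls IH] [|k ks] //= /andP[/allIn hl pl] /andP[/allIn hk pk].
rewrite IH // andbT; apply/allIn => -[l' k'] h; rewrite /ordp /=.
by have [/hl -> /hk ->] := In_zip h.
Qed.

Lemma In_start it ks : In it (start_items ks) ->
  exists l k b, In (l, k) (zip labels ks) /\ it = newitem l k b.
Proof.
rewrite /start_items; elim: zip => //= -[l k] s IH [<-|/IH[l' [k' [b' [h ->]]]]].
  by do 3!eexists; split; [left|].
by exists l', k', b'; split=> //; right.
Qed.

Lemma refutes_sound t k1 k2 k3 k4 k5 :
  let ks := [:: key0 xH; k1; k2; k3; k4; k5] in
  refutes nb t ks -> pairwise (fun a b => ps a < ps b) ks ->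
  (forall k, In k ks -> validk k) ->
  (forall v, In v [:: 1; 2; 3; 4]%positive -> In (key0 v) ks /\ In (key1 v) ks) ->
  (forall v y, In v [:: 3; 4]%positive -> In y [:: 1; 2]%positive -> In y (nb v)) ->
  pg 3%positive 1%positive = P1 -> pg 3%positive 2%positive = P2 -> False.
Proof.
move=> ks; rewrite /refutes => hr pk vk hin hnb e1 e2.
have ef : frame (start_items ks) = zip labels ks by [].
have pw : pairwise ordp (zip labels ks) by apply: pairwise_zip.
have hlab k : In k ks -> In (labelof k (zip labels ks), k) (zip labels ks).
  by move=> hk; apply: labelofP; apply: zip_In.
have hedge v y m : In v [:: 3; 4]%positive -> In y [:: 1; 2]%positive ->
    pok (pg v y) m -> ue_ok (zip labels ks) (start_edge ks v y m).
  move=> hv hy hm; have h := hnb v y hv hy.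
  have [v0 v1] : In (key0 v) ks /\ In (key1 v) ks.
    by apply: hin; case: hv => [<-|[<-|//]]; [right; right; left|right; right; right; left].
  have [y0 y1] : In (key0 y) ks /\ In (key1 y) ks.
    by apply: hin; case: hy => [<-|[<-|//]]; [left|right; left].
  split=> // e [<-|[<-|//]].
    apply: (inst_okP pw (hlab _ v0) (hlab _ y0)); last exact: (arc_vy false).
    by case: hv hy => [<-|[<-|//]] [<-|[<-|//]].
  apply: (inst_okP pw (hlab _ v1) (hlab _ y1)); last exact: (arc_vy true).
  by case: hv hy => [<-|[<-|//]] [<-|[<-|//]].
have inv : Inv (start_items ks, start_edges ks).
  split; last first.
    move=> u; rewrite [_.1]/= ef => -[<-|[<-|[<-|[<-|//]]]];
      apply: hedge => /=; auto; first [by rewrite e1|by rewrite e2|by case: (pg _ _)].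
  split; [by rewrite ef|by []|move=> it].
  move=> h; have [l [k [b [hk ->]]]] := In_start h; split;
    first by apply: vk; have [] := In_zip hk.
  by move=> p; split; case: p.
have [st e h] := settle_ok (start_edges ks) inv.
by rewrite e in hr; exact: check_sound hr h.
Qed.

End Sound.

End Soundness.
Import Soundness.

(** * From a book embedding to two copies of the same type in one of the five orders *)

Module Reduction.
Import fintype finset.
Local Open Scope nat_scope.

(** Renames the pages of tA and tB, known to be distinct, as [P1] and [P2]; by injectivity, equal
    names mean equal pages. *)
Lemma page_inj (a b : 'I_3) : a != b ->
  injective (fun i => if i == a then P1 else if i == b then P2 else P3).
Proof.
by case: a b => [[|[|[|]]]] // ? [[|[|[|]]]] // ? ? [[|[|[|]]]] // ? [[|[|[|]]]] // ? ? //;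
  exact: val_inj.
Qed.

Section Graph.
Variables (inner : seq positive) (nb : positive -> seq positive) (N : nat).
(** The bound is written with [.-1.+1] because [inord] needs one of the form [n.+1]. *)
Definition gtype := ('I_2 + 'I_N * 'I_((size inner).-1.+1))%type.
Definition vnum (x : gtype) : positive := match x with
  | inl i => if val i is 0 then xH else xO xH | inr p => nth xH inner p.2 end.
Definition samecopy (x y : gtype) := match x, y with
  | inr p, inr q => p.1 == q.1 | _, _ => true end.
Definition padj v w := memp w (nb v) || memp v (nb w).
Definition gadj (x y : gtype) := samecopy x y && padj (vnum x) (vnum y).
Lemma padjC v w : padj v w = padj w v. Proof. exact: orbC. Qed.
Lemma samecopyC x y : samecopy x y = samecopy y x.
Proof. by case: x y => [i|p] [j|q] //=; rewrite eq_sym. Qed.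
Lemma gadj_sym : symmetric gadj.
Proof. by move=> x y; rewrite /gadj samecopyC padjC. Qed.
Hypothesis nb_irr : forall v, ~ In v (nb v).
Lemma gadj_irrefl : irreflexive gadj.
Proof.
move=> x; apply/negP => /andP[_]; rewrite /padj orbb => /mempP; exact: nb_irr.
Qed.
Definition gluing := SGraph gadj_sym gadj_irrefl.

Hypothesis nb_vertex : forall v y, In y (nb v) -> vertexb nb y.
Hypothesis inner_vertex : forall v, vertexb nb v -> pole v = false -> In v inner.

Definition emb (j : 'I_N) (v : positive) : gluing :=
  match v with
  | xH => inl ord0 | xO xH => inl ord_max
  | _ => inr (j, inord (find (peq v) inner)) end.

Lemma embE j v : pole v = false -> emb j v = inr (j, inord (find (peq v) inner)).
Proof. by case: v => [?|[?|?|]|]. Qed.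
Lemma poleP v : pole v -> v = xH \/ v = xO xH.
Proof. by case: v => [?|[?|?|]|] //; [right|left]. Qed.

Lemma vnum_emb j v : vertexb nb v -> vnum (emb j v) = v.
Proof.
case E: (pole v) => vv; first by case: (poleP E) => ->.
have /mempP hv := inner_vertex vv E.
rewrite embE //= inordK; last by have := hv; rewrite /memp has_find; case: size.
by apply/esym/peqP; exact: nth_find.
Qed.

Lemma emb_inj j k v w : vertexb nb v -> vertexb nb w -> emb j v = emb k w ->
  v = w /\ (j = k \/ pole v).
Proof.
move=> vv vw e; have e' : v = w by rewrite -(vnum_emb j vv) e vnum_emb.
split=> //; case E: (pole v); first by right.
by left; move: e; rewrite -e' !embE // => -[].
Qed.

Lemma emb_adj j v w : vertexb nb v -> vertexb nb w -> padj v w -> adj (emb j v) (emb j w).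
Proof.
move=> vv vw h; rewrite /= /gadj !vnum_emb // h andbT.
case E: (pole v); first by case: (poleP E) => ->.
case E': (pole w); first by case: (poleP E') => ->; case: emb.
by rewrite !embE //= eqxx.
Qed.

Section Book.
Variables (lt : rel gluing) (page : 'I_3 -> {set {set gluing}}).
Hypothesis book : book_embedding lt page.
Let lt_irr : irreflexive lt. Proof. by case: book => [[]]. Qed.
Let lt_trans : transitive lt. Proof. by case: book => [[]]. Qed.
Let lt_tot x y : x != y -> lt x y || lt y x. Proof. case: book => [[_ _ H] _ _ _]; exact: H. Qed.

Definition col x y : 'I_3 := odflt ord0 [pick i | [set x; y] \in page i].
Lemma colC x y : col x y = col y x. Proof. by rewrite /col finset.setUC. Qed.
Lemma colP x y : adj x y -> [set x; y] \in page (col x y).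
Proof.
move=> xy; rewrite /col; case: pickP => //= h.
have : [set x; y] \in edges gluing.
  by rewrite inE; apply/existsP; exists x; apply/existsP; exists y; rewrite xy eqxx.
case: book => _ <- _ _ /finset.bigcupP[i _ hi].
by have := h i; rewrite /= hi.
Qed.

Definition rank x := #|[set y | lt y x]|.
Lemma rank_lt x y : lt x y -> rank x < rank y.
Proof.
move=> xy; apply: proper_card; apply/properP; split.
  by apply/subsetP => z; rewrite !inE => /lt_trans; apply.
by exists x; rewrite inE ?lt_irr.
Qed.
Lemma rank_inj : injective rank.
Proof.
move=> x y e; apply/eqP; apply/negPn/negP => /lt_tot /orP[] /rank_lt; rewrite e ltnn //.
Qed.
Lemma rank_ltE x y : rank x < rank y -> lt x y.
Proof.
move=> h; have : x != y by apply: contraTneq h => ->; rewrite ltnn.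
by move/lt_tot => /orP[//|/rank_lt h']; have := ltn_trans h h'; rewrite ltnn.
Qed.
Lemma rank_max x : rank x < #|gluing|.
Proof.
rewrite -cardsT; apply: proper_card; apply/properP; split;
  first by apply/subsetP => y _; rewrite inE.
by exists x; rewrite inE ?lt_irr.
Qed.

Definition noncross (pos : gluing -> nat) := forall x y z w, adj x y -> adj z w ->
  col x y = col z w -> pos x < pos z -> pos z < pos y -> pos y < pos w -> False.

Lemma noncross_rank : noncross rank.
Proof.
move=> x y z w xy zw e /rank_ltE h1 /rank_ltE h2 /rank_ltE h3.
case: book => _ _ _ /(_ (col x y) [set x; y] [set z; w]); apply.
- exact: colP.
- by rewrite e; exact: colP.
have ne a b : lt a b -> b != a by apply: contraTneq => ->; rewrite lt_irr.
exists x, y, z, w; split=> //; rewrite ?h1 ?h2 ?h3 //.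
- rewrite -setI_eq0; apply/eqP/setP => a; rewrite !inE; apply/negP.
  have n1 := ne _ _ h1; have n2 := ne _ _ h2; have n3 := ne _ _ h3.
  have n4 := ne _ _ (lt_trans (lt_trans h1 h2) h3).
  case/andP => /orP[] /eqP -> /orP[] /eqP e'; subst.
  + by rewrite eqxx in n1.
  + by rewrite eqxx in n4.
  + by rewrite eqxx in n2.
  + by rewrite eqxx in n3.
- exact: lt_trans h1 h2.
- exact: lt_trans h2 h3.
Qed.

Definition rot a x := if rank a <= rank x then rank x - rank a
  else rank x + #|gluing| - rank a.
Lemma rot0 a : rot a a = 0. Proof. by rewrite /rot leqnn subnn. Qed.
Lemma rot_inj a : injective (rot a).
Proof.
move=> x y; rewrite /rot => e; apply: rank_inj; move: e.
have := rank_max x; have := rank_max y; have := rank_max a.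
move: (rank x) (rank y) (rank a) #|_| => rx ry ra n; case: (leqP ra rx); case: (leqP ra ry); lia.
Qed.
Lemma rot_lt a x : rot a x < #|gluing|.
Proof.
have := rank_max x; have := rank_max a; rewrite /rot.
by move: (rank x) (rank a) #|_| => rx ra n; case: (leqP ra rx); lia.
Qed.
(** Crossing depends only on the cyclic order of the four ends, which rotation preserves. The four
    instances of [noncross_rank] are for the four points that can come first before the rotation. *)
Lemma noncross_rot a : noncross (rot a).
Proof.
move=> x y z w xy zw e h1 h2 h3.
have mx := rank_max x; have my := rank_max y; have mz := rank_max z; have mw := rank_max w.
have ma := rank_max a; have yx := xy; have wz := zw.
rewrite adj_sym in yx; rewrite adj_sym in wz.
have e1 : col z w = col y x by rewrite (colC y) e.
have e2 : col y x = col w z by rewrite (colC y) (colC w).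
have e3 : col w z = col x y by rewrite (colC w).
have H0 := noncross_rank xy zw e; have H1 := noncross_rank zw yx e1.
have H2 := noncross_rank yx wz e2; have H3 := noncross_rank wz xy e3.
move: h1 h2 h3 mx my mz mw ma H0 H1 H2 H3; rewrite /rot.
move: (rank x) (rank y) (rank z) (rank w) (rank a) #|_| => rx ry rz rw ra n; clear.
case: (leqP ra rx); case: (leqP ra ry); case: (leqP ra rz); case: (leqP ra rw); lia.
Qed.

(** Reflection of the spine that leaves [a] first. *)
Definition refl a x := if x == a then 0 else #|gluing| - rot a x.
Lemma refl_inj a : injective (refl a).
Proof.
move=> x y; rewrite /refl; have hx := rot_lt a x; have hy := rot_lt a y.
by case: eqP => [->|_]; case: eqP => [->|_] //; [lia|lia|move=> e; apply: (@rot_inj a); lia].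
Qed.
Lemma noncross_refl a : noncross (refl a).
Proof.
move=> x y z w xy zw e; rewrite /refl.
have mx := rot_lt a x; have my := rot_lt a y; have mz := rot_lt a z; have mw := rot_lt a w.
have yx := xy; have wz := zw; rewrite adj_sym in yx; rewrite adj_sym in wz.
case: (eqVneq z a) => [//|nz]; case: (eqVneq y a) => [//|ny].
case: (eqVneq w a) => [//|nw].
(* If [x] is [a], it stays first and only the other three are reversed; otherwise all four are, and
   the crossing is read from [w] on. *)
case: eqVneq => [ex|nx] h1 h2 h3.
  apply: (@noncross_rot a x y w z) => //; first by rewrite e colC.
  - rewrite ex rot0; have := @rot_inj a w a; rewrite rot0.
    by case: (rot a w) => // H; rewrite H ?eqxx in nw.
  - lia.
  - lia.
apply: (@noncross_rot a w z y x) => //; first by rewrite (colC w) (colC y).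
all: lia.
Qed.

Variables (tr1 tr2 tr3 tr4 tr5 : tree).
(** The keys 2 and 4 are A and B, 6 and 7 are t in copies 0 and 1, and 8 and 9 are u in copies 0 and
    1. *)
Hypothesis trees_ok : [/\ refutes nb tr1 [:: 2; 9; 8; 6; 7; 4]%positive,
  refutes nb tr2 [:: 2; 8; 9; 6; 7; 4]%positive,
  refutes nb tr3 [:: 2; 8; 6; 9; 7; 4]%positive &
  refutes nb tr4 [:: 2; 6; 7; 4; 9; 8]%positive /\
  refutes nb tr5 [:: 2; 6; 7; 4; 8; 9]%positive].
Hypothesis nb34 : forall v y, In v [:: 3; 4]%positive -> In y [:: 1; 2]%positive -> In y (nb v).

Section Model.
Variables (pos : gluing -> nat) (e : bool -> positive -> gluing).
Notation vx := (vertexb nb).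
(* [e c v] is vertex v in copy c of two copies of the same type. *)
Definition model := [/\ injective pos, noncross pos, pos (e false xH) = 0,
  (forall c v w, vx v -> vx w -> padj v w -> adj (e c v) (e c w)) &
  [/\ (forall c d v w, vx v -> vx w -> e c v = e d w -> v = w /\ (c = d \/ pole v)),
      (forall v, pole v -> e true v = e false v),
      (forall v w, vx v -> vx w ->
        (pos (e false v) < pos (e false w)) = (pos (e true v) < pos (e true w))) &
      (forall v w, vx v -> vx w -> padj v w ->
        col (e true v) (e true w) = col (e false v) (e false w))]].
Hypothesis M : model.
Let A := pos (e false 1%positive). Let B := pos (e false 2%positive).
Let t c := pos (e c 3%positive). Let u c := pos (e c 4%positive).

Lemma padj_nb v y : In y (nb v) -> padj v y.
Proof. by move=> /mempP h; rewrite /padj h. Qed.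
Lemma vx34 v : In v [:: 3; 4]%positive -> vx v.
Proof.
move=> h; have := @nb34 v 1%positive h (or_introl erefl).
by rewrite /vertexb; case: (nb v) => // *; rewrite orbT.
Qed.

(** As the types agree, copy 1 of u also precedes copy 1 of t, or also follows B. This leaves it
    three places relative to the other vertices in the first case and two in the second. *)
Lemma model_false : t false < t true -> t true < B ->
  u false < t false \/ B < u false -> False.
Proof.
case: M => pinj nc pA eadj [einj epole esame ecol] t01 t1B hu.
have v1 : vx 1 by []. have v2 : vx 2 by [].
have v3 : vx 3 by apply: vx34; left.
have v4 : vx 4 by apply: vx34; right; left.
have eA : pos (e true 1%positive) = 0 by rewrite epole.
have eB : pos (e true 2%positive) = B by rewrite epole.
pose cA := col (e false 3%positive) (e false 1%positive).
pose cB := col (e false 3%positive) (e false 2%positive).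
have n31 : In 1%positive (nb 3%positive) by apply: nb34; left.
have n32 : In 2%positive (nb 3%positive) by apply: nb34; [left|right; left].
have cAB : cA != cB.
  apply/eqP => ce; apply: (nc (e true 1%positive) (e true 3%positive)
    (e false 3%positive) (e false 2%positive)).
  - by apply: eadj => //; rewrite padjC; exact: padj_nb.
  - by apply: eadj => //; exact: padj_nb.
  - by rewrite colC ecol ?padj_nb.
  - rewrite eA; have := pinj (e false 3%positive) (e false 1%positive).
    rewrite pA -/(t false); case: (t false) => // H.
    by have [] := einj _ _ _ _ v3 v1 (H erefl).
  - exact: t01.
  - exact: t1B.
pose sg (i : 'I_3) := if i == cA then P1 else if i == cB then P2 else P3.
have sg_inj : injective sg.
  exact: page_inj.
(* [xH] is no key, so its value 0 is a filler. *)
pose ps (k : positive) :=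
  match k with xO v => pos (e false v) | xI v => pos (e true v) | xH => 0 end.
have psE c v : ps (kc c v) = pos (e c v).
  by case: c => //=; rewrite /key1; case E: (pole v) => //=; rewrite epole.
pose pg v w := sg (col (e false v) (e false w)).
have ps_inj k k' : validk nb k -> validk nb k' -> ps k = ps k' -> k = k'.
  move=> [v vv [c ->]] [w vw [d ->]]; rewrite !psE => /pinj /(einj _ _ _ _ vv vw)[<-].
  by case=> [->//|p]; case: c d => [] []; rewrite /= /key1 ?p.
have ps_min k : validk nb k -> k <> key0 1 -> ps (key0 1) < ps k.
  move=> vk ne; rewrite -[key0 _]/(kc false 1) psE pA lt0n; apply/eqP => e0.
  apply: ne; apply: ps_inj => //; first exact: validk0.
  by rewrite e0 -[key0 _]/(kc false 1) psE.
have ps_same v w : vx v -> vx w -> ps (key0 v) < ps (key0 w) -> ps (key1 v) < ps (key1 w).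
  by move=> vv vw; rewrite -![key1 _]/(kc true _) !psE -esame.
have ps_cross p a b c d : arc nb pg p a b -> arc nb pg p c d ->
    ps a < ps c -> ps c < ps b -> ps b < ps d -> False.
  have H k k' : arc nb pg p k k' ->
    exists x y, [/\ adj x y, ps k = pos x, ps k' = pos y & sg (col x y) = p].
    move=> [v [y [c0 [hy <- h]]]]; have ay := padj_nb hy.
    have vv : vx v by rewrite /vertexb; case: (nb v) hy => // *; rewrite orbT.
    have vy := nb_vertex hy.
    have ce : col (e c0 v) (e c0 y) = col (e false v) (e false y) by case: (c0) => //; exact: ecol.
    case: h => [[-> ->]|[-> ->]]; rewrite !psE.
      by exists (e c0 v), (e c0 y); split; rewrite /pg ?ce //; exact: eadj.
    exists (e c0 y), (e c0 v); split; rewrite /pg ?(colC (e c0 y)) ?ce //.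
    by apply: eadj => //; rewrite padjC.
  move=> /H[x [y [xy -> -> c1]]] /H[z [w [zw -> -> c2]]].
  by apply: nc => //; apply: sg_inj; rewrite c1.
have pg1 : pg 3%positive 1%positive = P1 by rewrite /pg /sg eqxx.
have pg2 : pg 3%positive 2%positive = P2 by rewrite /pg /sg -/cB eq_sym (negbTE cAB) eqxx.
have fin tr k1 k2 k3 k4 k5 : refutes nb tr [:: key0 1; k1; k2; k3; k4; k5] ->
   pairwise (fun a b => ps a < ps b) [:: key0 1; k1; k2; k3; k4; k5] ->
   (forall k, In k [:: key0 1; k1; k2; k3; k4; k5] -> validk nb k) ->
   (forall v, In v [:: 1; 2; 3; 4]%positive -> In (key0 v) [:: key0 1; k1; k2; k3; k4; k5] /\
      In (key1 v) [:: key0 1; k1; k2; k3; k4; k5]) -> False.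
  by move=> h1 h2 h3 h4; apply: (refutes_sound nb_vertex ps_inj ps_min ps_same ps_cross nb_irr
    h1 h2 h3 h4 nb34 pg1 pg2).
have vk k : In k [:: 2; 4; 6; 7; 8; 9]%positive -> validk nb k.
  case=> [<-|[<-|[<-|[<-|[<-|[<-|//]]]]]]; first [exact: (@validk0 nb 1)|exact: (@validk0 nb 2)|
   exact: (@validk0 nb 3)|exact: (@validk1 nb 3)|exact: (@validk0 nb 4)|exact: (@validk1 nb 4)].
have keys ks : (forall k, In k [:: 2; 4; 6; 7; 8; 9]%positive -> In k ks) ->
    forall v, In v [:: 1; 2; 3; 4]%positive -> In (key0 v) ks /\ In (key1 v) ks.
  by move=> h v [<-|[<-|[<-|[<-|//]]]]; split; apply: h; rewrite /=; tauto.
have d k k' : In k [:: 2; 4; 6; 7; 8; 9]%positive -> In k' [:: 2; 4; 6; 7; 8; 9]%positive ->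
    k <> k' -> ps k != ps k'.
  by move=> h h' ne; apply/eqP => /(ps_inj _ _ (vk _ h) (vk _ h')).
have su : (u false < t false) = (u true < t true) by exact: esame.
have sB : (B < u false) = (B < u true) by rewrite -{2}eB; exact: esame.
have A0 : ps 2%positive = 0 by exact: pA.
have h6 : 0 < ps 6%positive by rewrite -A0; apply: ps_min; [apply: vk; rewrite /=; tauto|].
have h8 : 0 < ps 8%positive by rewrite -A0; apply: ps_min; [apply: vk; rewrite /=; tauto|].
have h9 : 0 < ps 9%positive by rewrite -A0; apply: ps_min; [apply: vk; rewrite /=; tauto|].
have d89 : ps 8%positive != ps 9%positive by apply: d => //=; tauto.
have d69 : ps 6%positive != ps 9%positive by apply: d => //=; tauto.
have e6 : ps 6%positive = t false by []. have e7 : ps 7%positive = t true by [].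
have e8 : ps 8%positive = u false by []. have e9 : ps 9%positive = u true by [].
have e4 : ps 4%positive = B by [].
case: trees_ok => r1 r2 r3 [r4 r5].
have go tr k1 k2 k3 k4 k5 : refutes nb tr [:: key0 1; k1; k2; k3; k4; k5] ->
   pairwise (fun a b => ps a < ps b) [:: key0 1; k1; k2; k3; k4; k5] ->
   (forall k, In k [:: 2; 4; 6; 7; 8; 9]%positive <-> In k [:: key0 1; k1; k2; k3; k4; k5])
     -> False.
  move=> h1 h2 h3; apply: (fin _ _ _ _ _ _ h1 h2); first by move=> k /h3; exact: vk.
  by apply: keys => k /h3.
case: hu => [ut|Bu].
  have u1 : u true < t true by rewrite -su.
  case: (ltnP (ps 9%positive) (ps 8%positive)) => h98.
    apply: (go _ _ _ _ _ _ r1); last by move=> k /=; tauto.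
    by move: h6 h8 h9 d89 d69 t01 t1B ut u1 h98; rewrite /ps /t /u /B /= !pA; clear; lia.
  case: (ltnP (ps 9%positive) (ps 6%positive)) => h96.
    apply: (go _ _ _ _ _ _ r2); last by move=> k /=; tauto.
    by move: h6 h8 h9 d89 d69 t01 t1B ut u1 h98 h96; rewrite /ps /t /u /B /= !pA; clear; lia.
  apply: (go _ _ _ _ _ _ r3); last by move=> k /=; tauto.
  by move: h6 h8 h9 d89 d69 t01 t1B ut u1 h98 h96; rewrite /ps /t /u /B /= !pA; clear; lia.
have u1 : B < u true by rewrite -sB.
case: (ltnP (ps 9%positive) (ps 8%positive)) => h98.
  apply: (go _ _ _ _ _ _ r4); last by move=> k /=; tauto.
  by move: h6 h8 h9 d89 d69 t01 t1B Bu u1 h98; rewrite /ps /t /u /B /= !pA; clear; lia.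
apply: (go _ _ _ _ _ _ r5); last by move=> k /=; tauto.
by move: h6 h8 h9 d89 d69 t01 t1B Bu u1 h98; rewrite /ps /t /u /B /= !pA; clear; lia.
Qed.
End Model.

Lemma model_swap pos e : model pos e -> model pos (fun c => e (~~ c)).
Proof.
move=> [h1 h2 h3 h4 [h5 h6 h7 h8]]; split=> //.
- by rewrite /= h6.
- by move=> c v w; exact: h4.
split.
- by move=> c d v w vv vw /(h5 _ _ _ _ vv vw)[-> [/negb_inj|]]; auto.
- by move=> v /h6.
- by move=> v w vv vw; rewrite /= h7.
- by move=> v w vv vw vw'; rewrite /= h8.
Qed.

Variable mu : positive -> positive.
Hypothesis mu_vertex : forall v, vertexb nb v -> vertexb nb (mu v).
Hypothesis mu_pole : forall v, pole v -> mu v = v.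
Hypothesis mu_npole : forall v, pole (mu v) = pole v.
Hypothesis mu_inj : forall v w, vertexb nb v -> vertexb nb w -> mu v = mu w -> v = w.
Hypothesis mu_adj : forall v w, vertexb nb v -> vertexb nb w -> padj v w -> padj (mu v) (mu w).
Hypothesis mu34 : mu 3 = 4%positive /\ mu 4 = 3%positive.

Lemma model_mu pos e : model pos e -> model pos (fun c v => e c (mu v)).
Proof.
move=> [h1 h2 h3 h4 [h5 h6 h7 h8]]; split=> //.
- by rewrite mu_pole.
- by move=> c v w vv vw /mu_adj h; apply: h4; auto.
split.
- move=> c d v w vv vw /(h5 _ _ _ _ (mu_vertex vv) (mu_vertex vw))[e1 e2].
  by split; [exact: mu_inj|rewrite -mu_npole].
- by move=> v pv; apply: h6; rewrite mu_npole.
- by move=> v w vv vw; apply: h7; exact: mu_vertex.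
- by move=> v w vv vw /mu_adj h; apply: h8; auto.
Qed.

(** Exchanging the copies makes copy 0 of t the first one. If u then lies between t and B, the
    automorphism turns u into the new t, and the old t becomes a u that precedes it; the copies may
    have to be exchanged once more. *)
Lemma model_false_wlog pos e : model pos e ->
  pos (e false 3%positive) < pos (e false 2%positive) -> False.
Proof.
move=> M; have v1 : vertexb nb 1 by []. have v2 : vertexb nb 2 by [].
have v3 : vertexb nb 3 by apply: vx34; left.
have v4 : vertexb nb 4 by apply: vx34; right; left.
have [m3 m4] := mu34; have m2 : mu 2 = 2%positive by exact: mu_pole.
wlog t01 : e M / pos (e false 3%positive) < pos (e true 3%positive).
  move=> H tB; case: (ltngtP (pos (e false 3%positive)) (pos (e true 3%positive))) => h.
  - exact: (H e).
  - apply: (H _ (model_swap M)) => //=.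
    by case: M => _ _ _ _ [_ h6 h7 _]; rewrite -h7 // -h6.
  - case: M => pinj _ _ _ [h5 _ _ _].
    by have [_ []] := h5 _ _ _ _ v3 v3 (pinj _ _ h).
case: (M) => pinj _ _ _ [h5 h6 h7 h8] tB.
have tB1 : pos (e true 3%positive) < pos (e false 2%positive) by rewrite -h6 // -h7.
case: (ltngtP (pos (e false 4%positive)) (pos (e false 3%positive))) => h.
- by apply: (model_false M) => //; left.
- case: (ltngtP (pos (e false 4%positive)) (pos (e false 2%positive))) => h'.
  + have uB1 : pos (e true 4%positive) < pos (e false 2%positive) by rewrite -h6 // -h7.
    have hh : pos (e true 3%positive) < pos (e true 4%positive) by rewrite -h7.
    have M' := model_mu M.
    case: (ltngtP (pos (e false 4%positive)) (pos (e true 4%positive))) => h''.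
    * by apply: (model_false M'); rewrite ?m3 ?m4 ?m2 //; left.
    * have eB : e true 2%positive = e false 2%positive by exact: h6.
      by apply: (model_false (model_swap M')); rewrite /= ?m3 ?m4 ?m2 ?eB //; left.
    * by have [_ []] := h5 _ _ _ _ v4 v4 (pinj _ _ h'').
  + by apply: (model_false M) => //; right.
  + by have [] := h5 _ _ _ _ v4 v2 (pinj _ _ h').
- by have [] := h5 _ _ _ _ v4 v3 (pinj _ _ h).
Qed.

Notation verts := [:: 1, 2 & inner]%positive.
Definition ctype := {ffun 'I_(size inner).+2 * 'I_(size inner).+2 -> bool * 'I_3}.
Definition typ (pos : gluing -> nat) (j : 'I_N) : ctype :=
  [ffun p : 'I_(size inner).+2 * 'I_(size inner).+2 =>
             let v := emb j (nth xH verts p.1) in let w := emb j (nth xH verts p.2) in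
             (pos v < pos w, col v w)].
Lemma vertsP v : vertexb nb v -> exists i : 'I_(size inner).+2, v = nth xH verts i.
Proof.
move=> vv; have : memp v verts.
  apply/mempP; rewrite /=; case E: (pole v).
    by case: (poleP E) => ->; [left|right; left].
  by right; right; exact: inner_vertex.
move=> h; have := h; rewrite /memp has_find => hlt.
by exists (Ordinal hlt); apply/peqP; exact: (nth_find xH h).
Qed.

(** By the pigeonhole principle two copies have the same type. When t lies beyond B, the spine is
    reflected with A still first. *)
Lemma no_book : #|{: ctype}| < N -> False.
Proof.
move=> hN; pose a : gluing := inl ord0.
have : ~~ injectiveb (typ (rot a)).
  apply/negP => /injectiveP /leq_card; rewrite card_ord leqNgt hN //.
case/injectivePn => j [k jk /ffunP tjk].
have tl v w : vertexb nb v -> vertexb nb w ->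
   (rot a (emb j v) < rot a (emb j w)) = (rot a (emb k v) < rot a (emb k w)) /\
   col (emb j v) (emb j w) = col (emb k v) (emb k w).
  move=> /vertsP[i1 ->] /vertsP[i2 ->].
  by have := tjk (i1, i2); rewrite !ffunE /= => -[-> ->].
have mk pos : injective pos -> noncross pos -> pos a = 0 ->
   (forall v w, vertexb nb v -> vertexb nb w ->
     (pos (emb j v) < pos (emb j w)) = (pos (emb k v) < pos (emb k w))) ->
   model pos (fun c => emb (if c then k else j)).
  move=> p1 p2 p3 p4; split=> //; first by move=> c v w; exact: emb_adj.
  split=> //.
  - move=> c d v w vv vw /(emb_inj vv vw)[-> [e|]]; auto.
    split=> //; left; case: c d e => [] [] // e; by rewrite e eqxx in jk.
  - by move=> v /poleP[] ->.
  - by move=> v w vv vw _; have [] := tl v w vv vw.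
have ra : rot a a = 0 by exact: rot0.
have v1 : vertexb nb 1 by []. have v2 : vertexb nb 2 by [].
have v3 : vertexb nb 3 by apply: vx34; left.
have tl' v w (vv : vertexb nb v) (vw : vertexb nb w) := proj1 (tl v w vv vw).
have M := mk _ (@rot_inj a) (@noncross_rot a) ra tl'.
case: (ltngtP (rot a (emb j 3)) (rot a (emb j 2))) => h.
- exact: (model_false_wlog M).
(* In the reflected order [a] is still least and all other comparisons are reversed, in both copies
   alike, so the two copies keep a common type. *)
- have rl x y : (refl a x < refl a y) = (y != a) && ((x == a) || (rot a y < rot a x)).
    have hx := rot_lt a x; have hy := rot_lt a y; rewrite /refl.
    move: hx hy; move: (rot a x) (rot a y) #|_| => p q n; clear => hp hq.
    by case: (x == a); case: (y == a) => /=; lia.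
  have ea i v : vertexb nb v -> (emb i v == a) = peq v 1.
    move=> vv; apply/eqP/peqP => [|-> //]; rewrite -[a]/(emb i 1).
    by move/(emb_inj vv v1) => [].
  apply: (@model_false_wlog (refl a) (fun c => emb (if c then k else j))).
    apply: mk; [exact: refl_inj|exact: noncross_refl|by rewrite /refl eqxx|].
    by move=> v w vv vw; rewrite !rl !ea // tl'.
  by rewrite rl !ea //=.
- by have [] := emb_inj v3 v2 (rot_inj h).
Qed.
End Book.
End Graph.

End Reduction.
Import Reduction.

(** * Separating lines and barycentric subdivision *)

Module Barycentric.
Local Open Scope ring_scope.

Section Sep.
Variable R : realFieldType.
Implicit Types (g : R * R * R) (p q : R * R).
Definition aff g p := g.1.1 * p.1 + g.1.2 * p.2 + g.2.
(* Weak separation by a line that does not contain all the points. If the points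
   of U and of V are affinely independent, the relative interiors of their
   convex hulls are then disjoint. *)
Definition sep (U V : seq (R * R)) := exists g, [/\ forall p, In p U -> aff g p <= 0,
  forall p, In p V -> 0 <= aff g p & exists2 p, In p U \/ In p V & aff g p != 0].
(* Affine independence, in the form in which it produces separating lines. *)
Definition nondeg p q r := forall a b c : R, exists g, [/\ aff g p = a, aff g q = b & aff g r = c].
Definition bary p q r : R * R := ((p.1 + q.1 + r.1) / 3, (p.2 + q.2 + r.2) / 3).

Lemma affN g p : aff (- g.1.1, - g.1.2, - g.2) p = - aff g p.
Proof. rewrite /aff /=; ring. Qed.
Lemma sepC U V : sep U V -> sep V U.
Proof.
move=> [g [h1 h2 [p hp ne]]]; exists (- g.1.1, - g.1.2, - g.2); split.
- by move=> q /h2; rewrite affN oppr_le0.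
- by move=> q /h1; rewrite affN oppr_ge0.
- by exists p; [case: hp; auto|rewrite affN oppr_eq0].
Qed.
Lemma aff_bary g p q r : aff g (bary p q r) = (aff g p + aff g q + aff g r) / 3.
Proof. by rewrite /aff /=; field. Qed.

(** The value at the barycentre is the mean of the values at the corners, so the line stays valid
    for any piece of the triangle. If it is nonzero at some corner, it is positive at the
    barycentre, which is why the piece [O] must contain that point. *)
Lemma sep_sub U x y z O : sep U [:: x; y; z] -> In (bary x y z) O ->
  (forall p, In p O -> In p [:: bary x y z; x; y; z]) -> sep U O.
Proof.
move=> [g [h1 h2 [p hp ne]]] hv hO.
have hx : 0 <= aff g x by apply: h2; left.
have hy : 0 <= aff g y by apply: h2; right; left.
have hz : 0 <= aff g z by apply: h2; right; right; left.
exists g; split=> //.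
  by move=> q /hO[<-|[<-|[<-|[<-|//]]]] //; rewrite aff_bary; lra.
case: hp => [hp|hp]; first by exists p; [left|].
exists (bary x y z); first by right.
rewrite aff_bary; apply: lt0r_neq0.
have : 0 < aff g p by rewrite lt0r ne h2.
case: hp => [e|[e|[e|//]]]; rewrite -e => ?; lra.
Qed.

(** The value [3 * c - a - b] at [r] is the one that gives [c] at the barycentre. *)
Lemma nondeg_bary p q r : nondeg p q r -> nondeg p q (bary p q r).
Proof.
move=> h a b c; have [g [h1 h2 h3]] := h a b (3 * c - a - b).
by exists g; split=> //; rewrite aff_bary h1 h2 h3; field.
Qed.
Lemma nondegC p q r : nondeg p q r -> nondeg q r p.
Proof. by move=> h a b c; have [g [h1 h2 h3]] := h c a b; exists g. Qed.
Lemma nondegX p q r : nondeg p q r -> nondeg q p r.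
Proof. by move=> h a b c; have [g [h1 h2 h3]] := h b a c; exists g. Qed.
Lemma bary_rot p q r : bary q r p = bary p q r.
Proof. by rewrite /bary; congr pair; ring. Qed.
Lemma bary_swap p q r : bary p r q = bary p q r.
Proof. by rewrite /bary; congr pair; ring. Qed.

(** What replaces a triangle once [v] is placed inside it. The order within each list matters, since
    faces are looked up as lists: the newest corner comes last, as in [table], whereas an edge
    starts with its newer end. *)
Definition pieces (T : Type) (v x y z : T) :=
  [:: [:: v]; [:: v; x]; [:: v; y]; [:: v; z]; [:: x; y; v]; [:: y; z; v]; [:: x; z; v]].

Fixpoint pairw T (r : T -> T -> Prop) (s : seq T) : Prop :=
  if s is x :: s' then (forall y, In y s' -> r x y) /\ pairw r s' else True.

(** The numbers are the values of the separating function at [x], [y] and [z], and [w] is a point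
    where it is nonzero. *)
Ltac piece a b c w :=
  match goal with go : forall a b c U V p, _ |- _ => apply: (go a b c _ _ w) end;
  [by rewrite /=; auto 12|
   let g := fresh in let e1 := fresh in let e2 := fresh in let e3 := fresh in
   let e4 := fresh in move=> g e1 e2 e3 e4; split;
   [move=> ? /=; repeat (case=> [<-|]); rewrite ?e1 ?e2 ?e3 ?e4 //; lra
   |move=> ? /=; repeat (case=> [<-|]); rewrite ?e1 ?e2 ?e3 ?e4 //; lra
   |rewrite ?e1 ?e2 ?e3 ?e4; apply/eqP; lra]].

(** All the separating lines are medians: the values 1, 0 and -1 at the corners sum to 0, so the
    line passes through one corner and the barycentre. *)
Lemma pieces_sep x y z : nondeg x y z -> pairw sep (pieces (bary x y z) x y z).
Proof.
move=> nd; set v := bary x y z.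
have go (a b c : R) U V p : In p U \/ In p V ->
    (forall g, aff g x = a -> aff g y = b -> aff g z = c -> aff g v = (a + b + c) / 3 ->
     [/\ forall p, In p U -> aff g p <= 0, forall p, In p V -> 0 <= aff g p & aff g p != 0])
       -> sep U V.
  move=> hp h; have [g [h1 h2 h3]] := nd a b c; have h4 : aff g v = (a + b + c) / 3.
    by rewrite aff_bary h1 h2 h3.
  have [u1 u2 u3] := h g h1 h2 h3 h4; exists g; split=> //; by exists p.
split=> [ o|].
  case=> [<-|[<-|[<-|[<-|[<-|[<-|//]]]]]].
  by piece (1 : R) (0 : R) (-1 : R) x.
  by piece (0 : R) (1 : R) (-1 : R) y.
  by piece (0 : R) (-1 : R) (1 : R) z.
  by piece (0 : R) (1 : R) (-1 : R) y.
  by piece (-1 : R) (0 : R) (1 : R) z.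
  by piece (0 : R) (-1 : R) (1 : R) z.
split=> [ o|].
  case=> [<-|[<-|[<-|[<-|[<-|//]]]]].
  by piece (0 : R) (1 : R) (-1 : R) y.
  by piece (0 : R) (-1 : R) (1 : R) z.
  by piece (0 : R) (1 : R) (-1 : R) y.
  by piece (-1 : R) (0 : R) (1 : R) x.
  by piece (0 : R) (-1 : R) (1 : R) z.
split=> [ o|].
  case=> [<-|[<-|[<-|[<-|//]]]].
  by piece (0 : R) (-1 : R) (1 : R) y.
  by piece (1 : R) (0 : R) (-1 : R) x.
  by piece (-1 : R) (0 : R) (1 : R) z.
  by piece (0 : R) (-1 : R) (1 : R) y.
split=> [ o|].
  case=> [<-|[<-|[<-|//]]].
  by piece (0 : R) (1 : R) (-1 : R) z.
  by piece (-1 : R) (1 : R) (0 : R) y.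
  by piece (1 : R) (-1 : R) (0 : R) x.
split=> [ o|].
  case=> [<-|[<-|//]].
  by piece (-1 : R) (0 : R) (1 : R) x.
  by piece (0 : R) (-1 : R) (1 : R) y.
split=> [ o|].
  case=> [<-|//].
  by piece (1 : R) (-1 : R) (0 : R) y.
by [].
Qed.

Lemma pairw_map T U (r : T -> T -> Prop) (f : U -> T) s :
  pairw r (map f s) -> pairw (fun a b => r (f a) (f b)) s.
Proof.
elim: s => //= a s IH [h /IH h']; split=> // y hy; apply: h.
by elim: s hy {IH h'} => //= b s IH [->|/IH]; auto.
Qed.

Lemma pairw_cat T (r : T -> T -> Prop) s1 s2 : pairw r s1 -> pairw r s2 ->
  (forall a b, In a s1 -> In b s2 -> r a b) -> pairw r (s1 ++ s2).
Proof.
elim: s1 => //= a s IH [h1 h2] h3 h; split; last first.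
  by apply: IH => // b c hb hc; apply: h => //; right.
by move=> y /In_cat[/h1 //|hy]; apply: h => //; left.
Qed.

(** Cramer's rule; the hypothesis says that the signed area of the triangle is nonzero. *)
Lemma orient_nondeg p q r :
  (q.1 - p.1) * (r.2 - p.2) - (q.2 - p.2) * (r.1 - p.1) != 0 -> nondeg p q r.
Proof.
case: p q r => px py [qx qy] [rx ry] /= ne a b c.
pose D := (qx - px) * (ry - py) - (qy - py) * (rx - px).
pose gx := ((b - a) * (ry - py) - (c - a) * (qy - py)) / D.
pose gy := ((c - a) * (qx - px) - (b - a) * (rx - px)) / D.
exists (gx, gy, a - gx * px - gy * py); rewrite /aff /gx /gy /D /=; split; by field.
Qed.

Fixpoint pel (s t : seq positive) := match s, t with
  | x :: s', y :: t' => if peq x y then pel s' t' else false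
  | [::], [::] => true | _, _ => false end.
Lemma pelP s t : reflect (s = t) (pel s t).
Proof.
apply: (iffP idP) => [|<-]; last by elim: s => //= x s ->; case: peqP.
by elim: s t => [|x s IH] [|y t] //=; case: peqP => // -> /IH ->.
Qed.
Fixpoint remo (T : seq positive) (s : seq (seq positive)) :=
  if s is o :: s' then if pel T o then Some s' else omap (cons o) (remo T s') else None.
Definition subdivide (e : positive * seq positive) objs := match e.2 with
  | [:: x; y; z] => omap (cat (pieces e.1 x y z)) (remo [:: x; y; z] objs)
  | _ => None end.

Section Objects.
Variable pt : positive -> R * R.
Definition osep o1 o2 := sep (map pt o1) (map pt o2).
Definition drawn objs := pairw osep objs /\
  forall x y z, In [:: x; y; z] objs -> nondeg (pt x) (pt y) (pt z).

Lemma remo_ok T s s' : remo T s = Some s' -> pairw osep s ->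
  [/\ In T s, (forall o, In o s' -> In o s /\ osep T o) & pairw osep s'].
Proof.
elim: s s' => //= o s IH s'; case: pelP => [eo|_].
  case=> <- [h1 h2]; split=> //; first by left.
  by move=> p hp; split; [right|rewrite eo; exact: h1].
case E: (remo T s) => [r|] //= [<-] [h1 h2]; have [h3 h4 h5] := IH _ E h2.
split; first by right.
  by move=> p [<-|/h4[]]; [split; [left|apply: sepC; exact: h1]|split; [right|]].
by split=> // p /h4[/h1].
Qed.

(** The pieces are separated from one another by [pieces_sep], and from every other object because
    the triangle that they come from was. *)
Lemma subdivide_ok v x y z objs objs' : drawn objs -> pt v = bary (pt x) (pt y) (pt z) ->
  subdivide (v, [:: x; y; z]) objs = Some objs' -> drawn objs'.
Proof.
move=> [pw nd] ev; rewrite /subdivide /=; case E: (remo _ objs) => [r|] //= [<-].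
have [h1 h2 h3] := remo_ok E pw.
have nd0 := nd _ _ _ h1.
have ps := pieces_sep nd0; rewrite -ev in ps.
split.
  apply: (@pairw_cat _ osep (pieces v x y z)) => //.
    exact: (@pairw_map _ _ _ (map pt) (pieces v x y z)).
  move=> o1 o2 ho1 /h2[_ /sepC hs]; apply: sepC; apply: (sep_sub hs); rewrite -ev.
    by move: ho1; rewrite /pieces /=; repeat (case=> [<-|]) => //=; auto 6.
  by move: ho1; rewrite /pieces /=; do 7!(case=> [<- p|]; first by rewrite /=; tauto).
move=> a b c /(@In_cat _ _ (pieces v x y z))[|/h2[/nd //]].
rewrite /pieces /=; do 4!(case=> [//|]).
case=> [[<- <- <-]|]; first by rewrite ev; exact: nondeg_bary.
case=> [[<- <- <-]|].
  by rewrite ev -bary_rot; apply: nondeg_bary; exact: nondegC.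
case=> [[<- <- <-]|//].
by rewrite ev -bary_swap; apply: nondeg_bary; apply: nondegX; apply: nondegC; apply: nondegC.
Qed.
End Objects.

Fixpoint subdivides (es : seq (positive * seq positive)) objs :=
  if es is e :: es' then obind (subdivides es') (subdivide e objs) else Some objs.

Fixpoint placeable (known : seq positive) (es : seq (positive * seq positive)) :=
  if es is e :: es' then
    [&& ~~ memp e.1 known, all (fun y => memp y known) e.2 & placeable (e.1 :: known) es']
  else true.

(** The positions are only proved to exist. What follows uses the barycentre equations and the known
    positions alone, so that no rational coordinates are ever computed. *)
Lemma place known (pt0 : positive -> R * R) es : placeable known es ->
  exists2 pt, (forall v, In v known -> pt v = pt0 v) &
    forall v x y z, In (v, [:: x; y; z]) es -> pt v = bary (pt x) (pt y) (pt z).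
Proof.
elim: es known pt0 => [|[v ys] es IH] known pt0 /=; first by exists pt0.
case/and3P => nv /allIn hys /IH H.
pose b := if ys is [:: x; y; z] then bary (pt0 x) (pt0 y) (pt0 z) else 0.
have [pt h1 h2] := H (fun w => if peq w v then b else pt0 w).
have h3 w : In w known -> pt w = pt0 w.
  move=> hw; rewrite h1; last by right.
  by case: peqP => // e; rewrite e in hw; move/mempP: hw; rewrite (negbTE nv).
exists pt => // w x y z [[<- e]|]; last exact: h2.
rewrite h1 /=; last by left.
rewrite /b -?e; case: peqP => // _; rewrite e /=.
by rewrite !h3 //; apply/mempP; apply: hys; rewrite e /=; auto.
Qed.

Lemma subdivides_ok pt es objs objs' : drawn pt objs ->
  (forall v x y z, In (v, [:: x; y; z]) es -> pt v = bary (pt x) (pt y) (pt z)) ->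
  subdivides es objs = Some objs' -> drawn pt objs'.
Proof.
elim: es objs => [|[v ys] es IH] objs d h /=; first by case=> <-.
case E: subdivide => [ o|] //= h'; apply: IH h'; last by move=> *; apply: h; right.
case: ys h E => [|x [|y [|z []]]] // h E.
by apply: subdivide_ok d _ E; apply: h; left.
Qed.

Section Grid.
Variable co : positive -> Z * Z.
(** Grid coordinates live in [Z], where the checks can be computed, and are carried over to the
    field by this ring morphism. *)
Definition zr (z : Z) : R := (int_of_Z z)%:~R.
Lemma zrD a b : zr (Z.add a b) = zr a + zr b.
Proof. by rewrite /zr -[Z.add a b]/(a + b)%R !rmorphD. Qed.
Lemma zrM a b : zr (Z.mul a b) = zr a * zr b.
Proof. by rewrite /zr -[Z.mul a b]/(a * b)%R !rmorphM. Qed.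
Lemma zrN a : zr (Z.opp a) = - zr a.
Proof. by rewrite /zr -[Z.opp a]/(- a)%R !rmorphN. Qed.
Lemma zr_ge0 a : Z.leb Z0 a -> 0 <= zr a.
Proof. by rewrite /zr ler0z; case: a. Qed.
Lemma zr_eq0 a : zr a = 0 -> a = Z0.
Proof. by rewrite /zr => /eqP; rewrite intr_eq0 => /eqP; case: a => //= p; lia. Qed.
Lemma zr_le a b : Z.leb a b -> zr a <= zr b.
Proof.
move=> ab; rewrite -subr_ge0 -zrN -zrD; apply: zr_ge0.
by apply/Z.leb_spec0; have /Z.leb_spec0 := ab; lia.
Qed.
Lemma zr_lt a b : Z.ltb a b -> zr a < zr b.
Proof.
move=> ab; have /Z.ltb_spec0 h := ab; rewrite lt_neqAle zr_le ?andbT;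
  last by apply/Z.leb_spec0; lia.
by rewrite -subr_eq0 -zrN -zrD; apply/eqP => /zr_eq0 e; lia.
Qed.
Definition gpt v : R * R := (zr (co v).1, zr (co v).2).

Definition affz (g : Z * Z * Z) (p : Z * Z) :=
  Z.add (Z.add (Z.mul g.1.1 p.1) (Z.mul g.1.2 p.2)) g.2.
Definition negz (g : Z * Z * Z) := (Z.opp g.1.1, Z.opp g.1.2, Z.opp g.2).
Definition sepz (g : Z * Z * Z) (U V : seq positive) :=
  [&& all (fun v => Z.leb (affz g (co v)) Z0) U, all (fun v => Z.leb Z0 (affz g (co v))) V
    & has (fun v => negb (Z.eqb (affz g (co v)) Z0)) (U ++ V)].
Definition axes (c : seq positive) :=
  [seq (Z0, Z.one, Z.opp (co v).2) | v <- c] ++ [seq (Z.one, Z0, Z.opp (co v).1) | v <- c].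
Definition line (p q : Z * Z) : Z * Z * Z :=
  let a := Z.sub p.2 q.2 in let b := Z.sub q.1 p.1 in
  (a, b, Z.opp (Z.add (Z.mul a p.1) (Z.mul b p.2))).
(* Tries the lines through a vertex parallel to an axis and the lines through two
   vertices. *)
Definition has_sep U V :=
  let c := U ++ V in
  let ok (g : Z * Z * Z) := sepz g U V || sepz (negz g) U V in
  has ok (axes c) || has (fun v => has (fun w => ok (line (co v) (co w))) c) c.

Lemma sepz_sep (g : Z * Z * Z) U V : sepz g U V -> sep (map gpt U) (map gpt V).
Proof.
have E v : aff (zr g.1.1, zr g.1.2, zr g.2) (gpt v) = zr (affz g (co v)).
  by rewrite /aff /affz !zrD !zrM.
have mp (W : seq positive) p : In p (map gpt W) -> exists2 v, In v W & p = gpt v.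
  by elim: W => //= v W IH [<-|/IH[w]]; [exists v; [left|]|exists w; [right|]].
case/and3P => /allIn h1 /allIn h2 h3; exists (zr g.1.1, zr g.1.2, zr g.2); split.
- move=> p /mp[v hv ->]; rewrite E -oppr_ge0 -zrN; apply: zr_ge0; have := h1 v hv; lia.
- by move=> p /mp[v hv ->]; rewrite E; apply: zr_ge0; exact: h2.
have mi (W : seq positive) v : In v W -> In (gpt v) (map gpt W).
  by elim: W => //= w W IH [->|/IH]; auto.
have hs (a : pred positive) s : has a s -> exists2 v, In v s & a v.
  elim: s => //= v s IH /orP[h|/IH[w h h']]; first by exists v; [left|].
  by exists w; [right|].
have [v hv nv] := hs _ _ h3.
exists (gpt v); first by case/In_cat: hv => /mi; auto.
by rewrite E; apply/eqP => /zr_eq0 e; rewrite e in nv.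
Qed.

Lemma has_sepP U V : has_sep U V -> sep (map gpt U) (map gpt V).
Proof.
have hs T (a : pred T) s : has a s -> exists v, a v.
  by elim: s => //= v s IH /orP[h|/IH //]; exists v.
by case/orP => /hs[v]; [|case/hs => w]; case/orP => /sepz_sep.
Qed.

Definition area (p q r : Z * Z) :=
  Z.sub (Z.mul (Z.sub q.1 p.1) (Z.sub r.2 p.2)) (Z.mul (Z.sub q.2 p.2) (Z.sub r.1 p.1)).
Definition grid_drawn (objs : seq (seq positive)) :=
  pairwise has_sep objs && all (fun o => if o is [:: x; y; z] then
    negb (Z.eqb (area (co x) (co y) (co z)) Z0) else true) objs.

Lemma grid_drawnP objs : grid_drawn objs -> drawn gpt objs.
Proof.
case/andP => pw /allIn nd; split.
  elim: objs pw {nd} => //= o s IH /andP[/allIn h /IH h']; split=> // p /h; exact: has_sepP.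
move=> x y z /nd /= h; apply: orient_nondeg.
have <- : zr (area (co x) (co y) (co z)) = ((gpt y).1 - (gpt x).1) * ((gpt z).2 - (gpt x).2)
    - ((gpt y).2 - (gpt x).2) * ((gpt z).1 - (gpt x).1).
  by rewrite /area /Z.sub !(zrD, zrM, zrN).
by apply/eqP => /zr_eq0 e; rewrite e in h.
Qed.
End Grid.
End Sep.

End Barycentric.
Import Barycentric.

(** * The drawing of all copies by straight segments *)

Module Arcs.
Local Open Scope ring_scope.

Section Segment.
Variable R : realType.
Implicit Types p q : R * R.
Definition seg p q (t : R) : R * R := (p.1 + t * (q.1 - p.1), p.2 + t * (q.2 - p.2)).

Lemma seg_arc p q : p <> q -> simple_arc (seg p q) p q.
Proof.
move=> pq; split.
- have ct (a b : R) : continuous (fun u : R => a + u * b).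
    by move=> u; apply: cvgD; [exact: cvg_cst|apply: cvgM; [exact: cvg_id|exact: cvg_cst]].
  by apply: continuous_subspaceT => t; exact: (cvg_pair (ct _ _ t) (ct _ _ t)).
- move=> s t _ _ [/addrI e1 /addrI e2]; apply: contrapT => st; apply: pq.
  have H (a b : R) : s * (b - a) = t * (b - a) -> a = b.
    move=> e; apply/eqP; rewrite -subr_eq0 -oppr_eq0 opprB; apply/negPn/negP => ne.
    by apply: st; apply: (mulIf ne).
  by case: p q e1 e2 => [a b] [c d] /= /H -> /H ->.
- by rewrite /seg !mul0r !addr0; case: p {pq}.
- by rewrite /seg; case: q {pq} => a b /=; congr pair; ring.
Qed.

Lemma aff_seg g p q t : aff g (seg p q t) = (1 - t) * aff g p + t * aff g q.
Proof. rewrite /aff /seg /=; ring. Qed.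

Lemma conv0 (a b t : R) : 0 < t < 1 -> 0 <= a -> 0 <= b -> (1 - t) * a + t * b <= 0 ->
  a = 0 /\ b = 0.
Proof.
move=> /andP[t0 t1] a0 b0 h; have t1' : 0 < 1 - t by lra.
have ha := mulr_ge0 (ltW t1') a0; have hb := mulr_ge0 (ltW t0) b0.
split; apply/eqP; rewrite eq_le ?a0 ?b0 andbT leNgt; apply/negP.
  by move/(mulr_gt0 t1'); lra.
by move/(mulr_gt0 t0); lra.
Qed.

Lemma sep_point p q : sep [:: p] [:: q] -> p <> q.
Proof.
move=> [g [h1 h2 [r hr /eqP ne]]] e; apply: ne; rewrite -e in h2 hr.
have r1 := h1 p (or_introl erefl); have r2 := h2 p (or_introl erefl).
have -> : r = p by case: hr => [[->|//]|[->|//]].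
lra.
Qed.

Lemma sep_seg p q r t : sep [:: r] [:: p; q] -> 0 < t < 1 -> seg p q t <> r.
Proof.
move=> [g [h1 h2 [s hs /eqP ne]]] t01 e; apply: ne.
have r1 := h1 r (or_introl erefl).
have := aff_seg g p q t; rewrite e => r4; rewrite r4 in r1.
have [rp rq] := conv0 t01 (h2 p (or_introl erefl)) (h2 q (or_intror (or_introl erefl))) r1.
rewrite rp rq !mulr0 addr0 in r4.
by move: hs; rewrite /= => -[[<-|//]|[<-|[<-|//]]].
Qed.

(** At a common point the affine function would be both nonpositive and nonnegative, hence 0, and
    then 0 at all four ends, against the nontriviality in [sep]. *)
Lemma sep_segs p q p' q' s t : sep [:: p; q] [:: p'; q'] ->
  0 < s < 1 -> 0 < t < 1 -> seg p q s <> seg p' q' t.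
Proof.
move=> [g [h1 h2 [r hr /eqP ne]]] s01 t01 e; apply: ne.
have p1 : 0 <= - aff g p by rewrite oppr_ge0; apply: h1; left.
have q1 : 0 <= - aff g q by rewrite oppr_ge0; apply: h1; right; left.
have p2 : 0 <= aff g p' by apply: h2; left.
have q2 : 0 <= aff g q' by apply: h2; right; left.
have := aff_seg g p q s; rewrite e aff_seg => r4.
have /andP[s0 s1] := s01; have /andP[t0 t1] := t01.
have s1' : 0 <= 1 - s by lra.
have t1' : 0 <= 1 - t by lra.
have ha := mulr_ge0 s1' p1; have hb := mulr_ge0 (ltW s0) q1.
have hc := mulr_ge0 t1' p2; have hd := mulr_ge0 (ltW t0) q2.
rewrite !mulrN in ha hb.
have [|rp' rq'] := conv0 t01 p2 q2; first by rewrite r4; lra.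
have [|/eqP rp /eqP rq] := conv0 s01 p1 q1.
  by move: r4; rewrite rp' rq' !mulr0 addr0 !mulrN => r4; lra.
rewrite !oppr_eq0 in rp rq.
by move: hr; rewrite /= => -[[<-|[<-|//]]|[<-|[<-|//]]] //; exact/eqP.
Qed.
End Segment.

Lemma In_nth x (s : seq positive) n : (n < size s)%N -> In (nth x s n) s.
Proof. by elim: s n => //= a s IH [|n] hn; [left|right; exact: IH]. Qed.
Lemma find_nth x (s : seq positive) n : pairwise (fun v w => ~~ peq v w) s ->
  (n < size s)%N -> find (peq (nth x s n)) s = n.
Proof.
elim: s n => //= a s IH [|n] /andP[/allIn ha hs] hn /=; first by case: peqP.
case: peqP => [e|_]; last by rewrite IH.
by have := ha _ (In_nth x (s := s) hn); rewrite e; case: peqP.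
Qed.

Section Drawing.
Variables (R : realType) (inner : seq positive) (nb : positive -> seq positive) (N : nat).
Hypothesis nb_irr : forall v, ~ In v (nb v).
Hypothesis nb_vertex : forall v y, In y (nb v) -> vertexb nb y.
Hypothesis inner_vertex : forall v, vertexb nb v -> pole v = false -> In v inner.
Hypothesis inner_ok : forall v, In v inner -> vertexb nb v /\ pole v = false.
Hypothesis nb_pole : forall v, pole v -> nb v = [::].
Hypothesis uniq_inner : pairwise (fun v w => ~~ peq v w) inner.
Hypothesis inner_gt0 : (0 < size inner)%N.
Hypothesis N0 : (0 < N)%N.
(** Data for one copy. The triangle on the two poles with apex [low] is among the separated objects,
    hence free to receive the later copies. *)
Variables (pt : positive -> R * R) (W h : R) (low : positive) (objs : seq (seq positive)).
Hypothesis dr : drawn pt objs.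
Hypothesis objs1 : forall v, vertexb nb v -> In [:: v] objs.
Hypothesis objs2 : forall v y, In y (nb v) -> In [:: v; y] objs.
Hypothesis objs3 : In [:: 1%positive; 2%positive; low] objs.
Hypothesis ptA : pt 1%positive = (- W, 0).
Hypothesis ptB : pt 2%positive = (W, 0).
Hypothesis ptL : pt low = (0, h).
Hypothesis W0 : 0 < W.
Hypothesis h0 : 0 < h.
Hypothesis strict : forall v, In v inner -> `|(pt v).1| < W /\ 0 < (pt v).2.
Let G := gluing inner N nb_irr.
Notation emb := (@emb inner nb N nb_irr).
Notation vx := (vertexb nb).

Lemma vertex_emb (x : G) : exists j v, vx v /\ x = emb j v.
Proof.
case: x => [i|[j k]].
  exists (Ordinal N0); case: i => [[|[|]]] // hi; [exists 1%positive|exists 2%positive];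
    by split=> //; congr inl; exact: val_inj.
pose v := nth xH inner k.
have lt : (k < size inner)%N by exact: leq_trans (ltn_ord k) (eq_leq (prednK inner_gt0)).
have hv : In v inner by exact: In_nth.
have [vv pv] := inner_ok hv.
exists j, v; split=> //; rewrite embE //; congr (inr (_, _)); apply: val_inj.
by rewrite /= inordK /v find_nth // prednK.
Qed.

(** Poles have empty lists, so every edge has an inner end, and this end determines the copy. *)
Lemma edge_emb e : e \in edges G -> exists j v y,
  [/\ vx v, pole v = false, In y (nb v) & e = [set emb j v; emb j y]%SET].
Proof.
rewrite inE => /existsP[x /existsP[y /andP[xy /eqP ->]]].
have [j [v [vv ex]]] := vertex_emb x; have [k [w [vw ey]]] := vertex_emb y.
have nbp a b : In b (nb a) -> vx a /\ pole a = false.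
  move=> ab; rewrite /vertexb; case E: (pole a); last by split=> //=; case: (nb a) ab.
  by move: ab; rewrite nb_pole.
move: xy; rewrite ex ey /= /gadj !(vnum_emb nb_irr inner_vertex) // => /andP[sc pa].
have [l e1 e2] : exists2 l, emb j v = emb l v & emb k w = emb l w.
  case Ev: (pole v); first by exists k => //; case: (poleP Ev) => ->.
  case Ew: (pole w); first by exists j => //; case: (poleP Ew) => ->.
  have /eqP -> : j == k by move: sc; rewrite !embE.
  by exists k.
rewrite e1 e2; case/orP: pa => /mempP hn; have [va pa] := nbp _ _ hn.
  by exists l, v, w.
by exists l, w, v; split=> //; rewrite finset.setUC.
Qed.

(** The inequality says that the point of [v], flattened by [s], lies below both upper sides of the
    triangle with base AB and apex at height [h]. As there are finitely many [v], one [s] serves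
    all. *)
Lemma small_scale : exists2 s : R, 0 < s < 1 & forall v, In v inner ->
  s * (pt v).2 * W < h * (W - `|(pt v).1|).
Proof.
elim: (inner) strict => [_|v vs IH st].
  by exists (1 / 2) => //; apply/andP; split; lra.
have [s /andP[s0 s1] hs] := IH (fun w hw => st w (or_intror hw)).
have [v1 v2] := st v (or_introl erefl).
pose c := h * (W - `|(pt v).1|); have c0 : 0 < c by apply: mulr_gt0 => //; lra.
pose d := (pt v).2 * W; have d0 : 0 < d by apply: mulr_gt0.
(* The half makes the inequality for [v] strict. *)
pose m := Num.min s (c / d / 2).
have cd : 0 < c / d by apply: divr_gt0.
have m0 : 0 < m by rewrite lt_min s0 /=; lra.
have ms : m <= s by rewrite ge_min lexx.
have md : m <= c / d / 2 by rewrite ge_min lexx orbT.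
exists m; first by rewrite m0 (le_lt_trans ms).
move=> w [<-|hw]; last first.
  apply: le_lt_trans (hs w hw); rewrite -!mulrA ler_wpM2r //.
  by have [_ w2] := st w (or_intror hw); apply: mulr_ge0; exact: ltW.
rewrite -mulrA -/d -/c; apply: le_lt_trans (_ : c / d / 2 * d < _).
  by rewrite ler_wpM2r // ltW.
by rewrite mulrAC divfK ?gt_eqF //; lra.
Qed.

Section Scale.
Variable s : R.
Hypothesis s01 : 0 < s < 1.
Hypothesis hs : forall v, In v inner -> s * (pt v).2 * W < h * (W - `|(pt v).1|).
Let s0 : 0 < s. Proof. by case/andP: s01. Qed.
(** For a pole, 0 is a filler: its height is 0 in every copy. *)
Definition copyno (x : G) : nat := if x is inr q then q.1 else 0.
Definition gp (x : G) : R * R := ((pt (vnum x)).1, s ^+ copyno x * (pt (vnum x)).2).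

Lemma gp_emb j v : vx v -> gp (emb j v) = ((pt v).1, s ^+ j * (pt v).2).
Proof.
move=> vv; rewrite /gp (vnum_emb nb_irr inner_vertex) //; case E: (pole v); last by rewrite embE.
by case: (poleP E) => ->; rewrite ?ptA ?ptB /= !mulr0.
Qed.

(** Flattening is undone by dividing the second coefficient of the line by [s ^+ j], so the
    separating lines of the drawing [pt] serve in every copy. *)
Lemma sep_same (j : 'I_N) w1 w2 : In w1 objs -> In w2 objs -> w1 <> w2 ->
  (forall v, In v w1 \/ In v w2 -> vx v) ->
  sep (map (fun v => gp (emb j v)) w1) (map (fun v => gp (emb j v)) w2).
Proof.
move=> h1 h2 ne vv; have [pw _] := dr.
have : osep pt w1 w2.
  elim: objs h1 h2 pw => //= o os IH [->|h1] [e|h2] [p1 p2].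
  - by [].
  - exact: p1.
  - by apply: sepC; rewrite -e; exact: p1.
  - exact: IH.
move=> [g [g1 g2 [p hp np]]].
have E v : vx v -> aff (g.1.1, g.1.2 / s ^+ j, g.2) (gp (emb j v)) = aff g (pt v).
  move=> vv'; rewrite gp_emb // /aff /=.
  have : s ^+ j != 0 by rewrite expf_eq0 (gt_eqF s0) andbF.
  by move: (s ^+ j) => z z0; field.
have mp w q : In q (map (fun v => gp (emb j v)) w) -> exists2 v, In v w & q = gp (emb j v).
  by elim: w => //= v w IH [<-|/IH[u]]; [exists v; [left|]|exists u; [right|]].
have mp' w q : In q (map pt w) -> exists2 v, In v w & q = pt v.
  by elim: w => //= v w IH [<-|/IH[u]]; [exists v; [left|]|exists u; [right|]].
have mi w v : In v w -> In (gp (emb j v)) (map (fun v => gp (emb j v)) w).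
  by elim: w => //= u w IH [->|/IH]; auto.
have mi' w v : In v w -> In (pt v) (map pt w).
  by elim: w => //= u w IH [->|/IH]; auto.
exists (g.1.1, g.1.2 / s ^+ j, g.2); split.
- by move=> q /mp[v hv ->]; rewrite E; [apply: g1; exact: mi'|apply: vv; left].
- by move=> q /mp[v hv ->]; rewrite E; [apply: g2; exact: mi'|apply: vv; right].
- case: hp => /mp'[v hv ev]; exists (gp (emb j v)); try (by rewrite E -?ev //; apply: vv; auto);
   by [left; exact: mi|right; exact: mi].
Qed.

(** The line that separates [w1] from the lowest triangle of copy [j] also works here, since copy
    [k] lies in that triangle, and its inner vertices strictly inside. The size bound tells [w1]
    from the triangle itself. *)
Lemma sep_copies (j k : 'I_N) w1 w2 : (j < k)%N -> In w1 objs -> (size w1 < 3)%N ->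
  (forall v, In v w1 -> vx v) ->
  (forall v, In v w2 -> vx v) -> (exists2 v, In v w2 & pole v = false) ->
  sep (map (fun v => gp (emb j v)) w1) (map (fun v => gp (emb k v)) w2).
Proof.
move=> jk h1 sz v1 v2 [u hu pu]; have [pw _] := dr.
pose L := [:: 1%positive; 2%positive; low].
have : osep pt w1 L.
  have ne : w1 <> L by move=> e; rewrite e in sz.
  elim: objs h1 objs3 pw => //= o os IH [->|h1] [e|h2] [p1 p2].
  - by case: ne.
  - exact: p1.
  - by apply: sepC; rewrite -/L in e; rewrite -e; exact: p1.
  - exact: IH.
move=> [g [g1 g2 [p hp np]]].
set gA := aff g (pt 1%positive); set gB := aff g (pt 2%positive); set gL := aff g (pt low).
have A0 : 0 <= gA by apply: g2; left.
have B0 : 0 <= gB by apply: g2; right; left.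
have L0 : 0 <= gL by apply: g2; right; right; left.
(* A function that vanished at all three corners would be 0 everywhere, as they are not
   collinear. *)
have pos : 0 < gA + gB + gL.
  rewrite lt0r; apply/andP; split; last by apply: addr_ge0 => //; apply: addr_ge0.
  apply/eqP => e.
  have eA : gA = 0 by lra.
  have eB : gB = 0 by lra.
  have eL : gL = 0 by lra.
  move: eA eB eL np; rewrite /gA /gB /gL ptA ptB ptL /aff /= => eA eB eL /eqP; apply.
  have c0 : g.2 = 0 by lra.
  have /eqP : g.1.1 * W = 0 by lra.
  rewrite mulf_eq0 (gt_eqF W0) orbF => /eqP a0.
  have /eqP : g.1.2 * h = 0 by lra.
  by rewrite mulf_eq0 (gt_eqF h0) orbF => /eqP ->; rewrite a0 c0; ring.
have E v : vx v -> aff (g.1.1, g.1.2 / s ^+ j, g.2) (gp (emb j v)) = aff g (pt v).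
  move=> vv'; rewrite gp_emb // /aff /=.
  have : s ^+ j != 0 by rewrite expf_eq0 (gt_eqF s0) andbF.
  by move: (s ^+ j) => z z0; field.
have E2 v : vx v -> aff (g.1.1, g.1.2 / s ^+ j, g.2) (gp (emb k v)) =
   aff g ((pt v).1, s ^+ (k - j) * (pt v).2).
  move=> vv'; rewrite gp_emb // /aff /= -{1}(subnK (ltnW jk)) exprD.
  have : s ^+ j != 0 by rewrite expf_eq0 (gt_eqF s0) andbF.
  by move: (s ^+ j) (s ^+ (k - j)) => z z' z0; field.
have inr v : vx v -> pole v = false -> 0 < aff (g.1.1, g.1.2 / s ^+ j, g.2) (gp (emb k v)).
  move=> vv pv; rewrite E2 //; have hv := inner_vertex vv pv.
  have [x1 y1] := strict hv; have hsv := hs hv.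
  set x := (pt v).1 in x1 hsv *; set y := (pt v).2 in y1 hsv *; set t := s ^+ (k - j).
  have t0 : 0 < t by exact: exprn_gt0.
  have ts : t <= s.
    rewrite /t; have : (0 < k - j)%N by rewrite subn_gt0.
    case: (k - j)%N => // n _; rewrite exprS ger_pMr //.
    by have /andP[_ s1] := s01; rewrite exprn_ile1 // ltW.
  (* [a], [b] and [c] are the barycentric coordinates of the flattened point with respect to A, B
     and [low]; all three are positive. *)
  pose c := t * y / h; have c0 : 0 < c by rewrite divr_gt0 // mulr_gt0.
  have cW : c * W < W - `|x|.
    rewrite /c mulrAC ltr_pdivrMr // mulrC [X in _ < X]mulrC mulrC.
    apply: le_lt_trans hsv; rewrite -!mulrA ler_wpM2r // ltW // mulr_gt0 //.
  have xl := ler_norm x; have xr := ler_norm (- x); rewrite normrN in xr.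
  pose a := (W - c * W - x) / (2 * W); pose b := (W - c * W + x) / (2 * W).
  have W2 : 0 < 2 * W by lra.
  have a0 : 0 < a by apply: divr_gt0 => //; lra.
  have b0 : 0 < b by apply: divr_gt0 => //; lra.
  have -> : aff g (x, t * y) = a * gA + b * gB + c * gL.
    rewrite /gA /gB /gL ptA ptB ptL /aff /a /b /c /=; field.
    by rewrite !gt_eqF.
  have q1 := mulr_ge0 (ltW a0) A0; have q2 := mulr_ge0 (ltW b0) B0.
  have q3 := mulr_ge0 (ltW c0) L0.
  rewrite lt0r; apply/andP; split; last by apply: addr_ge0 => //; apply: addr_ge0.
  apply/eqP => e.
  have : a * gA = 0 by lra.
  move=> /eqP; rewrite mulf_eq0 (gt_eqF a0) /= => /eqP eA.
  have : b * gB = 0 by lra.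
  move=> /eqP; rewrite mulf_eq0 (gt_eqF b0) /= => /eqP eB.
  have : c * gL = 0 by lra.
  by move=> /eqP; rewrite mulf_eq0 (gt_eqF c0) /= => /eqP eL; move: pos; rewrite eA eB eL; lra.
have mp (l : 'I_N) w q : In q (map (fun v => gp (emb l v)) w) ->
  exists2 v, In v w & q = gp (emb l v).
  by elim: w => //= v w IH [<-|/IH[z]]; [exists v; [left|]|exists z; [right|]].
have mi' w v : In v w -> In (pt v) (map pt w).
  by elim: w => //= z w IH [->|/IH]; auto.
have mi w v : In v w -> In (gp (emb k v)) (map (fun v => gp (emb k v)) w).
  by elim: w => //= z w IH [->|/IH]; auto.
exists (g.1.1, g.1.2 / s ^+ j, g.2); split.
- by move=> q /mp[v hv ->]; rewrite E; [apply: g1; exact: mi'|exact: v1].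
- move=> q /mp[v hv ->]; case pv: (pole v); last by apply/ltW/inr => //; exact: v2.
  rewrite E2; last exact: v2.
  by case: (poleP pv) => ->; rewrite ?ptA ?ptB /= mulr0 -?ptA -?ptB.
- exists (gp (emb k u)); first by right; exact: mi.
  by rewrite gt_eqF // inr //; exact: v2.
Qed.

Lemma sep_objs j k w1 w2 : In w1 objs -> In w2 objs -> (size w1 < 3)%N -> (size w2 < 3)%N ->
  (forall v, In v w1 -> vx v) -> (forall v, In v w2 -> vx v) ->
  (j = k -> w1 <> w2) -> (j <> k -> exists2 v, In v w1 & pole v = false) ->
  (j <> k -> exists2 v, In v w2 & pole v = false) ->
  sep (map (fun v => gp (emb j v)) w1) (map (fun v => gp (emb k v)) w2).
Proof.
move=> i1 i2 z1 z2 v1 v2 ne p1 p2; case: (ltngtP j k) => jk.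
- by apply: sep_copies => //; apply: p2 => e; rewrite e ltnn in jk.
- by apply: sepC; apply: sep_copies => //; apply: p1 => e; rewrite e ltnn in jk.
- have ejk := val_inj jk; rewrite -ejk; apply: sep_same => //; first exact: ne.
  by move=> v [/v1|/v2].
Qed.

(** An edge is a set, so its arc needs a direction. [pick] may choose either one, hence the later
    comparison of end lists up to order. *)
Definition endpoints (e : {set G}) : option (G * G) :=
  [pick p : G * G | adj p.1 p.2 && (e == [set p.1; p.2]%SET)].
Definition garc (e : {set G}) : R -> R * R :=
  if endpoints e is Some p then seg (gp p.1) (gp p.2) else fun=> 0.

Lemma endpointsP e : e \in edges G -> exists p, [/\ endpoints e = Some p, adj p.1 p.2 &
  e = [set p.1; p.2]%SET].
Proof.
rewrite inE => /existsP[x /existsP[y xy]]; rewrite /endpoints.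
case: pickP => [p /andP[ap /eqP ep]|/(_ (x, y))]; last by rewrite xy.
by exists p.
Qed.

Lemma set2_eq (T : finType) (a b c d : T) : [set a; b]%SET = [set c; d]%SET -> a != b ->
  (a = c /\ b = d) \/ (a = d /\ b = c).
Proof.
move=> /setP H ab; have := H a; have := H b; rewrite !inE !eqxx orbT /=.
move=> /esym/orP[] /eqP eb /esym/orP[] /eqP ea; subst; auto; by rewrite eqxx in ab.
Qed.

Lemma sep_In (U V U' V' : seq (R * R)) : sep U V -> (forall p, In p U <-> In p U') ->
  (forall p, In p V <-> In p V') -> sep U' V'.
Proof.
move=> [g [h1 h2 [p hp np]]] e1 e2; exists g; split.
- by move=> q /e1 /h1.
- by move=> q /e2 /h2.
- by exists p => //; case: hp => [/e1|/e2]; auto.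
Qed.

Lemma edge_adj (x y : G) : adj x y -> x != y.
Proof. by apply: contraTneq => ->; rewrite adj_irrefl. Qed.

Lemma edge_ends e : e \in edges G -> exists a b j v y,
  [/\ adj a b, garc e = seg (gp a) (gp b), e = [set a; b]%SET,
      [/\ vx v, pole v = false, In y (nb v) & e = [set emb j v; emb j y]%SET] &
      forall p, In p [:: gp (emb j v); gp (emb j y)] <-> In p [:: gp a; gp b]].
Proof.
move=> he; have [[a b] /= [ep ab eab]] := endpointsP he.
have [j [v [y [vv pv hy evy]]]] := edge_emb he.
exists a, b, j, v, y; split=> //; first by rewrite /garc ep.
have := eab; rewrite evy => /esym e2.
by have [[-> ->]|[-> ->]] := set2_eq e2 (edge_adj ab) => p /=; tauto.
Qed.

(** A pole belongs to every copy, so the two vertices can be taken in the same copy unless both are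
    inner. *)
Lemma common_copy j k v w : exists j' k', [/\ emb j v = emb j' v, emb k w = emb k' w &
  j' <> k' -> pole v = false /\ pole w = false].
Proof.
case Ev: (pole v); first by exists k, k; split=> //; case: (poleP Ev) => ->.
case Ew: (pole w); first by exists j, j; split=> //; case: (poleP Ew) => ->.
by exists j, k.
Qed.

Lemma gp_inj : injective gp.
Proof.
move=> x y exy; apply: contrapT => ne; move: exy.
have [j [v [vv ex]]] := vertex_emb x; have [k [w [vw ey]]] := vertex_emb y.
have [j' [k' [e1 e2 hp]]] := common_copy j k v w.
rewrite ex ey e1 e2; apply: sep_point.
apply: (@sep_objs j' k' [:: v] [:: w]) => //; try exact: objs1.
- by move=> u [<-|].
- by move=> u [<-|].
- by move=> e [e']; apply: ne; rewrite ex ey e1 e2 e e'.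
- by move=> /hp[pv _]; exists v; [left|].
- by move=> /hp[_ pw]; exists w; [left|].
Qed.

Lemma planar_gluing_scaled : planar R G.
Proof.
have vvy v y u : vx v -> In y (nb v) -> In u [:: v; y] -> vx u.
  by move=> vv hy [<-|[<-|]] //; exact: nb_vertex hy.
exists gp, garc; split; first exact: gp_inj.
- move=> e he; have [a [b [j [v [y [ab -> eab _ _]]]]]] := edge_ends he.
  exists a, b; split=> //; apply: seg_arc => /gp_inj exy.
  by have := edge_adj ab; rewrite exy eqxx.
- move=> e x t he; rewrite in_itv /= => t01.
  have [a [b [j [v [y [ab -> eab [vv pv hy _] hin]]]]]] := edge_ends he.
  have [k [w [vw ->]]] := vertex_emb x; apply: sep_seg t01.
  have [k' -> hk] : exists2 k', emb k w = emb k' w & k' <> j -> pole w = false.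
    by case E: (pole w); [exists j => //; case: (poleP E) => ->|exists k].
  apply: (@sep_In [:: gp (emb k' w)] [:: gp (emb j v); gp (emb j y)]) => //.
  apply: (@sep_objs k' j [:: w] [:: v; y]) => //; [exact: objs1|exact: objs2| | | | ].
  + by move=> u [<-|].
  + by move=> u; exact: vvy.
  + by move=> /hk pw; exists w; [left|].
  + by move=> _; exists v; [left|].
- move=> e f s' t he hf ef; rewrite !in_itv /= => s01' t01.
  have [a [b [j [v [y [ab -> eab [vv pv hy ee] hin]]]]]] := edge_ends he.
  have [a' [b' [k [w [z [ab' -> eab' [vw pw hz ef'] hin']]]]]] := edge_ends hf.
  apply: sep_segs s01' t01.
  apply: (@sep_In [:: gp (emb j v); gp (emb j y)] [:: gp (emb k w); gp (emb k z)]) => //.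
  apply: (@sep_objs j k [:: v; y] [:: w; z]) => //; [exact: objs2|exact: objs2| | | | | ].
  + by move=> u; exact: vvy.
  + by move=> u; exact: vvy.
  + by move=> ejk [e1 e2]; move: ef; rewrite ee ef' ejk e1 e2 eqxx.
  + by move=> _; exists v; [left|].
  + by move=> _; exists w; [left|].
Qed.
End Scale.

Lemma planar_gluing : planar R G.
Proof. by have [s s01 hs] := small_scale; exact: (planar_gluing_scaled s01 hs). Qed.
End Drawing.

End Arcs.
Import Arcs.

(** * The graph P, its automorphism and the encoded case trees *)

Module Trees.
Local Open Scope positive_scope.

(* The vertices of P except the poles 1 and 2, each with the neighbours of smaller
   number; from 13 on, with the exception of 19 and 20, these are the corners of
   the face into which it is stacked. *)
Definition table : seq (positive * seq positive) := [:: (3, [:: 1; 2]); (4, [:: 1; 2]); (5, [:: 1;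
3; 4]); (6, [:: 2; 3; 4; 5]); (7, [:: 1; 2]); (8, [:: 1; 3; 7]); (9, [:: 2; 3; 7; 8]); (10, [:: 1;
2]); (11, [:: 1; 4; 10]); (12, [:: 2; 4; 10; 11]); (13, [:: 1; 5; 3]); (14, [:: 1; 5; 4]); (15, [::
5; 6; 3]); (16, [:: 5; 6; 4]); (17, [:: 2; 6; 3]); (18, [:: 2; 6; 4]); (19, [:: 1; 2; 7]); (20, [::
1; 2; 10]); (21, [:: 1; 5; 13]); (22, [:: 5; 3; 13]); (23, [:: 1; 3; 13]); (24, [:: 1; 5; 14]); (25,
[:: 5; 4; 14]); (26, [:: 1; 4; 14]); (27, [:: 5; 6; 15]); (28, [:: 6; 3; 15]); (29, [:: 5; 3; 15]);
(30, [:: 5; 6; 16]); (31, [:: 6; 4; 16]); (32, [:: 5; 4; 16]); (33, [:: 2; 6; 17]); (34, [:: 6; 3;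
17]); (35, [:: 2; 3; 17]); (36, [:: 2; 6; 18]); (37, [:: 6; 4; 18]); (38, [:: 2; 4; 18]); (39, [::
2; 7; 19]); (40, [:: 1; 7; 19]); (41, [:: 2; 10; 20]); (42, [:: 1; 10; 20]); (43, [:: 1; 11; 4]);
(44, [:: 1; 11; 10]); (45, [:: 11; 12; 4]); (46, [:: 11; 12; 10]); (47, [:: 2; 12; 4]); (48, [:: 2;
12; 10]); (49, [:: 1; 8; 3]); (50, [:: 1; 8; 7]); (51, [:: 8; 9; 3]); (52, [:: 8; 9; 7]); (53, [::
2; 9; 3]); (54, [:: 2; 9; 7]); (55, [:: 3; 13; 22]); (56, [:: 5; 13; 22]); (57, [:: 3; 13; 23]);
(58, [:: 1; 13; 23]); (59, [:: 4; 14; 25]); (60, [:: 5; 14; 25]); (61, [:: 4; 14; 26]); (62, [:: 1;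
14; 26]); (63, [:: 6; 15; 27]); (64, [:: 5; 15; 27]); (65, [:: 3; 15; 28]); (66, [:: 6; 15; 28]);
(67, [:: 3; 15; 29]); (68, [:: 5; 15; 29]); (69, [:: 6; 16; 30]); (70, [:: 5; 16; 30]); (71, [:: 4;
16; 31]); (72, [:: 6; 16; 31]); (73, [:: 4; 16; 32]); (74, [:: 5; 16; 32]); (75, [:: 6; 17; 33]);
(76, [:: 2; 17; 33]); (77, [:: 3; 17; 34]); (78, [:: 6; 17; 34]); (79, [:: 3; 17; 35]); (80, [:: 2;
17; 35]); (81, [:: 6; 18; 36]); (82, [:: 2; 18; 36]); (83, [:: 4; 18; 37]); (84, [:: 6; 18; 37]);
(85, [:: 4; 18; 38]); (86, [:: 2; 18; 38]); (87, [:: 1; 11; 43]); (88, [:: 11; 4; 43]); (89, [:: 1;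
11; 44]); (90, [:: 11; 10; 44]); (91, [:: 2; 12; 47]); (92, [:: 12; 4; 47]); (93, [:: 2; 12; 48]);
(94, [:: 12; 10; 48]); (95, [:: 1; 8; 49]); (96, [:: 8; 3; 49]); (97, [:: 1; 8; 50]); (98, [:: 8; 7;
50]); (99, [:: 2; 9; 53]); (100, [:: 9; 3; 53]); (101, [:: 2; 9; 54]); (102, [:: 9; 7; 54])].
(* The images of 1, 2, 3, ... under the automorphism of P that exchanges 3 and 4. *)
Definition mirrored : seq positive := [:: 1; 2; 4; 3; 5; 6; 10; 11; 12; 7; 8; 9; 14; 13; 16; 15; 18;
17; 20; 19; 24; 25; 26; 21; 22; 23; 30; 31; 32; 27; 28; 29; 36; 37; 38; 33; 34; 35; 41; 42; 39; 40;
49; 50; 51; 52; 53; 54; 43; 44; 45; 46; 47; 48; 59; 60; 61; 62; 55; 56; 57; 58; 69; 70; 71; 72; 73;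
74; 63; 64; 65; 66; 67; 68; 81; 82; 83; 84; 85; 86; 75; 76; 77; 78; 79; 80; 95; 96; 97; 98; 99; 100;
101; 102; 87; 88; 89; 90; 91; 92; 93; 94].

(** In ASCII, 48 is the digit 0, 58 comes right after the digit 9, and 87 is 10 less than the letter
    a. *)
Definition hex (a : Ascii.ascii) : N :=
  let n := Ascii.N_of_ascii a in if N.ltb n 58 then N.sub n 48 else N.sub n 87.

(* Postfix notation, three characters for a node: its vertex or edge number in
   hexadecimal, then a letter of the alphabet starting at A for [I1], at a for
   [I2] and at 0 for [Sp], whose rank is the number of subtrees. *)
Definition node (a b c : Ascii.ascii) (ts : seq tree) : seq tree :=
  let n := N.add (N.mul 16 (hex a)) (hex b) in
  let v := if n is Npos p then p else xH in
  let z := Ascii.nat_of_ascii c in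
  let push f k := f (rev (take k ts)) :: drop k ts in
  if (97 <= z)%N then push (I2 v) (z - 97)%N else
  if (65 <= z)%N then push (I1 v) (z - 65)%N else push (Sp (N.to_nat n)) (z - 48)%N.
Fixpoint nodes (s : String.string) (ts : seq tree) : seq tree :=
  if s is String.String a (String.String b (String.String c s'))
  then nodes s' (node a b c ts) else ts.
Definition decode (ss : seq String.string) : tree :=
  head (I1 xH [::]) (foldl (fun ts s => nodes s ts) [::] ss).

Local Open Scope string_scope.

(** With the copy as index, the orders refuted are A u0 u1 t0 t1 B by [tree2], A u0 t0 u1 t1 B by
    [tree3], A t0 t1 B u1 u0 by [tree4], A t0 t1 B u0 u1 by [tree5], and A u1 u0 t0 t1 B here. The
    order in which u and t alternate takes by far the largest tree. *)
Definition tree1 : tree := Eval vm_compute in decode [::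
"12a0ea12a0fB0ea0ba0ba0ba2fa0cb0bb0fB10B2fa0cb0bb0fB10B10A25A25A0cb2ba0bc10A0ba0ba0ba2ba0bb2fa0cb";
"0bb0fB10B0ba0ba0ba0ba0as21a21a21a1dD23a23a23a1bD0fC11c4eA4eA4eA1dD4dA4dA4dA1bD0fC22B0ba0ba0ba2fa";
"0cb10A0bc25B10A25A10A0ba0ba0ba25A25A0bb2fa0cb0bb25B10B0ba0ba0ba0ba0ba0as21a21a21a1dD23a23a23a1bD";
"0fC11d12d06e0ea0fB0ea12a0ba0ba0ba2ba25A0cb0bc25A2fa0cb0bb25A0ba0ba0ba2fa0cb0bb0ba2ba0bb0ba0ba0ba";
"0ba0ba0as10B0ea0ea1bA1bA23b0321dA1dA21b0220fD25A0ea1bA4dB1bA0321dA4eB1dA0220fD22B11d12d06e22A53A";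
"53A53A1eD54A54A54A20D25C0da10C0da08a08a08a31a08b35a09b08b08a08a08a22A35a09b08b0fB0fA22A22A09b31a";
"08c0fA08a08a08a08a08a07t11e24a24a24a20D26a26a26a1eD0da10D12c11a0da0da10B06e12a1eA1eA26b03220A20A";
"24b02210C54A54A20B03253A53A1eB02225C10B08a08a08a35a09b08b22A08b22A08a08a08a22A35a09b08b08a08a08a";
"08a07p08a08a35a09b08b31a08b08a08a08a31a22A09b08c22A35a09b08b35a09b08b08a08a08a08a07p0da0da11f12c";
"0fC11a10B0da11a06e05e05a00205a05a003"].

Definition tree2 : tree := Eval vm_compute in decode [::
"05a11a12a06c06a05c0020da06a05c0ea0da06c05b003"].

Definition tree3 : tree := Eval vm_compute in decode [::
"12a10A23a23a1bB02221a21a1dB03211d0fC06b12a10A23a23a1bB02221a21a1dB03211d0fC06b00212a0ba0ba0ba30a";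
"2fb2ca2dA0cd2fa0cb30a2fb30a0cc0322dA2fa2fa5eA5da2ab5da03230c58A5aA57a57a2be2eB30a29b14d0ce2dA2fa";
"2dA0cd2cd2ca0bd1fA18b1fA0221eA1ab1eA03210C1eA1eA2fa0cb0bb3bC0123cA3cA1fB0322fa0cb0bb2fa0cb2fa0cb";
"0bc19E10B1fA1fA3cB0221eA1eA3bB03210C19B0ed26a24b1dA45B1dA0321cA46B1cA0220fC1eB12c1dA1dA1fB0321cA";
"1cA20B0220fC10C16A08a08a08a08a08a22A09a08b35a09b08b35a09b16A08c16A22A22A09b22A09b21c31a31a21b032";
"21a08d08a08a08a08a08a08a08a08a07u11b0de0ba0ba0ba0ba0ba0ba0al0020ea0ea16A16A3cA3cA3cA1fD3bA3bA3bA";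
"1eD10C19B0ba0ba0ba0ba2fa0cb2fa0cb0bc25A25A0cb2ba0bc0ba0ba0ba0ba0ba0ba0ba0ao00235a09b08b08a08a08a";
"08a08a35a09b08b08a08a08a35a66A65a28b65a04236c00209b08b09a09a27a62A62A16A60A62A5fa34A09c31e35a33A";
"09c09a09a32j08b35a09b08b03208a35a09b08b35a09b08b35a09b08b13k35a36b09b08b01236a35b09b08b31a31a08c";
"31a08b16A36a09b35a09b35a09b35a09b33A35a09c27a5fa62A60A31d34B65a28b65a03266A65a65a36e36a36a13f35a";
"35a09d35a09b35a09b35a09b35a09b35a09b32k08c16A32a36b32a32a35c32a00233A09d33A32a36a35b09d08d01236a";
"35a09c08b08a08a08a35a09b08b36a35a09c08b35a09b08b08a07u0ba0ba0ba0ba2fa0cb2fa2fa0cc2fa2fa0cc0bd2fa";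
"0cb2fa0cb0bc25A25A0cb2ba0bc0ba0ba0ba0ba0ba0ba0ba0ba0ba0ar00216A16A16A0dh1fA1fA1fA18d1eA1eA1eA1ad";
"10C0ec4dA4dA4dA1bD4eA4eA4eA1dD22C12d0fB12a21a21a21a1dD23a23a23a1bD0fD11c06d0ba0ba0ba30a2ca2bb2dA";
"0cd2dA5aA59a59a29b03230a2cd2ca2ab5cA5eA5ba5ba2fe2eB2dA30d14c30a30a2bc30a02230a0ce0bc1aa18b1cA1cA";
"46B0221dA1dA45B03211a0fD1eB0ec1cA20B1cA0321dA1fB1dA0420fC22A08a08a08a08a08a08a31a08b31a22A09b08c";
"22A15a15a16C35a09b35a09b15b03215a08d16A0dc08a08a08a08a08a08a08a07r11d1cA1dA1cA0fD46A46A1cB0121dA";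
"1dA1cA0fE24a26a26a24a24a20C26a53A53A54A54A20C25D0122ba0bc53A53A54A54A20C25D12g45D24a26a26a20A24b";
"20A00226a53A53A20A20A54B00225D0122ba0bc53A53A20A20A54B00225D12g24a26a24a26a53A54A25C0122ba0bc53A";
"54A25C12f1eD10D0ba0ba0ba0ba0ba0ba0al12a12a11a11a08a08a08a08a08a08a31a09a09a08d16A35a09b08c16A35a";
"35a09c35a09b08d12b08a08a08a08a08a07o08a08a08a08a08a08a08a08a31a09a09a08d16A16A35a09b08c16A35a35a";
"09c35a09b08d16A35a35a35a09d35a35a09c35a09b08e08a08a08a08a08a08a08a07u15c0de0fC06c00210A0ea1cA15b";
"1cA0221bA17b1bA0320fD0dc0ba0ba0ca0bb0ba0ba0ba0ba0ba0ai12b2ba0bb2ca2ba0cc0bb0ba0ba0ba0ba30a2ca2bb";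
"2dA10A10A1cA15b1cA0221bA17b1bA0320fC0dd0ce2dA30a2cb59a5aA59a59a29b03230a2ce2ca2ab5cA5eA5ba2fd2eB";
"2dA30d14d30a30a2bc30a0320cd10A0cb10A0cb1cA15b1cA0221bA17b1bA0320fC0dd0bd10A10A1cA15b1cA0221bA17b";
"1bA0320fC0dd37A37A1bB02238A38A1cB03216C19A17a17a1bB02215a15a1cB0320de0fB30a0cb2fa0cb0bc0fA2ba0bb";
"2ba0bb2ba2ba0ca0ca5ba5ba2eA2dA5cA5eA5eA2aa30f2fe0cb2ba2ba2ch0bb0ba0321cA15b1cA0221bA17b1bA0320fC";
"0db17a17a1bB02215a15a1cB0320dc0fB0da10E2ba0ca59a59a29b0325aA2cd0020bb0ba0ba2ba0bb2ba0bb14i0ba0ba";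
"0ba0ba2ba0bb0ba2ba0bb0ba0au0fA0ed0ea0da08a08a08a08a08a08a08a08a35a09b0fA08c0fA22A22A09b31a08c31a";
"08b21b01231a31a08c22A09b31a31a31a08e21c08a08a08a08a08a08a08a07u11d00211a11a0da11b0da11b11a11a12c";
"0020da11b03111a11a11a11a0ej08a08a08a08a08a09a08b0ea0ba0ba0ba2ba0bb2ba0bb2fa0cb0bb2fa0cb0bb0ba0ba";
"0ba0ba0ba0ba0ba0ba0ap0ba0ba0ba2ba0bb2ba2ba24c0bb0322ba0ca0ca0bd2ba0bb2ba0bb24c0322fa0cb0bb2fa0cb";
"0bb0ba0ba0ba0ba0ba0ba0ba0ao0ba0ba0ba0ea0bb2ba0bb0ea0ea24c0322fa0cb0bb2fa0cb0bb0ba0ba0ba0ba0ba0ba";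
"0ba0ao0ea0ba0ba0ba0ba2ba0bb2ba2ba0ca0bd2ba0ca0bc2fa0cb0bb2fa0cb0bb0ba0ba0ba0ba0ba0ba0ba0ba0ar0ea";
"0ea24e18a18a53A53A1eB53A1eB0fC0020fA20B0fA20B54B0321dA1dA48C1dA1dA48C53B08247A47A54B0721dA1dA1dA";
"1fF1cA1cA0fD0fA10E1eA1eA53B05220A20A54B0421cA0fB48B1cA0fB48B53B06247A47A54B0521cA0fB1cA0fB1fE10D";
"3cA1eA1eA0fC1eA1eA0fC53B05219C20A0fB20A0fB20A54B0fB20A54B0fB0620431fA1fA19C1fA1fA19C1dB0021cA20B";
"1cA0220fC1dA48A48A53B08206247A47A54B0821dA1dA1dA1fF1cA1cA0fD19B02210D16A35a09b16A08c0de0ee03325D";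
"0ea0ea0ba0ba0ba0ba2ba0bb2fa0cb0bb2fa0cb0bb0ba0ba0ba0ba0ba0ba0ba0ba0ba0aq0ba0ba0ba0ba2ba2ba0bc2fa";
"0cb0bb2fa0cb0bb0ba0ba0ba0ba0ba0ba0ba0ba0ap0ba0ba0ba0ba0ba2ba2ba0ca0ca0be2ba0ca0ca0bd2fa0cb0bb2fa";
"0cb0bb0ba0ba0ba0ba0ba0ba0ba0ba0ar1eA1eA55F0ba0ba0ba0ba2ba0bb2fa0cb0bb2fa0cb0bb0ba0ba0ba0ba0ba0ba";
"0ba0ao56c1eA1eA1eA26e0ba0ba0ba0ba2ba0bb2fa0cb0bb2fa0cb0bb0ba0ba0ba0ba0ba0ba0ba0ba0ba0aq0ba0ba0ba";
"0ba2ba2ba0bc2fa0cb0bb2fa0cb0bb0ba0ba0ba0ba0ba0ba0ba0ba0ap0ba0ba0ba0ba0ba2ba2ba0ca0ca0be2ba0ca0ca";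
"0bd2fa0cb0bb2fa0cb0bb0ba0ba0ba0ba0ba0ba0ba0ba0ar1eA1eA55F0ba0ba0ba0ba2ba0bb2fa0cb0bb2fa0cb0bb0ba";
"0ba0ba0ba0ba0ba0ba0ao56c1eA1eA1eA26e16A3cA19B0ec16A3cA19B0ec1eC18a16A1eA1eA19C0ed0ea0ba0ba0ba0ba";
"0ba2ba2ba56c0bb2ba55A0cb0bc2ba0bb56b01255A2fa0cb0bb0ca2fa0cb0bc2fa0cb0bb0ba0ba0ba0ba0ba0ba0ba0ba";
"0ba0ba0av0ea18a1eA1eA16A3cA19B1eA1eA19C0920ef0ea0ea26g0930ea35a09b16A08c0e20de0620ea24a24a0d2092";
"0ea0ea24b24a0d20920ea0ea24b24a0d20920b00eb0b00eb0ea16A0eb35a09b16A08c0dd20G18a18a1cA1cA1cA1cA1cA";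
"19C3cA3cA19C09216A35a09b16A08c0de0ef0ea0ba0ba0ba0ba0ba2ba2ba56c0bb1dA1dA48C1dA1dA48C1dA1dA48C0e2";
"2ba55A0cb0bc2ba0bb56b0120e31dA1dA48C1dA1dA48C1dA1dA48C0c255A0c32fa0cb0bb2fa0cb0bb0ba0ba0ba0ba0ba";
"0ba0ba0ba0ba0at1401401401401dA1201201dC0c11621dA1201dB0c116214048H0c048B0311dA0621dA1dA48C0b048B";
"0310b048B0411dB0720f21320c048B0311dA0621dA1dA48C0b048B0310b048B0411dB0720f21320ea0ea0ea26i47A47A";
"47A0ec47A24b47A24b47A24b0a20ec0a31dA0d00d01dC0611021dA0d01dB0611021dA0d01dB0611021fF0ea16A0eb35a";
"09b16A08c0dd10F0da0eb0ea0fE0ea0ea12f0ea0ea0ea0ea0ea0dc21a09b21a09b22C31a31a21b02221a08d22A22A11g";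
"0120da31a31a21c11c0da21a11c08c08a08a08a08a08a07o00212a12a12a0ea12b0410ea12b12a12a11c0020ea12b12a";
"12a12a0dj0ba0ba0ba0ba24a2ba2ba24c0bb0ea12d0da24b0da0da25C24a2ba2ba24b02224a0cb0da0da25C0320bd0ea";
"0ea0dc0da0da12g0da15a0db19A2fa0cb0bc19A0db0da0ed20A0a020B0610e220A0a020B0610e220A0a00a020C0610e2";
"0da0da0da0da20A20A42C20A20A42C20A20A42C23b08220A20A42C20A20A42C23b0820f213013013042A20A20A13142C";
"42A42A20B42A20B0d21220b320A20A42C20A20A42C0c220A20A42C20A20A42C10208a08a08a08a08a08a08a08a08a35a";
"09b08b35a09b08b4fA50a09b50a09b4fC31a31a50b03250a08d31a31a50c08b08a08a08a08a08a08a08a07v4fA23i023";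
"41A41A41A0dc0da41A21b41A21b0b200201308a08a08a08a08a08a08a08a08a35a09b08b35a09b08b10020A0f020B0c1";
"14220A0f00f020C0c11421101104dC0411104dB0411104dB04142G41A41A41A4eB41A4eB0c200322C12020A11020B0e1";
"16220A11011020C0e11624dA09b4dA09b1221404dB07109b1404dB07109b42G31a08c21a03241A41A41A4eB41A4eB0e2";
"00309a09a31a08d31a08b31a08b21c03231a08b22E31a31a21c08b08a08a08a08a08a08a07u0da11i1cE19A2fa0cb0bc";
"19A38A16B1fA1fA16C0321fA0ee1fA1fA15a0de0da0da0da0da08a08a08a08a08a08a08a08a35a09b08b35a09b08b19A";
"2fa0cb0bc19A16A0ed15a0dc0da19A2fa0cb0bc10238A16B1bA1bA16C38A16B1bA1bA16C0a24fA09b31a08c31a08b50b";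
"0024fA23d03319A1bA1bA4fA09b31a08c31a08b50b0024fA23d0421bA1bA4fA09b31a08c31a08b50b0024fA23d04215a";
"0df1bA1bA1bA1bA4fA09b31a08c31a08b50b0020521bA1bA4fC23f1bA1bA1bA1bA4fA09b31a08c31a08b50b0020421bA";
"1bA4fC23f0ee0da0da08c0da08b08a08a08a08a08a08a07u00219A2fa0cb0bc19A0ec0db21a0db21a0a221a0db21a0a2";
"21a1dE21a1dB21a0320da0a308a08a08a08a08a08a08a35a09b08b35a09b08b31a08b0da31a08b21c0120da08b08a08a";
"08a08a08a07q0da08a08a08a08a08a35a09b08b35a09b08b09a31a08c08a08a08a08a08a08a07o0da21b0020c20da19A";
"2fa0cb0bc19A38A16B1bA1bA16C38A16B1bA1bA16C4dB0820234dA4dA1bB0524dA4dA1bB0420ef4dA4dA1bB0424dA4dA";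
"1bB04215a0de19A2fa0cb0bc19A0db0da0ed0b00b00c04eB0310c04eB0310c00c04eC0311dG08a08a08a08a08a35a09b";
"08b35a09b08b31a08b08a08a08a08a08a08a08a07p22D0c20130da11h0fE0da10E0fA0bb0ba0ba0ba0ba0ba0ba0ba0ap";
"0020ea0ea0da0da0da11f0da10C1fA1fA1fA18d1eA1eA1eA1ad0ec10B0ea0ea23a23a23a1bD1dA1dA21b0220fD0ba0ba";
"25A0bb25A25A0ba0ba0ba25A10A2fa0cb0bb10B0ba0ba0ba0ba0ba0ba0ba0ba0at0ba0ba0ba0ba2fa0cb0bb0ba0ba0ba";
"0ba0ba0ba0ba0ba0an10B25B2ba0bb2ca2ba0cc0bb0ba0ba2ca2ba0cc0bb30a2ca2bb2dA25A0ce2dA30a2cb30a2cb59a";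
"59a5aA59a59a29b03230a2cf2ca5eA5cA2dA30d5eA5cA2dA30d2ad2eA5ba2fd14e30a30a2bc30a0320cd25A0cb0bd25A";
"2fa0cb0bb2ca2bb0bb2ba0bb2ba0bb0ba2ba2dA5ba2eA5eA5cA25A2ff5eA5eA2ca2bb2ab30g0cb0bb2ba2ba2ba0ca59a";
"2bb29a2bb59a2bb29b0320525aA2ba2ba2ci0bb0ba0ba0ba2ba0bb2ba0bb14k0ba0ba0ba2ba0bb0ba2ba0bb0ba0ar0ba";
"0ba0ba2ba0bb2fa0cb0bb0ba0ba0ba0ba0ba0ba0al0ea0ea1dA1dA1dA52a52a4eF4dA4dA4dA1bD52a52a52a52a22G0fD";
"51A24d02210B0ea0ea1bA4dB1bA0324eA4eA4eA1dD0fD22B0ba0ba0ba55A55A56a2ba2ba56b02256a0cb56a0cb55C0bd";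
"0ea0ea4eA4eA1dB0324dA4dA1bB02222C0fD26e2fa0cb0bb0ba0ba0ba0ba0ba0ba0al10B00225A25A0ba0ba0ba0ba25A";
"10A2fa0cb0bb10B0ba0ba0ba0ba0ba0ba25A25A0ba25B25A0bb0400bb0as12i11d0130ba0ba0ba0ba0ba2ba2ba2ba25A";
"0cb0be2ba2ba25A0cb0bd2ba25A0cb0bc25A2fa0cb0bb0ba0ba0ba0ba0ba0ba0ba0ba0ba0ba0au0ba0ba0ba2ba2ba0bc";
"2ba0bb2fa0cb0bb0ba0ba0ba0ba0ba0ba0ba0ba0ao24c0ea0ea0da12e0da10C00210A0ea1cA15b1cA0221bA17b1bA032";
"0fD0dc10A0ea1cA15b1cA0221bA17b1bA0320fD0dc00210A0ea1cA15b1cA0221bA17b1bA0320fD0dc10A0ea1cA15b1cA";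
"0221bA17b1bA0320fD0dc00206h0ba0ba0ca0bb0ba2fa0cb2fa0cb18c0bb12a0ed11a18b11a11a19C11a2fa0cb2fa0cb";
"0bc2fa0cb0bb2fa0cb0bb2fa0cb0bb18c02219C07212a12a11c11a11a0eg08a08a08a08a08a08a0ba09008c31a09b09a";
"09a08d25A0cb2ba0bc25A22A0fA12e10A21a11d25A0cb2ba0bc25A12c11b11a12a11b25A0cb2ba0bc25A11b11a12d20A";
"0b00b020C0310f220A0b020B0310f220A0b020B0310f211a11a11a1100e011b16A35a09b08c16A35a09b08c15b002101";
"16A0e10dh1cF11a1fA1fA1fA11a43A43A15b0220221fA44A44A17b0920621fA44A44A44A3aa3aa39A39A17h0c21fA44A";
"44A44A35a35a35a3ac05235a39A39A17h0c23aa39A17c1fA3aa39A17c44B0b206209d3aa39A17c1fA3aa39A17c44B082";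
"03208c0421dF1fA1fA1fA1fA44A44A35a09b08b15a05237C01208238A38A43B03235a09b08b35a09b08b35a09b08b15c";
"04235a09b35a09b08c16E1dE1fA1fA1fA1fA37A37A44B02207238A38A43B03216C1dE0de17a1fA43A43A15b02244A44A";
"39A35a09b08c39A35a09b08c3ab00239A17d0321dD1fA43A43A38B02244A44A35a09b08b37C0321dD35a09b08b35a09b";
"35a09b08c16D35a09b35a09b08c15b0021fA43A43A38B02244A44A37B0321dD16B0de1fA02211a0a310E11a12a11b25A";
"0cb2ba0bc25A0cb2ba0bc11c22A22A1bC22A22A1bC22A22A1bC22A22A1bC39A35a09b08c39A35a09b08c3ab00203222A";
"1bA1bA39C09217f15a15a1cB06222A1bA1bA35a09b08b15a03237C0120b238A38A1cB08235a09b08b35a09b08b35a09b";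
"08b15c02235a09b35a09b08c16E37A37A1bB37A1bB22C06238A38A1cB07216C0de25A21a11d12c1bA1bA1bA1bA39A35a";
"09b08c39A35a09b08c3ab0020321bA1bA39C17f15a1cB15a05235a09b35a09b08c37A1bB37A07238A1cB38A08238A35a";
"09b08c16D03235a09b35a09b08c35a09b35a09b35a09b08d15b03215a17d37A1bB37A05238A1cB38A06216C0de25A0cb";
"2ba0bc22A25A11c12c05225A0cb2ba0bc4eA22B25A11c12c05211a11a11a11a11a16A35a09b08c16A35a09b08c15b002";
"16A11a0di0b311a11a10F0fD11a08a0620ba09b08b08a08a08a08a08a07r0ba0ca0bb0ca0bb0ba0ba0ba0ba0ba0ao0ba";
"0ba0ba12a0ba04208a08a08a08a09a08b12a08b09a08b08a12a12a24a19A09219A3cA1fB3cA0523bA1eB3bA04219C3cA";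
"1fB3cA0523bA1eB3bA04219C3cA1fB3cA0523bA1eB3bA04219C3cA1fB3cA0623bA1eB3bA05219C3cA3cA25C3cA3cA1fB";
"05205254A25B3bA3bA1eB3bA1eB25C04205219C22A31a22A09b08c11f12f2fa0cb2fa0cb0bc2fa0cb0bb2fa0cb0bb2fa";
"0cb0bb18c0223cA3cA3cA1fB3cA0623cA1fB3cA0621101103cC0411103cB0411103cB04110010022A31a22A09b08c11c";
"1fG12f18a2fa0cb18a05224a1eA1eA3bB1eA3bB18c0421eA1eA3bB1eA3bB18c0421eA1eA3bB1eA3bB18c0421eA1eA3bB";
"1eA3bB18c05254A25B54A25B1eA1eA3bB1eA3bB18c0420820e222A31a22A09b08c11f12e0bd19E18a18a1fB03218a1fB";
"18a03218a1fB22A31a22A09b08c11d12b18a12b12a04308212a0f31eA3dA3ea1eA1ad3dA3ea3ea3dC2fa0cb2fa0cb3eb";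
"0021eA1ae0bc0121eA3dA3ea1eA1ad3dA3ea3ea3dC2fa0cb2fa0cb3eb0021eA1ae0bc02224a1eA3dA3ea1eA1ad3dA3ea";
"3ea3dC2fa0cb2fa0cb3eb0021eA1ae0bc0321eA3dA3ea1eA1ad3dA3ea3ea3dC2fa0cb2fa0cb3eb0021eA1ae0bc03222A";
"54A3dA3ea1ac3dA3ea1ac1eB0723dA3ea3ea3dC2fa0cb2fa0cb3eb0021ad3dA3ea3ea3dC2fa0cb2fa0cb3eb0021ad1eB";
"0721eA1eA0be3dA3ea1ac3dA3ea3ea3dC2fa0cb2fa0cb3eb0021ad0bc3dA3ea1ac3dA3ea3ea3dC2fa0cb2fa0cb3eb002";
"1ad0bc1eB04225D12f12a12a12a12a31a13222A09b22A09b13212a12a12a08i11e12a12a12a0ei24a1dA1dA1dA54A25B";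
"1dA1dA25C08222A31a22A09b08c11e12e1cA1cA4aC1cA1cA4aC3bB03249A49A3cB0221cA1cA1cA20F19B2fa0cb3cA49B";
"3cA0321cA1cA4aC1cA1cA4aC3bB01219C1cA1cA1cA20E0bc2fa0cb2fa0cb0bc18b0023dA3ea1ac3dA3ea3ea3dC2fa0cb";
"2fa0cb3eb0021ad0bc4aB3dA3ea1ac3dA3ea3ea3dC2fa0cb2fa0cb3eb0021ad0bc0021cA04249A49A18b0221cA1cA1cA";
"20F1aa0ee12a1cA3cA3cA3bA3bA3bA4aC04219D0511cA0733cA3bA19C05110010049E1cA1cA0d21cA1cA0d21cA1cA0d2";
"20E2fa0cb2fa0cb0bc2fa0cb0bb2fa0cb0bb2fa0cb0bb18c0221cA1cA20B1cA20B18c05218a20A1cB20A0820920d22fa";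
"0cb18a05220A1cB20A0a220A20A1cB0a211212218a3bA3bA4aB1cA06200207249A49A3cB0421cA1cA1cA20F1cA4aA4aA";
"3bB4aA3bB18c05208249A49A3cB0421cA1cA1cA20F1020bd19D12a1cA4aA4aA3dC1011cA0733ea2fa0cb2fa0cb3eb032";
"1cA1cA4aC1cA1cA4aC1023ea3ea3dC0920bd1101cA1501504aC1cA0830321cA1504aB0311cA09312a1cA12a4aB031082";
"13212a12a1ai12a49A49A18b0f10320321cA1cA1021cA1cA1021cA1cA10220F12a12a12a12a0ei02222A31a22A09b08c";
"11c12b10E24a12b12a0fE12a12a12a12a11c12a15a15a16C35a09b35a09b15b03215a15a08e07212a12a16C12a12a16C";
"12a12a16C0dh12a12a12a12a11c35a09b08b35a09b35a09b08c15b00212a12a16C12a12a16C12a15b0dh11a35a09b08b";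
"35a09b08b15b00208a08a0de12a09a08b08a08a08a08a07s10A08a08a08a08a08a08a08a08a08a08a31a22A09b08c24a";
"0fA22A25A12e16A15a15a16C35a09b35a09b15b04215a08d15a35a35a15c09c08b08a08a08a08a08a08a08a08a07x15a";
"0dc11c2ba0bb2ba0bb12b0220ca0bb0ba0ba0ba0ba0ba0ba0ba0ap06c00212a24a24a24a20D26a26a26a1eD12c11a11a";
"10D35a09b08b08a08a08a35a09b08b08a35a66A65a28b65a04236c00209b08b09a09a36a35b27b09b62A60A62A5fa34A";
"09c09a31e35a33A09c09a09a32i08b35a09b08b35a09b08b35a09b08b13h10A1eA1eA26b03220A20A24b02210C1eA53B";
"1eA03220A54B20A02210C25B22A31a22A09b08c0da0da11f12c32a33A5fa62A60A31d34B27a32d66A28a28a65b02213d";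
"65a36d32a32a35c32a00233A09d33A32a36a35b09d08c08a08a35a09b08b36a35a09c08b35a09b08b08a07o0fD0da11a";
"08a08a08a08a0ba0ba0ba0ba0ba25A24a12c25A25A0cb25A0cb24c2ba2ba24b00212d0bc19A19A2fa0cb0bc2fa0cb0bb";
"0ca0bb0ba0ba0ba0ba0ba0ba0ba0ar19A1cA1cA20B0221dA1dA1fB0323fA3fA20B03240A40A1fB0421bC23a21b11c0fD";
"10B38A38A1cB03237A37A1bB02216C0fB35a09b38A38A1cB03237A37A1bB02216C0fB08c1bA17b1bA0321cA15b1cA022";
"0fC0dd0ee32a33A33A5fa5fa62A60A31e36a27b32e34B32a65a28b65a03266A36d13c35a35a32c35a03233A09d33A32a";
"36a35b09d08d08a08a08a08a08a07l00206d0ba0ba0ba0ba0ba2fa0cb2fa2fa0cc19A0bd2fa0cb2fa2fa0cc19A0bd18b";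
"0022fa0cb2fa0cb0bc2fa0cb0bb2fa0cb0bb2fa0cb0bb18c03219C19A10A10A0cb2ba0bc0ba0ba0ba0ba0ba0ba0ba0ba";
"0ba0ba0au12a11a0ed08a08a08a08a0ba0ba0ba0ba0ba19A18a2fa0cb2fa0cb18b03218a18a19C0bd0ec25A25A0cb2ba";
"0bc08a0bb0ba0ba0ba0ba0ba0ba0ba0ba0ar25A1dA1dA1fB0321cA1cA20B02240A40A1fB0423fA3fA20B0321bC17a15b";
"0dc0fD10B1bA1bA4dB0321dA1dA4eB0220fC22B31a08b31a08b31a08b23b02231a1bA1bA4dB1bA4dB23c0421dA1dA4eB";
"0320fC08c22D1bA23b1bA0321dA21b1dA0220fC11d12e36a36a36a31c09c27a33A63a63a34A66A64A35f32a28b36d33A";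
"09c36a36a36a61a61a27b05262A32d33A33A09f13d00233A32a31b36a09d08c08a08a08a08a08a07l06c00212a10A23a";
"23a1bB02221a21a1dB03211d0fC06b12a10A23a23a1bB02221a21a1dB03211d0fC06b12a10A23a23a1bB02221a21a1dB";
"03211d0fC06b00205g11a12a0020ea08a08a08a08a0fA36a35b32a33A09d33A32a32a35c32a00236a36a65a66A65a28b";
"65a03236d36a62A60A33A32d62A60A33A32d27d13d36a32b65a28a13b28a13b28a28a65c13b02266C36c34A0135fa31e";
"09d08c36a35b09b08b31a32a08c0fA0ea0da3bA3bA1eB0223cA3cA3cA48A48A26b0723cA47A47A24b0520521fF0da19E";
"16A16A3bA3bA1eB0323cA3cA3cA48A48A26b0823cA47A47A24b0620621fF19C0dd1aa1eB1aa02218a18a18a48A48A26b";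
"07224a24a47B18a0420121fF0ee1eA1eA26b0320da3bA3bA4aB02224a3cA3cA49B0320520da19E16A16A3bA3bA4aB032";
"24a3cA3cA49B04206219C0dd1aa4aB1aa02224a18a49B18a0320520ee24a24a24a20E10D12c12a0fB0da3bA3bA1eB022";
"3cA3cA1fB0320da19E16A16A3bA3bA1eB0323cA3cA1fB04219C0dd1aa1eB1aa02218a1fB18a0320ee10B22A09b31a08c";
"31a08b21b00222A21a11e01310A1eA1eA26b03220A20A24b02210C0fA0fA12d31a31a21c08b21a11e08a08a08a08a08a";
"08a07r06d0ea0da11c0da12b22A23a23a23a53A1eB53A06223a23a54C23a23a54C23a23a54C4aA1ab4aA0b249A18b23a";
"23a54C09249A23a23a54C0820a220F25F0da11d26a26a1eB02224a24a4aA1ab4aA06249A18b49A05220D0320da12e1eA";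
"1ab1eA03222A23a23a23a23a23a18a18a47C54D18a18a47C02248A53B48A03218a18a18a1fF25E0da11d24a24a47B18a";
"04201248A48A26b03218a18a18a1fF0da12d0da10E0fA23a11b22A22A11c02254A4aA4aA3bB03249A49A3cB02220D19B";
"54A0121eA53B1eA0323cA47A54B47A05205248A53B48A0723cA3cA3cA1fF3bA3bA1eB02219C10D25C22A22A11c22A22A";
"23a11d01324a24a24a4aA4aA3bB03224a49A49A3cB02205220F19B1eA1eA26b0323cA47A47A24b05248A48A26b0623cA";
"1fD0323bA3bA1eB02219C10D12c0ee00211a11a0ec0da11b04208a08a08a08a0ea08b36a35b32a33A33A09e33A32a32a";
"35c32a00265a65a28a13b28a13b28a28a65c13b02266C32a32a36f36a36a60A36a65a65a66A65a28b65a03236e62A36a";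
"27b13e5fa31e33A33A32e34C09d0ba0ba0ba0ba0ba0ba0ba0ba0ba0ba0ba0ba0ba0ba0ao0eb46A46A1cB03245A45A1dB";
"0221eC0fB0b026b0710b026b0710b00b026c07126a1dA1dA45B03204226a26a45C26a26a45C1dB0020c246A46A46A1cB";
"46A1cB0b20130da0eb0fD1eE4aA0b00b024c0610b024b0610b024b0610fA0b116A33A09b0dc0eb20G1dA48A48A26b062";
"0521dA1dA48C1dA1dA48C26b0720c247A47A47A24b47A24b0b20830e00e01dC0310e01dB0310e01dB0311fF1cA1cA4aC";
"0c00c00e01cB0410e01cB0410e00e01cC04116A33A09b0dc0eb20H0da0eb0fD16A33A09b0dc0eb10F12c08d09a08b12a";
"46A46A1cB03245A45A1dB0221eD0fB0ba0ba0ba0ba0ba0ba0ba0ba0ba0ba0ba0ba0ba0ba0ao0eb4aA24a0ea0ea24b022";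
"0ea0ea24c0fA0ea16A0eb35a09b16A08c0dd0ea20H0fA20B0fA20B24b0020ea0830ea0ea26a1eB26a05203226a26a26a";
"46A46A1cB03226a26a45C26a26a45C1dB0221eF0ea0720ea0b30da0eb0ea0fE26a0ea26b0ea26b46A46A1cB0320ea26b";
"45A45A1dB0220621eF0fB0320ea0ea12f0ba0ba0ba0ba0ba0ba0ba0ba0ba0ba0ba0ba0ba0ba0ao0eb1dA48A48A26b032";
"0721dA1dA48C1dA1dA48C26b0321dA1dA48C1dA1dA48C26b0320d20ea0e347A47A24b02247A47A24b0220ea0e31dA0d0";
"0d01dC0611021dA0d01dB0611021dA0d01dB0611021fF0ea0ea0ea0ea12g1cA1cA4aC0ea12b0ea12b0c21cA0a01cB041";
"0d21cA0a01cB0410d21cA0a00a01cC0410d20ea16A0eb35a09b16A08c0dd0ea20H0da0eb0ea0fE0ea16A0eb35a09b16A";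
"08c0dd0ea10F0ea0ea0ea0ea0ea0ea0dc0ea22A09b31a08c31a08b21b0020320ea0ea22C11h08a36a31b36a03231a35b";
"09c35a09b08c08a08a08a08a07p00210A41A41A41A21d42A42A42A23d1cD11b0ea1fA1fA1fA1fA11a0811dF43A1fA1fA";
"1fA11a0811dF02220A20A41A41A41A21d42A42A42A23d1cD05220A20A20A41A41A41A21d20A20A23a23a23a42F1cF092";
"11b10D0ea23a3fA3fA3fA20D0a240A40A40A0b21fB40A04323a23a23a1bF3fA3fA3fA20D40A40A40A1fD23a1bD23a072";
"05210C21a21a21a1dD21a21a43C21a21a21a1dE21a21a21a1dD08210C11c0fD18a1aa3cA3bA19C0ed3cA3cA3cA3cA1fE";
"3bA3bA19D0eb1fA1fA1fA1fA18e1aa1aa19A0ee0820ea1dA45A21a21a21a1dD23a23a23a1bD0fE11c0ea18a18a3cA3cA";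
"3bA19D0ed1fB1dA46A46A46A41A41A41A21d46A46A23a23a23a42F1cF45A21a21a21a1dD23a23a23a1bD0fF18a18a1aa";
"3cA3cA19C0ee1fB04311c1eE1fA11a23a21a11c23a23a23a23a1bE21a21a11d1dD0fC18a18a4aA4aA4aA4aA1ae3cA3cA";
"4aA4aA4aA4aA3bE19D0ee18a1aa3cA3bA19C0ed49C41A41A41A21d42A42A42A23d1cC06249A49A41A41A41A21d42A42A";
"42A23d1cC41A41A41A21d42A42A42A23d1cC20F11b1fA11a11a23a21a11c23a23a23a23a1bE21a21a11d1dE0fD10D18a";
"18a3cA3cA3bA19D0ed18a3bA19B0ec1fC18a1aa3cA3bA19C0ed0ea46A46A46A0ea11b0ea11b1cF45A45A45A0ea11b1dE";
"0ea46A46A46A23a23a3fF45A45A45A40D23a23a23a1bF21a21a11e0ea11b0fF1eC18a18a1aa3cA3cA19C0ee1aa3cA19B";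
"0ec1fC0031cA1cA11c3cA3cA4aA4aA4aA4aA3bE19D0eb3cA3bA19C0eb49C0421cA1cA11c18a18a4aA4aA4aA4aA1ae19A";
"0ee18a1aa19A0ed49C0420821cA1cA11c1cA1cA11c1cA1cA11c20E1fA1fA1fA11a1dE3cA3cA3bA3bA3bA3bA3fA3fA4aG";
"19D3cA3bA19C49C23a0620eb18a18a1aa1aa1aa1aa3fA3fA4aG23a0a219A0ee18a1aa19A0ed49C0b223a23a3fC23a23a";
"3fC23a23a3fC20E21a21a11d1fA1fA0e21fA1fA0e21fA1fA0e211a11a11a40G23a23a21a21a11e23a21a21a11d11a1bF";
"11a0fE10C08a08a08a08a08a08a36a35b09b08b32a31a32a08d18a1aa3cA3bA19C0ed1fA18b1fA0021aa1aa3cA3cA3cA";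
"1fC0523bA3bA19D0ee1fA1fA18c3cA3cA3bA19D1fB0ec1cA1cA46B0221dA1dA45B03221a3fA46B3fA02240A45B40A032";
"1bC0fE18a18a1fC1aa3cA3cA1fC19B0ed0231eD1cA4aA1ab4aA03206249A18b49A0221cA1cA1cA20F1cA4aA4aA3bB032";
"06249A49A3cB0221cA1cA1cA20F19B0ec1dA1dA1fB03221a3fA3fA4aC1ab3fA3fA4aC03249A18b49A0223fA3fA3fA20F";
"3cA3cA3fA3fA4aC3fA3fA4aC3bB01219D3cA3bA19C49C3fA3fA3fA20E0ec40A1fB40A0321bC0fE10C35a09b08b35a09b";
"08b27c62A33A35a09c34A5fa35a35a09e62A60A31d36a27b09b35a09b32f08b33A09b35a33A09c33A33A32a36a35b09e";
"08d00232a65a28b65a05266A36d32a32a32a35d09c08b32a36b35a35a32c35a03233A33A09e33A35a09c33A09b08d022";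
"13d08a08a08a08a08a08a08a07r08a08a08a08a08a08a36a35b09b08b32a31a32a08d18a1aa3cA3bA19C0ed1fA18b1fA";
"0021aa1aa3cA3cA3cA1fC0523bA3bA19D0ee18a18a1fC1cA1cA46B1aa0520421dA1dA45B05221a1aa1aa46C3fB1aa1aa";
"46C01240A45B40A0521bC0fE3cA3cA1fC3bA1cA1cA46B04206219C1dA1dA45B03221a3cA3cA1fC3bA3fA46B3fA042062";
"19C40A45B40A0321bC0fE0ed1eD1cA4aA1ab4aA03206249A18b49A0221cA1cA1cA20F1cA4aA4aA3bB03206249A49A3cB";
"0221cA1cA1cA20F19B0ec1dA1dA1fB03221a18a49B18a0323fA3fA4aC1ab3fA3fA4aC03240A40A1fC1bC3cA3cA49B032";
"3bA3bA3bA3fA3fA40A40A1fC1bD4aE19C0ed3fA3fA1fA40B1fA0021bD3fA40A1bC20D0fE10C33A36a27b5fa62A60A31d";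
"34B65a28b65a03266A36c13d36a32d32a32a35c32a00233A09d33A32a36a35b09d08c08a08a08a08a08a08a08a07r18a";
"1aa3cA3bA19C0ed1fA1fA1fA1fA18e1aa1aa3cA3cA3cA3cA1fE3bA3bA19D0ee45A45A45A1dD45A45A45A1dD0a218a18a";
"3cA3cA3bA19D0ed1fB46A46A46A41A41A41A21d46A46A23a23a23a42F1cF46A41A41A41A21d42A42A42A23d1cD46A032";
"09218a18a1aa3cA3cA19C0ee1fB0531eE18a1aa3cA3bA19C0ed1fA1fA1fA1fA18e1aa1aa3cA3cA3cA3cA1fE3bA3bA19D";
"0ee21a21a21a1dD21a21a21a1dD0921eD18a1aa3cA3bA19C0ed1fA1fA1fA1fA18e1aa1aa3cA3cA3cA3cA1fE3bA3bA19D";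
"0ee18a18a3cA3cA3bA19D0ed46A46A46A23a23a3fF46A46A46A23a23a3fF0d218a18a1aa3cA3cA19C0ee0a31fB45A45A";
"45A40D45A45A45A40D0c223a23a0c223a23a0c223a23a0c21bF1eD0fD41A41A42A42A42A42A23e1cD41A42A1cC21c4aA";
"4aA4aA1ad49A49A49A18d0e00e00e00e010010010010021a21a10221a21a10221a21a10241H42A42A0f242A42A0f242A";
"42A0f223d1cG20D41A41A41A21d42A42A42A23d1cC05341A41A41A21d42A42A42A23d1cC41A41A41A21d42A42A42A23d";
"1cC4aA4aA4aA3bD49A49A49A3cD0e00e00e00e041A41A41A21d41A41A41A21d01242A42A42A0e223b42A0c31cG20D41A";
"41A41A21d42A42A42A23d1cC05319B0ed1fA1fA1fA1dD1fA1fA1fA1dD0820a00a021a21a0a221a21a0a221a21a0a21dF";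
"23a3fA3fA4aC49A3fA3fA3fA20F0621aa1aa1aa1aa23a23a3fC23a23a3fC4aG49A49A23a23a3fC23a23a3fC23a23a3fC";
"20G20A20A20A23a23a3fF18d1aa1aa1aa3fA3fA4aF49A49A49A18d3fA3fA3fA20F23a0420c223a3fA3fA4aC3fA3fA4aC";
"49A49A49A49A3cE3fA3fA3fA20G0624aA4aA4aA23a23a3fF49A23a23a3fC23a23a3fC23a23a3fC20F4aA4aA4aA23a23a";
"3fF49A49A23a23a3fC23a23a3fC23a23a3fC20G4aA4aA49A49A20E4aA4aA49A49A20E4aA4aA49A49A20E23a23a3fF3cD";
"0e24aA4aA4aA23a23a3fF49A23a23a3fC23a23a3fC23a23a3fC20F4aA4aA4aA23a23a3fF49A23a23a3fC23a23a3fC23a";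
"23a3fC20F0e23bC19B0ec40A40A40A0b21fB40A07323a23a0a223a23a0a223a23a0a21bF0fE10C02308a08a08a08a08a";
"08a08a08a08a08a08a07l11c0de12a12a0dc0ea12b0320020ea0da0ea0ea25A37A37A1bB04238A38A38A42A42A23b052";
"38A41A41A21b0420721cF16C25A37A37A1bB04238A38A38A26a26a4eC38A26a26a4eC41B0820324dA4dA42B02226a26a";
"26a22F1cE16C11d17a17a1bB02223a23a15a15a15a42A42A23b03215a41A41A21b0220721cF25A15a15a42A4dB42A032";
"41A4eB41A0221cD06226a03226a26a26a22E11f0de23a23a37A37A44B02221a38A38A43B03207216C21a21a21a1dE37A";
"37A44B02221a38A38A43B03207216C21a21a21a1dE21a43A15b43A02207244A17b44A03221a21a21a1dF0dd23a23a1bB";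
"02225A37A37A44B0224eA38A38A43B03208216C4eA4eA4eA1dE26a0324dA4dA1bB04226a26a26a22F26a26a4eC43A15b";
"43A04209244A17b44A05226a26a4eC26a26a4eC26a26a4eC1dF4dA4dA1bB06226a26a26a22F0dc11g0fE0da10C12d0ea";
"0da12c00206e0ba0ba0ba0ba1dA1dA21b0221bA1bA23b0320fC11b24a0fA12c2ba2ba24c0fA12c0bc11a10B01310A24a";
"25A2ba0bb24b2ba25A0cb0bc00212d24a12b24a12b24a25A12c07224a25A24a0cb24a0cb25C2ba24b2ba00212e0bd21a";
"21a21a21a17a15a15a43B03217a17a44B02219A38A38A43B03237A37A44B02216C38A38A43B03237A37A44B02216C38A";
"38A43B03237A37A44B02216C0dh0421dE19A0ed1bA1bA23b03224a12b24a24a25A12d07224a24a25A24a0cb24a0cb25C";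
"2ba24b2ba00212f0bc17a15a41A41A21b06206242A42A23b08215a15a15a1cF17a17a1bB03219A38A41A41A21b062062";
"42A42A23b08238A38A38A1cF37A37A1bB03216C38A41A41A21b06206242A42A23b08238A38A38A1cF37A37A1bB03216C";
"38A41A41A21b06206242A42A23b08238A38A38A1cF37A37A1bB03216C0dh19A0ed0fE17a0db11d10A10A0cb2ba0bc30a";
"2fb0cb0bb2ca30b2ca2ca2ca2fc0022dA0cd2dA2ca30a2fb0cd0bc2fa0cb0bb2dA57a5aA58A2bd2eB29a2cd2fa0cc2fa";
"0cb0bc2ca2aa2aa5dc30c2ca5da5da2ac5eA5da30e0222ca2ca2ca2fc0020cc0bb2ca30b2ca2ca2ca2fc0020cc0bb14e";
"00230a2fa0cc0bb0ba0ba0ba0ba0ba0ba0ar0da11a12a00206d05d0020da12a11a0dc06c12a0ea16A17a11a0dd16A17a";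
"17a11a0de3bA1eB3bA06216A17a17a3cC17a17a3cC17a17a3cC48A26b48A07247A24b47A06217a17a3cC0b21fF11a0dd";
"19E0fA16A16A17a17a17a3bA1eB3bA0823cA3cA3cA48A48A53B0723cA3cA47C3cA3cA47C54B0621fF17a07219F0dd25B";
"12d1aa1eB1aa02218a18a18a48A26b48A03218a18a47C24b18a18a47C0221fF0fA18a18a18a18a18a54A54A48A48A53B";
"01225D54A53A25C47E1fE12d11a0ee16A17a17a17a3bA4aB3bA06217a17a3cC49B17a17a3cC07219F12a11a0de26a26a";
"1eC0fA54A53A53A1eC25C12d24a26a26a1eC0fA53A53A25C1eB12e0531aa4aB1aa02224a24a49C24a24a49C18b02226a";
"26a1eC0fA18a18a18a54A54A53A53A1eC25D49E12e12a11a0ef24a24a1eA26b1eA0120fA54A54A1eA1eA53B01225D12f";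
"24a26a0fA54A53A25C12e11a20E11a10D06d0020ba0ba2ba0cb0ca0ca2fa2fa2bb0cc2fa2fa2cc0cb0020be0ba19A2fa";
"0cb19A0bc18b2fa0cb19A0bc00211a11a12c11a11a11a11a0eh2ca2ba2ca0bd11a11a11a11a25A11b11a11a11a25A11b";
"20A20A20A20A20A42C1cG11a1cB20B11a1cB0020a20e01fB0410e01fB0410e00e01fC04111a43A15b43A06243A15b43A";
"0620e311a1fA44A17b44A0620421fA1fA44C17b1fA1fA44C0720e31dF10E11a11a25A11b10A11a11a15c11a15b11a042";
"15a42A1cH10A1cB15b10A1cB02209311a11a11a17b40A1fB40A0320423fA20B3fA02211a17b11a17b17a1bF17a17a40C";
"1fB17a17a40C0323fA20B3fA02217a17a17a1bF0a210D11a03240A1fB40A0323fA20B3fA0221bC10B0fG08a08a08a08a";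
"08a08a08a08a08a09a08b08a08a08a08a08a08a08a07r11b0df20A17a44B17a02215a43B15a0320dc1dB10C17a17a1bB";
"02215a15a1cB0320dc0fC12d0ba0ca11a25A11b0cb11a11a11a25A11b0cb20A20A20A20A20A42C1cG20A1cB20A0320c2";
"1001fB0411001fB0411001001fC04143A15b43A06243A15b43A0621021fA44A17b44A0620421fA1fA44C17b1fA1fA44C";
"0721021dF10E11a25A11b0cb10A0d10f015b0610f015b0610f00f015c06142A1cH11a11a17a40A1fB40A03204217a17a";
"40C1fB17a17a40C0321023fA20B3fA0223fA20B3fA02210211011017c09111017b09111017b0911bF10D40A1fB40A032";
"3fA20B3fA0221bC10B0fG08a08a08a08a08a08a08a11a09a08b11b11a09b08b08a08a08a08a08a08a08a07r0dc20A17a";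
"44B17a02215a43B15a0320dc1dB10C17a17a1bB02215a15a1cB0320dc0fC12d0ca11a30a30a30a2bc0222dA5ba5eA5cA";
"2fd2eB2ca2ab30d30a29a29a59c2cc30a59a59a29c5aA2cd00214c2dA0cd11a25A11b11a11a11a25A11b0e00e020C031";
"0e020B0310e020B0310da0e120A20A42C1cH0e01fB0410e01fB0410e00e01fC0411fA17a17a44B0220621fA1fA44C17b";
"1fA1fA44C01210215a15a43B03215a43B15a03210208a08a08a08a08a09a08b08a08a08a08a08a08a08a08a07o11b0dd";
"1dE10E17a40A1fB40A0320623fA20B3fA02217a17a17a1bF10B11a11a20A3fB20A03217a17a40C1fB17a17a40C01210E";
"17a17a17a1bE0b211a25A11b10A0d10f015b0310f015b0310f00f015c03142A1cH08a08a08a08a08a09a08b08a08a08a";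
"08a08a08a08a08a07o11b0dd40A1fB40A0323fA20B3fA0220da1bD10B0fF2dA2dA2ca2bb30a0cf20A17a44B17a02215a";
"43B15a0320dc1dB10C17a17a1bB02215a15a1cB0320dc0fC2dA2ca2bb30a0cd2ca2bb12e0bf0ba0ba0ba0ba0ba0ba0ao";
"11a0420da0da12c11a0db0120ba0ba0ba0ba0fA0eb2fa0cb2fa0cb18c0fA0ec0bc0da17a17a15a15a15a1cC0520dd17a";
"15a0dc1bC0fB12c0da10B01318a19A2fa0cb19A0bc18b2fa0cb19A0bc0021bA1bA23b0321dA1dA21b0220fC1bA4dB1bA";
"0321dA4eB1dA0220fC22B25A25A12d4eA4eA1dB0324dA4dA1bB02222C0fB11d0ee15a15a15a42A42A23b03215a41A41A";
"21b0220521cF25A15a15a15a42A4dB42A03215a41A4eB41A0220521cF22B15a15a15a42A4dB42A03215a41A4eB41A022";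
"0521cF22B11e1bA17b1bA04221a43A15b43A06205244A17b44A08221a21a21a1dF23a23a1bB02225A4eA43A15b43A062";
"05244A17b44A0824eA4eA4eA1dF4dA4dA1bB02222C4eA43A15b43A06205244A17b44A0824eA4eA4eA1dF4dA4dA1bB022";
"22C11f0fD25A12c11a0dc0da10B03310A30a0cb2fa0cb0bc2ca2bb0bb30a30a30a2bc02230a2dA5ba5eA5cA2fd2eB2aa";
"30d5aA29a59b29a02214d59a2cd2dA0cd2dA2ca2bb30a0cd0bc2ba2ca0cc0bb0ba0ba0ba0ba0ba0ba0ar06d0ba0ba0ba";
"0ba0ca2bb30a2ba2cb2dA10A0ce2dA2dA5aA59a29b59a05230a2cd30a0ce2dA2ca0cc5eA5cA2dA30d2eA5ba2fd0cb5eA";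
"5cA2dA30d2eA5ba2fd0cb2ac0ca0ca2cd03229a14d30a30a2bc0cb00210A0cb0be10A12a19A2fa0cb0bc19A1cA38B1cA";
"0221bA37B1bA0320fC16B0ee0ba0ba0ba0ba0ba0ba0ba0ao0ea1cA1cA15b02208a08a08a08a61a61a62A61a61a27b052";
"36a32f36a36a36a31d09c08b09a28a64A66A63a63a35e34B33A36d09b31c08b31a09b09a08c00231a08b13d36a32a31b";
"33A09d33A36a32b36a36a31c36a02209d08c00232a31b08b35a09b08b1bA1bA1bA1bA39A35a09b08c39A35a09b08c3ab";
"0020621bA1bA39C3aa17g1bA1bA1bA3aa35a35a3ac09c08b08a17f08a08a08a08a08a07o0fD08a08a08a08a15a36a09b";
"08c31a09b36a36a31a32b33A09e33A33A32a32a27a27a61c32b62A61a61a61a27c03232c64A66A63a35d34B28a32b13e";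
"33A36e36a36a31c36a02209e08d31a32b08b35a09b08b0ea16A37A37A1cA1cA38B00216D37A38A16C1bD0fC36a09b35a";
"09b08c35a09b35a09b08c15b01215a35a35a15c09c08b08a08a08a08a08a08a07r15a0de12a0eb0ea0ea11c00226a45A";
"45A1dB04246A46A46A41A4eB41A04246A42A4dB42A0520721cF1eC22B45A45A40B0224dA46A46A3fB0320621eC4dA4dA";
"4dA1bE4eA4eA1dB03222C0fC0f01ab0910f01ab0910f00f01ac09145A45A45A1dB45A1dB0d20331aa1aa46C1aa1aa46C";
"1221aa1aa46C1aa1aa46C1221aa1aa46C1aa1aa46C12241A4eB41A0221aa1aa46C1aa1aa46C42A4dB42A0320831cF22B";
"1eF1001ab0b11001ab0b11001001ac0b11aa1aa46C1aa1aa46C4dA46A3fB46A3fB46A3fB1ab46A3fB1ab0e20b3062013";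
"45A45A45A40B45A40B1020034dA4dA4dA1bF1eE4eA4eA1dB03222C0fC1fA48A1fB1fA18b48A1fB18b0720331fA48A1fB";
"1fA18b48A1fB18b0720331dA4eB1dA0221bA4dB1bA0320fC22B08341A42A1cC4aA4aA1ab0a208249A49A18b0a241A42A";
"1cC41A42A1cC41A42A1cC20F4eA4eA41B01242A42A1cD4aA4aA1ab0a208249A49A18b0a24eA4eA41B01242A42A1cD4eA";
"4eA41B01242A42A1cD4eA4eA41B01242A42A1cD20F4dC4aA41A42A1cC0724aA1ab41A42A1cC0820b249A49A18b0a241A";
"42A1cC41A42A1cC41A42A1cC20F1aa1aa1aa4eA4eA41B01242A42A1cD4eA4eA41B01242A42A1cD4aF49A49A18b0a24eA";
"4eA41B01242A42A1cD4eA4eA41B01242A42A1cD4eA4eA41B01242A42A1cD20F4dC0c222B1fA48A1fB1fA1dB48A1fB1dB";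
"0920031aa1aa4aB4dA4dA3fC0721021aa4dA3fA1aa4aB0620520a200249A49A49A18b49A18b1020c34dA1001003fC041";
"0724dA1003fB0410724dA1003fB04107220F1fA48A1fB1fA40B48A1fB40B0c20034dA4dA4dA1bF4eA4eA1dB03222C0fD";
"10E0ec18a1fB18a0321aa1eB1aa0220ec4aA4aA1ab03249A49A18b02220C0eb1dA0fC10C26a45A45A1dB02246A46A46A";
"41A41A21b09246A42A42A23b0920521cF1eC1dA1dA21b05245A45A40B02223a46A46A3fB0320421eC23a23a23a1bE0fD";
"0f01ab0710f01ab0710f00f01ac0711aa1aa46C1aa1aa46C1221aa1aa46C1aa1aa46C1221aa1aa46C1aa1aa46C12241A";
"41A21b0c21aa1aa46C1aa1aa46C42A42A23b0c20331cF45A45A45A1dB45A1dB0f20031dA1dA21b0a21aa1aa46C1aa1aa";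
"46C23a46A3fB46A3fB46A3fB1ab46A3fB1ab0e209301201345A45A45A40B45A40B10200323a23a23a1bF0fE1eE1fA48A";
"1fB1fA18b48A1fB18b0c20531dA1dA21b07248A10010018c08110018b08110018b0811bA0c11bA23b0d10b21fF0fD140";
"1ab0c11401ab0c11401401ac0c114014041A41A21b0e242A42A23b0f21cE07114041A41A21b0e242A42A23b0f21cD071";
"1304aG49A49A49A18b49A18b0f208311011011011041A41A21b0c242A05142A23b0610d21cG10041A41A21b0b242A42A";
"23b0c21cD04111011011011041A41A21b0c242A05142A23b0610d21cG20F1fA48A1fB1fA1dB48A1fB1dB0b20031dA1dA";
"21b0721501ab0e11501ab0e11501501ac0e123a1401403fC07108223a1403fB0710821404aG49A49A49A18b49A18b102";
"0a323a1001003fC04105223a1003fB04105223a1003fB04105220F40A40A1fB05248A1fB48A1fB40B0020d223a23a23a";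
"1bF0fE10E0ec11d18a18a1aa1aa1aa45A45A1dB0421aa1aa46C1aa1aa46C1aa1aa46C41A4eB41A0221aa46A42A4dB42A";
"0320920a21cF22B1eF0ed18a18a1aa1aa1aa45A45A40B0221aa4dA46A46A3fB0320820a21eF4dA4dA4dA1bE0ed4eA4eA";
"1dB03222C0fC20A20A41A4eB41A02242A4dB42A0321cD03222B1dA1fB1dA0324dA3fA20B3fA05204240A1fB40A0724dA";
"4dA4dA1bF4eA4eA1dB03222C0fD10C18a18a1aa1aa1aa45A45A1dB0221aa1aa46C1aa1aa46C1aa1aa46C41A41A21b0a2";
"1aa46A42A42A23b0920520821cF1eF1dA1dA21b0621aa1aa1aa45A45A40B0221aa23a46A46A3fB0320420821eF23a23a";
"23a1bE0fD0ed20A20A41A41A21b05242A42A23b0621cD0121dA1fB1dA0321dA1dA21b04223a3fA20B3fA03202240A1fB";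
"40A05223a23a23a1bF0fE10C11c11a0eb04226a4dA4dA1bB0224eA4eA1dB03222C0fB1dA1dA21b0221bA1bA23b0320fC";
"11c0320fA1fB47A1fB0fB0fA1fB18b47A1fB18b0fB0720030c01ab0410c01ab0410c00c01ac0411aa1cA1cA46B022062";
"1aa1aa46C1aa1aa46C1cB0120d245A45A45A1dB45A1dB0c200311a0fD1eE0ec1cA4aA4aA1ab0320621cA1cA4aC1cA1cA";
"4aC1ab0320d249A49A49A18b49A18b0c20330d00d01cC0610d01cB0610d01cB06120F0eb1dA1dA47A1fC0eb0621dA1dA";
"1fB0eb03203211a0fD4aA4aA1ab03249A49A18b0220fA20D0eb10D12e06d00212a11a12a12a11a11a11a17a17a11a11a";
"11a4dA4dA4eA4eA4eA4eA44A17b44A0524eA43A15b43A0420b21dG22D4dA4dA4eA4eA4eA4eA44A17b44A0524eA43A15b";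
"43A0420d21dG22D23a23a21a21a21a21a44A17b44A05221a43A15b43A0420d21dG11f19A4dA4dA4eA4eA4eA4eA44A44A";
"37B0524eA1aa43A43A38B0420720f21dG22D23a23a21a21a21a21a44A44A37B05221a1aa43A43A38B0420720f21dG11e";
"1aa1aa1aa16E0di0eg11a11a11a10E4dA4eA22C10A23a21a11e1bD12a17a15a41A4eB41A02207242A4dB42A03215a15a";
"15a1cF22B15a41A4eB41A02209242A4dB42A03215a15a15a1cF22B10A15a41A41A21b02242A42A23b03215a1cD07211e";
"17a17a1bB04219A1aa4dA4dA42B02238A4eA4eA41B0320a222C10A23a23a42B02238A21a21a41B0320a211e38A38A38A";
"1cE37A37A1bB0521aa16D0120df0ec0fD0da11a06d12a11a0ec0ea06c00205d002"].

Definition tree4 : tree := Eval vm_compute in decode [::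
"11a0da0da10B0da0da08a08a22A35a09b08b22A22A09b31a08c08a08a08a08a08a31a08b35a09b08b08a08a07p0fB10C";
"22A0da53A53A53A1eD54A54A54A20D25C10C11e0da24a24a24a20D26a26a26a1eD10D12c06e10A0da11a1eA1eA26b032";
"20A20A24b02210C08a08a08a31a22A09b08c22A35a09b08b35a09b08b08a08a08a08a35a09b08b31a08b08a08a08a07q";
"0fB0da1eA53B1eA03220A54B20A02210C25B22A11e12c06e25A4dA4dA4dA1bD4eA4eA4eA1dD22C0fB0ea0ba0ba0ba2ba";
"0bb2fa0cb0bb0ba0ba0ba0ba2fa0cb0bb25B2fa0cb0bb25A25A0cb2ba0bc0ba0ba0ba0aq0fB10B12e21a21a21a1dD23a";
"23a23a1bD0fC11c12a0ea0fA06e1bA1bA23b0321dA1dA21b0220ea0fD4eA4eA1dB0324dA4dA1bB02222C0ea0fC25A0ba";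
"0ba2fa0cb0bb2ba0bb0ba0ba0ba0ba0ba2ba0bb2fa0cb0bb0ba0ba0an0ba0ba2fa0cb0bb2ba0bb0ba0ba0ba0ba2ba0ca";
"0ca0bd2fa0cb0bb0ba0ba0am25C10B0ea12e11c0ea0fB0ea12a06e05e05a00211a0da10A0da08a08a22A35a09b08b22A";
"22A09b31a08c08a08a08a08a08a31a08b35a09b08b08a08a07p0fB10B20A20A54B0221eA1eA53B03210C25B22A20A24b";
"20A0221eA26b1eA03210C12d11d06e10A0da11a1eA26b1eA03220A24b20A02210C08a08a31a08b35a09b08b35a09b08b";
"08a08a08a08a35a09b08b31a08b08a08a08a07o08a08a31a09a09a08d35a09b08b08a08a08a08a35a09b08b31a08b08a";
"08a08a07n22C0fB0da54A54A20B03253A53A1eB02225C10B22A11e12c06e25A4dA4dA1bB0224eA4eA1dB03222C0fB0ea";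
"0ba0ba0ba2ba0bb2fa0cb0bb0ba0ba0ba0ba0ba2fa0cb0bb2fa0cb0bb10B10A25A25A0cb2ba0bc10A0ba0ba0ba0at12e";
"1dA1dA21b0221bA1bA23b0320fC11c12a0ea0fA06e1bA1bA23b0321dA1dA21b0220fC1bA4dB1bA0321dA4eB1dA0220fC";
"22B25A0ba0ba2fa0cb0bb2ba0bb0ba0ba0ba0ba0ba10A2ba25A0cb0bc25A10A2fa0cb0bb10B25A0ba0ba0ba0as0ea12e";
"11c0fA0ea12a06e05e05a00205a05a002003"].

Definition tree5 : tree := Eval vm_compute in decode [::
"05a06a06a05c00205a06a05b00206a05b05a002003"].

End Trees.
Import Trees.

(** * Finite checks on P, and the theorem *)

Local Open Scope ring_scope.

Definition nbt := Eval vm_compute in foldr (fun x t => put t x.1 x.2) Leaf table.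
Definition nbg := look nbt.
Definition inner := Eval vm_compute in map fst table.

Fixpoint allT (f : positive -> seq positive -> bool) t := match t with Leaf => true
  | Node a s b => [&& (if s is [::] then true else f xH s), allT (fun p => f (xO p)) a
                    & allT (fun p => f (xI p)) b] end.
(** Keys outside the trie yield the empty list, so one pass over the trie settles a question about
    all of [positive]. *)
Lemma look_all f t v : allT f t -> look t v = [::] \/ f v (look t v).
Proof.
elim: t f v => [|a IHa s b IHb] f [v|v|] //=; try by left.
- by case/and3P => _ _ h; exact: (IHb _ v h).
- by case/and3P => _ h _; exact: (IHa _ v h).
- by case/and3P => h _ _; case: s h; [left|right].
Qed.

Definition row_ok v s := [&& ~~ memp v s, all (vertexb nbg) s, memp v inner & ~~ pole v].
Lemma rows_ok : allT row_ok nbt. Proof. by vm_compute. Qed.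
Lemma rowP v y : In y (nbg v) -> row_ok v (nbg v).
Proof. by move=> hy; case: (look_all v rows_ok) => // e; move: hy; rewrite /nbg e. Qed.
Lemma nb_irr v : ~ In v (nbg v).
Proof. by move=> h; case/and4P: (rowP h) => /mempP. Qed.
Lemma nb_vertex v y : In y (nbg v) -> vertexb nbg y.
Proof. by move=> h; case/and4P: (rowP h) => _ /allIn H _ _; exact: H. Qed.
Lemma inner_vertex v : vertexb nbg v -> pole v = false -> In v inner.
Proof.
rewrite /vertexb => + pv; rewrite pv /=; case E: (nbg v) => [//|y s] _.
have : In y (nbg v) by rewrite E; left.
by move/rowP => /and4P[_ _ /mempP].
Qed.
Lemma nb_pole v : pole v -> nbg v = [::].
Proof. by case/poleP => ->. Qed.
Lemma inner_ok v : In v inner -> vertexb nbg v /\ pole v = false.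
Proof.
have : all (fun v => vertexb nbg v && ~~ pole v) inner by vm_compute.
by move/allIn => H /H /andP[-> /negbTE].
Qed.
Lemma uniq_inner : pairwise (fun v w => ~~ peq v w) inner. Proof. by vm_compute. Qed.
Lemma nb34 v y : In v [:: 3; 4]%positive -> In y [:: 1; 2]%positive -> In y (nbg v).
Proof. by move=> [<-|[<-|//]] [<-|[<-|//]]; apply/mempP. Qed.

Definition verts := [:: 1, 2 & inner]%positive.
Lemma vertsP v : vertexb nbg v -> In v verts.
Proof.
move=> vv; case E: (pole v); last by right; right; exact: inner_vertex.
by case: (poleP E) => ->; [left|right; left].
Qed.
Fixpoint assoc T (d : T) (s : seq (positive * T)) (v : positive) :=
  if s is (a, b) :: s' then if peq v a then b else assoc d s' v else d.
Definition mu v := assoc v (zip verts mirrored) v.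
Lemma mu_npole v : pole (mu v) = pole v.
Proof.
have : all (fun p => pole p.1 == pole p.2) (zip verts mirrored) by vm_compute.
rewrite /mu; elim: zip v => //= -[a b] s IH v /andP[/eqP e /IH h].
by case: peqP => [->|].
Qed.
Lemma mu_pole v : pole v -> mu v = v. Proof. by case/poleP => ->. Qed.
Lemma mu_vertex v : vertexb nbg v -> vertexb nbg (mu v).
Proof.
have : all (fun v => vertexb nbg (mu v)) verts by vm_compute.
by move/allIn => H /vertsP /H.
Qed.
(** [mu] is an involution on the vertices, which a computation shows. *)
Lemma mu_inj v w : vertexb nbg v -> vertexb nbg w -> mu v = mu w -> v = w.
Proof.
have : all (fun v => peq (mu (mu v)) v) verts by vm_compute.
by move/allIn => H /vertsP /H /peqP {2}<- /vertsP /H /peqP {2}<- ->.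
Qed.
Lemma mu_adj v w : vertexb nbg v -> vertexb nbg w -> padj nbg v w -> padj nbg (mu v) (mu w).
Proof.
have : all (fun v => all (fun y => padj nbg (mu v) (mu y)) (nbg v)) verts by vm_compute.
move/allIn => H vv vw /orP[] /mempP h; last rewrite padjC.
  by have /allIn := H _ (vertsP vv); apply.
by have /allIn := H _ (vertsP vw); apply.
Qed.
(** The case analysis of the five orders takes place in this computation. *)
Lemma trees_ok : [/\ refutes nbg tree1 [:: 2; 9; 8; 6; 7; 4]%positive,
  refutes nbg tree2 [:: 2; 8; 9; 6; 7; 4]%positive,
  refutes nbg tree3 [:: 2; 8; 6; 9; 7; 4]%positive &
  refutes nbg tree4 [:: 2; 6; 7; 4; 9; 8]%positive /\
  refutes nbg tree5 [:: 2; 6; 7; 4; 8; 9]%positive].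
Proof. by split; [| | |split]; vm_compute. Qed.

(** The octahedra are piled up along the vertical axis: 7, 3, 4 and 10, where they begin, meet and
    end, have odd heights, and the remaining two vertices of each are at the even height in between.
    Vertex 19 is the apex of the lowest triangle; 20 lies above everything, in the outer face, where
    there is no barycentre to use. *)
Definition coords : seq (positive * (Z * Z)) := (let z := Z.of_nat in
  [:: (1%positive, (Z.opp (z 12), z 0)); (2%positive, (z 12, z 0)); (19%positive, (z 0, z 1));
  (7%positive, (z 0, z 3)); (3%positive, (z 0, z 5)); (4%positive, (z 0, z 7));
  (10%positive, (z 0, z 9)); (20%positive, (z 1, z 11));
  (8%positive, (Z.opp (z 1), z 4)); (9%positive, (z 1, z 4));
  (5%positive, (Z.opp (z 1), z 6)); (6%positive, (z 1, z 6));
  (11%positive, (Z.opp (z 1), z 8)); (12%positive, (z 1, z 8))])%N.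
Definition co := assoc (Z0, Z0) coords.
Definition core := Eval vm_compute in map fst coords.
Definition stack := [seq e <- table | ~~ memp e.1 core].
(* Vertices, edges and the faces to be subdivided; [:: 1; 2; 19] is the lowest
   triangle, in which the later copies lie. *)
Definition core_objs : seq (seq positive) :=
  [seq [:: v] | v <- core] ++ flatten [seq [seq [:: v; y] | y <- nbg v] | v <- core] ++
  [seq e.2 | e <- stack & all (fun y => memp y core) e.2] ++ [:: [:: 1; 2; 19]%positive].
Definition objs := Eval vm_compute in odflt [::] (subdivides stack core_objs).
Lemma objsE : subdivides stack core_objs = Some objs. Proof. by vm_compute. Qed.
(** Here alone are objects separated by means of coordinates; the stacked vertices inherit their
    separation. *)
Lemma core_drawn : grid_drawn co core_objs. Proof. by vm_compute. Qed.

Definition mem_obj o := has (pel o).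
Lemma mem_objP o s : mem_obj o s -> In o s.
Proof. by elim: s => //= p s IH /orP[/pelP ->|/IH]; [left|right]. Qed.
Lemma objs1 v : vertexb nbg v -> In [:: v] objs.
Proof.
have : all (fun v => mem_obj [:: v] objs) verts by vm_compute.
by move/allIn => H /vertsP /H /mem_objP.
Qed.
Lemma objs2 v y : In y (nbg v) -> In [:: v; y] objs.
Proof.
have : all (fun v => all (fun y => mem_obj [:: v; y] objs) (nbg v)) inner by vm_compute.
move/allIn => H hy; have /and4P[_ _ /mempP hv _] := rowP hy.
by have /allIn /(_ _ hy) /mem_objP := H _ hv.
Qed.
Lemma objs3 : In [:: 1; 2; 19]%positive objs. Proof. by apply: mem_objP; vm_compute. Qed.

Section Inside.
Variables (R : realFieldType) (W : R) (pt : positive -> R * R).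
Definition inside v := [/\ - W <= (pt v).1, (pt v).1 <= W, 0 <= (pt v).2 &
  pole v = false -> `|(pt v).1| < W /\ 0 < (pt v).2].
(** A mean of three points stays in the region, and is strictly inside as soon as one corner is not
    a pole; the second hypothesis provides such a corner for each face. *)
Lemma inside_stack known es : placeable known es ->
  all (fun e => if e.2 is [:: x; y; z] then ~~ [&& pole x, pole y & pole z] else false) es ->
  (forall v x y z, In (v, [:: x; y; z]) es -> pt v = bary (pt x) (pt y) (pt z)) ->
  (forall v, In v known -> inside v) -> forall v, In v known \/ In v (map fst es) -> inside v.
Proof.
elim: es known => [|[v ys] es IH] known /=; first by move=> _ _ _ h v [/h|].
case/and3P => _ /allIn hys hpl /andP[hp hpe] hb hk w hw.
apply: (IH (v :: known)) => //; first by move=> *; apply: hb; right.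
  move=> u [<-{u hw w}|]; last exact: hk.
  case: ys hys hp hb => [|x [|y [|z []]]] // hys hp hb.
  have ix : inside x by apply/hk/mempP/hys; left.
  have iy : inside y by apply/hk/mempP/hys; right; left.
  have iz : inside z by apply/hk/mempP/hys; right; right; left.
  have [[xl xr x2 _] [yl yr y2 _] [zl zr z2 _]] := And3 ix iy iz.
  rewrite /inside (hb v x y z) /=; last by left.
  split; [lra|lra|lra|move=> _; rewrite ltr_norml].
  have strict u : inside u -> pole u = false -> [/\ - W < (pt u).1, (pt u).1 < W & 0 < (pt u).2].
    by case=> _ _ _ h /h[]; rewrite ltr_norml => /andP[].
  case px: (pole x) hp => hp; first case py: (pole y) hp => hp.
  - have [||? ? ?] := strict z; [by []|by case: (pole z) hp|].
    by split; [apply/andP; split|]; lra.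
  - by have [||? ? ?] := strict y; [by []|by []|split; [apply/andP; split|]; lra].
  - by have [||? ? ?] := strict x; [by []|by []|split; [apply/andP; split|]; lra].
by case: hw => [h|[->|h]]; [left; right|left; left|right].
Qed.
End Inside.

Lemma stack_placeable : placeable core stack. Proof. by vm_compute. Qed.

Lemma core_or_stack v : vertexb nbg v -> In v core \/ In v (map fst stack).
Proof.
have : all (fun v => memp v core || memp v (map fst stack)) verts by vm_compute.
move/allIn => H /vertsP /H /orP[] /mempP h; [left|right]; exact: h.
Qed.

(** The core is checked for the grid positions, while the positions given by [place] are known to
    agree with them on the core only. *)
Lemma drawn_ext (R : realFieldType) (pt pt' : positive -> R * R) os (K : seq positive) :
  (forall v, In v K -> pt' v = pt v) -> all (all (fun v => memp v K)) os ->
  drawn pt os -> drawn pt' os.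
Proof.
move=> e /allIn h [pw nd].
have em o : In o os -> map pt' o = map pt o.
  move/h/allIn; elim: o => //= v o IH H; congr cons; first by apply/e/mempP/H; left.
  by apply: IH => w hw; apply: H; right.
split.
  elim: os pw em {h nd} => //= o os IH [h1 h2] em; split;
    last by apply: IH => // p hp; apply: em; right.
  move=> p hp; have := h1 p hp; rewrite /osep !em //; [by right|by left].
move=> x y z hx; have := nd _ _ _ hx; have := em _ hx => -[-> -> ->] //.
Qed.

Definition width : Z := Z.of_nat 12.
Lemma inside_core (R : realFieldType) v : In v core -> inside (zr R width) (gpt R co) v.
Proof.
have : all (fun v => let p := co v in
  [&& Z.leb (Z.opp width) p.1, Z.leb p.1 width, Z.leb Z0 p.2
    & pole v || [&& Z.ltb (Z.opp width) p.1, Z.ltb p.1 width & Z.ltb Z0 p.2]]) core by vm_compute.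
move/allIn => H /H /and4P[/(zr_le R) h1 /(zr_le R) h2 /(zr_le R) h3 h4].
rewrite zrN in h1; split=> // pv; move: h4; rewrite pv ltr_norml.
by move=> /and3P[/(zr_lt R) h5 /(zr_lt R) -> /(zr_lt R) ->]; rewrite zrN in h5; rewrite h5.
Qed.

Lemma mu34 : mu 3 = 4%positive /\ mu 4 = 3%positive.
Proof. by split; vm_compute. Qed.

Lemma gluing_no_book N : (#|{: ctype inner}| < N)%N ->
  ~ admits_book_embedding (gluing inner N nb_irr) 3.
Proof.
move=> hN [lt [page bk]].
exact: (no_book nb_vertex inner_vertex bk trees_ok nb34 mu_vertex mu_pole mu_npole
    mu_inj mu_adj mu34 hN).
Qed.

Lemma inner_gt0 : (0 < size inner)%N. Proof. by vm_compute. Qed.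

Lemma gluing_planar (R : realType) N : (0 < N)%N -> planar R (gluing inner N nb_irr).
Proof.
move=> N0.
have [pt ptc pts] := place (gpt R co) stack_placeable.
have dr : drawn pt objs.
  apply: (subdivides_ok _ pts objsE).
  apply: (drawn_ext ptc); first by vm_compute.
  exact: grid_drawnP core_drawn.
have ins v : vertexb nbg v -> inside (zr R width) pt v.
  move=> vv; apply: (inside_stack stack_placeable _ pts).
  - by vm_compute.
  - by move=> w hw; have := inside_core R hw; rewrite /inside -(ptc _ hw).
  - exact: core_or_stack.
apply: (@planar_gluing R inner nbg N nb_irr nb_vertex inner_vertex inner_ok nb_pole uniq_inner
  inner_gt0 N0 pt (zr R width) (zr R Z.one) 19%positive objs dr objs1 objs2 objs3).
- by rewrite ptc; [rewrite /gpt -zrN|left].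
- by rewrite ptc; [|right; left].
- by rewrite ptc; [|right; right; left].
- exact: (@zr_lt R Z0 width).
- exact: (@zr_lt R Z0 Z.one).
- by move=> v hv; have [vv pv] := inner_ok hv; have [_ _ _ H] := ins v vv; exact: H.
Qed.

Theorem theorem1 (R : realType) :
  exists G : sgraph, planar R G /\ ~ admits_book_embedding G 3.
Proof.
(* One copy more than there are types, so that two copies have the same type. *)
exists (gluing inner #|{: ctype inner}|.+1 nb_irr).
split; [exact: gluing_planar|exact: gluing_no_book].
Qed.
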